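(* Let $p>2$, $f=2$, $q=p^2$, $k=(k_0,k_1)$ with $r_i=k_i-2\ge q$, and suppose $r=r_0+pr_1\equiv a_0\pmod{q-1}$ with $1\le a_0\le p-1$ (i.e. $a=a_0+pa_1$ with $a_1=0$). Assume $p\nmid r_1$, that $p\mid r_0$ if $a_0=1$, and that $a_p$ lies in a finite extension of $\mathbb{Q}_{p^2}$ with $v(a_p)\in(\frac12,1)$. Then the map $\mathrm{ind}_{KZ}^G\mathrm{soc}(Q)\to\bar\Theta_{k_0,k_1,a_p}$ vanishes on $T(\mathrm{ind}_{KZ}^G\mathrm{soc}(Q))$, i.e. it factors through $T$.
   Context: Setting with $f=2$: $\mathbb{Q}_{p^2}$ unramified quadratic over $\mathbb{Q}_p$, ring of integers $\mathbb{Z}_{p^2}$, residue field $\mathbb F_{q}$, Teichmüller lifts $[\lambda]$; $G=\mathrm{GL}_2(\mathbb{Q}_{p^2})$, $K=\mathrm{GL}_2(\mathbb{Z}_{p^2})$, $Z$ the center, $\Gamma=\mathrm{GL}_2(\mathbb F_q)$, $v(p)=1$. For a ring $R$, $V(R)=\mathrm{Sym}^{r_0}R^2\otimes\mathrm{Sym}^{r_1}R^2$ is modeled on polynomials homogeneous of degree $r_i$ in $(X_i,Y_i)$, $i=0,1$; $\begin{pmatrix}a&b\\c&d\end{pmatrix}\in K$ acts by $v\mapsto v(a^{\sigma^i}X_i+c^{\sigma^i}Y_i,b^{\sigma^i}X_i+d^{\sigma^i}Y_i)$ ($\sigma$ Frobenius), $p\in Z$ acts trivially. $[g,v]$ is the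 function supported on $KZg^{-1}$ with $g'\mapsto g'g\cdot v$. Hecke operator: $T([g,v])=\sum_{\lambda\in\mathbb F_q}[g\begin{pmatrix}p&[\lambda]\\0&1\end{pmatrix},v(X_i,(-[\lambda])^{p^i}X_i+pY_i)]+[g\begin{pmatrix}1&0\\0&p\end{pmatrix},v(pX_i,Y_i)]$; on the induction of a mod $p$ weight $\mathrm{Sym}^{s_0}\otimes\mathrm{Sym}^{s_1}\otimes\det^m$ it is $T([g,v])=\sum_\lambda[g\begin{pmatrix}p&[\lambda]\\0&1\end{pmatrix},v(X_i,(-\lambda)^{p^i}X_i)]+[g\begin{pmatrix}1&0\\0&p\end{pmatrix},v(0,Y_i)]$. For $a_p$ in a finite extension $E$ (ring of integers $\mathcal O_E$, residue field $k_E$): $\Theta_{k,a_p}$ is the image of $\mathrm{ind}_{KZ}^GV(\mathcal O_E)$ in $\mathrm{ind}_{KZ}^GV(E)/(T-a_p)$ and $\bar\Theta_{k,a_p}=\Theta_{k,a_p}\otimes k_E$, with natural surjection $\mathrm{ind}_{KZ}^GV_r\twoheadrightarrow\bar\Theta_{k,a_p}$, $V_r=V(\bar{\mathbb F}_p)$. Let $\theta_0=X_0Y_1^p-Y_0X_1^p$, $\theta_1=X_1Y_0^p-Y_1X_0^p$, $V_r^*$ the subspace of elements $\theta_0P_0+\theta_1P_1$ of $V_r$, $X_r$ the $\Gamma$-submodule generated by $X_0^{r_0}X_1^{r_1}$, $Q=V_r/(V_r^*+X_r)$; under the hypotheses the surjection factors through $\mathrm{ind}_{KZ}^GQ\twoheadrightarrow\bar\Theta_{k,a_p}$,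 and the map in the claim is its restriction to $\mathrm{ind}_{KZ}^G\mathrm{soc}(Q)\subseteq\mathrm{ind}_{KZ}^GQ$. *)

(* Defs.v *)
From HB Require Import structures.
From mathcomp Require Import all_boot all_order all_algebra all_field.
From mathcomp Require Import generic_quotient ring_quotient.
From mathcomp Require Import boolp functions.
From mathcomp Require Import freeg mpoly.

Set Implicit Arguments.
Unset Strict Implicit.
Unset Printing Implicit Defensive.

Import Order.TTheory GRing.Theory Num.Theory.
Local Open Scope ring_scope.

Section SpanQuotient.
Variables (R : nzRingType) (V : lmodType R) (P : V -> Prop).

Inductive span : V -> Prop :=
| span_zero : span 0
| span_step c u v : P u -> span v -> span (c *: u + v).

Definition spanb : {pred V} := fun x => `[< span x >].

Lemma spanbP x : reflect (span x) (x \in spanb).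
Proof. exact: asboolP. Qed.

Lemma spanD x y : span x -> span y -> span (x + y).
Proof.
move=> sx sy; elim: sx => [|c u v Pu _ IH]; first by rewrite add0r.
by rewrite -addrA; apply: span_step.
Qed.

Lemma spanZ a x : span x -> span (a *: x).
Proof.
elim=> [|c u v Pu _ IH]; first by rewrite scaler0; apply: span_zero.
by rewrite scalerDr scalerA; apply: span_step.
Qed.

Lemma span_zmod_closed : zmod_closed spanb.
Proof.
split; first by apply/spanbP; apply: span_zero.
move=> x y /spanbP sx /spanbP sy; apply/spanbP.
by rewrite -scaleN1r; apply/spanD/spanZ.
Qed.

HB.instance Definition _ := GRing.isZmodClosed.Build V spanb span_zmod_closed.

(** [quo P] is the quotient of [V] by the submodule generated by [P]. *)
Definition quo : Type := Quotient.quot spanb.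
HB.instance Definition _ := GRing.Zmodule.on quo.

Definition toquo (x : V) : quo := \pi_(Quotient.quot spanb)%qT x.
Definition ofquo (x : quo) : V := repr (x : Quotient.quot spanb).

Lemma ofquoK : cancel ofquo toquo.
Proof. exact: reprK. Qed.

Lemma toquo_eq x y : toquo x = toquo y <-> span (x - y).
Proof.
split=> [/eqP|sxy].
  by rewrite /toquo -Quotient.idealrBE => /spanbP.
by apply/eqP; rewrite /toquo -Quotient.idealrBE; apply/spanbP.
Qed.

Lemma toquo_zmod : zmod_morphism toquo.
Proof. exact: raddfB. Qed.

Definition scalequo (c : R) (x : quo) : quo := toquo (c *: ofquo x).

Lemma scalequo_to c x : scalequo c (toquo x) = toquo (c *: x).
Proof.
apply/toquo_eq; rewrite -scalerBr; apply: spanZ.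
by apply/toquo_eq; rewrite ofquoK.
Qed.

Fact quo_scaleA a b v : scalequo a (scalequo b v) = scalequo (a * b) v.
Proof. by rewrite -[v]ofquoK !scalequo_to scalerA. Qed.

Fact quo_scale1 : left_id 1 scalequo.
Proof. by move=> v; rewrite -[v]ofquoK scalequo_to scale1r. Qed.

Let toquoD x y : toquo (x + y) = toquo x + toquo y.
Proof.
by have /= := raddfD (\pi_(Quotient.quot spanb)%qT) x y.
Qed.

Fact quo_scaleDr : right_distributive scalequo +%R.
Proof.
move=> a x y; rewrite -[x]ofquoK -[y]ofquoK -toquoD !scalequo_to.
by rewrite scalerDr toquoD.
Qed.

Fact quo_scaleDl v : {morph scalequo^~ v : a b / a + b}.
Proof.
by move=> a b; rewrite -[v]ofquoK !scalequo_to scalerDl toquoD.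
Qed.

HB.instance Definition _ := GRing.Zmodule_isLmodule.Build R quo
  quo_scaleA quo_scale1 quo_scaleDr quo_scaleDl.

HB.instance Definition _ := GRing.isZmodMorphism.Build V quo toquo toquo_zmod.

Fact toquo_scalable : scalable toquo.
Proof. by move=> a x; rewrite -scalequo_to. Qed.

HB.instance Definition _ := GRing.isScalable.Build R V quo *:%R toquo
  toquo_scalable.

End SpanQuotient.

(** The value of a valuation at 0 is irrelevant; [vge v N x] reads
    v(x) >= N and [vgt v N x] reads v(x) > N, with v(0) = +oo. *)
Definition vge (F : fieldType) (A : realDomainType) (v : F -> A) (N : A) (x : F)
  : bool := (x == 0) || (N <= v x).

Definition vgt (F : fieldType) (A : realDomainType) (v : F -> A) (N : A) (x : F)
  : bool := (x == 0) || (N < v x).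

Definition is_valuation (F : fieldType) (A : realDomainType) (v : F -> A) : Prop :=
  (forall x y, x != 0 -> y != 0 -> v (x * y) = v x + v y) /\
  (forall N x y, vge v N x -> vge v N y -> vge v N (x + y)).

(** The field of p-adic numbers: a field complete for a valuation with
    v(p) = 1 and in which the rationals are dense. *)
Definition is_Qp (p : nat) (F : fieldType) (v : F -> int) : Prop :=
  [/\ is_valuation v,
      p%:R != 0 :> F /\ v p%:R = 1,
      forall (N : int) (x : F), exists t : rat, vge v N (x - ratr t)
    & forall u : nat -> F,
        (forall N : int, exists n0 : nat, forall m n : nat,
           (n0 <= m)%N -> (n0 <= n)%N -> vge v N (u m - u n)) ->
        exists l : F, forall N : int, exists n0 : nat, forall n : nat,
          (n0 <= n)%N -> vge v N (u n - l)].

(** [red], restricted to the valuation ring, is a ring morphism whose kernel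
    is the maximal ideal; its values elsewhere are irrelevant. *)
Definition is_residue_map (F : fieldType) (A : realDomainType) (v : F -> A)
    (k : fieldType) (red : F -> k) : Prop :=
  [/\ red 1 = 1,
      forall x y, vge v 0 x -> vge v 0 y -> red (x + y) = red x + red y,
      forall x y, vge v 0 x -> vge v 0 y -> red (x * y) = red x * red y
    & forall x, vge v 0 x -> (red x == 0) = vgt v 0 x].

(** [Qp <= F <= E] with [F] the unramified quadratic extension of [Qp] and [E]
    a finite extension of [F]; all valuations are normalised by v(p) = 1.
    [Fq] is the residue field of [F], [sigma] the Frobenius and [teich] the
    Teichmueller lift.  The coefficient field [k] contains the
    residue field of [E] (embedded by [redE]): it may be that residue field
    itself or an algebraic closure of it. *)
Record setting (p : nat) := Setting {
  Qp : fieldType;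
  vp : Qp -> int;
  QpP : is_Qp p vp;

  F : fieldExtType Qp;
  dimF : \dim {: F} = 2%N;
  vF : F -> int;
  vFP : is_valuation vF;
  vFE : forall x : Qp, x != 0 -> vF x%:A = vp x;

  Fq : finFieldType;
  cardFq : #|Fq| = (p ^ 2)%N;
  redF : F -> Fq;
  redFP : is_residue_map vF redF;
  redF_surj : forall c : Fq, exists2 x : F, vge vF 0 x & redF x = c;

  sigma : {rmorphism F -> F};
  sigma_Qp : forall x : Qp, sigma x%:A = x%:A;
  sigma_red : forall x : F, vge vF 0 x ->
    vge vF 0 (sigma x) /\ redF (sigma x) = redF x ^+ p;

  teich : Fq -> F;
  teich_red : forall c : Fq, vge vF 0 (teich c) /\ redF (teich c) = c;
  teich_exp : forall c : Fq, teich c ^+ (p ^ 2) = teich c;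

  E : fieldExtType F;
  vE : E -> rat;
  vEP : is_valuation vE;
  vEE : forall x : F, x != 0 -> vE x%:A = (vF x)%:~R;

  k : fieldType;
  redE : E -> k;
  redEP : is_residue_map vE redE;
  iota : {rmorphism Fq -> k};
  redE_F : forall x : F, vge vF 0 x -> redE x%:A = iota (redF x)
}.

Section Polynomials.
Variable R : comNzRingType.

Definition X0 : {mpoly R[4]} := 'X_(@Ordinal 4 0 isT).
Definition Y0 : {mpoly R[4]} := 'X_(@Ordinal 4 1 isT).
Definition X1 : {mpoly R[4]} := 'X_(@Ordinal 4 2 isT).
Definition Y1 : {mpoly R[4]} := 'X_(@Ordinal 4 3 isT).

Definition bihom (r0 r1 : nat) (v : {mpoly R[4]}) : Prop :=
  forall m : 'X_{1..4}, m \in msupp v ->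
    (m (@Ordinal 4 0 isT) + m (@Ordinal 4 1 isT))%N = r0 /\
    (m (@Ordinal 4 2 isT) + m (@Ordinal 4 3 isT))%N = r1.

Definition mx2 (T : Type) (a b c d : T) : 'M[T]_2 :=
  \matrix_(i, j) if i == 0 then (if j == 0 then a else b)
                 else (if j == 0 then c else d).

(** For [Ai = mx2 ai bi ci di] this is
    v(a0 X0 + c0 Y0, b0 X0 + d0 Y0, a1 X1 + c1 Y1, b1 X1 + d1 Y1). *)
Definition subst2 (A0 A1 : 'M[R]_2) (v : {mpoly R[4]}) : {mpoly R[4]} :=
  v \mPo [tuple A0 0 0 *: X0 + A0 1 0 *: Y0;
                A0 0 1 *: X0 + A0 1 1 *: Y0;
                A1 0 0 *: X1 + A1 1 0 *: Y1;
                A1 0 1 *: X1 + A1 1 1 *: Y1].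

End Polynomials.

Section Setting.
Variables (p : nat) (S : setting p).

Local Notation F := (F S).
Local Notation Fq := (Fq S).
Local Notation E := (E S).
Local Notation k := (k S).
Local Notation vF := (@vF p S).
Local Notation vE := (@vE p S).
Local Notation iota := (@iota p S).
Local Notation sigma := (@sigma p S).
Local Notation teich := (@teich p S).

Definition inK (g : 'M[F]_2) : Prop :=
  (forall i j, vge vF 0 (g i j)) /\ (\det g != 0 /\ vF (\det g) = 0).

Definition inKZ (g : 'M[F]_2) : Prop :=
  exists z kappa, [/\ z != 0, inK kappa & g = z *: kappa].

(** If g = p^n kappa with kappa in K then v(det g) = 2n and
    [Kpart g = kappa]; as p acts trivially, KZ acts through [Kpart]. *)
Definition Kpart (g : 'M[F]_2) : 'M[F]_2 :=
  p%:R ^ (- (vF (\det g) %/ 2)%Z) *: g.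

Section Induction.
(** [W] carries an action [act] of K, and [inW] is a stable submodule.
    G is the set of invertible elements of ['M[F]_2]. *)
Variables (A : nzRingType) (W : lmodType A).
Variables (inW : W -> Prop) (act : 'M[F]_2 -> W -> W).

Definition ind (f : 'M[F]_2 -> W) : Prop :=
  [/\ forall g, inW (f g),
      forall g, g \notin unitmx -> f g = 0,
      forall h g, inKZ h -> g \in unitmx -> f (h *m g) = act (Kpart h) (f g)
    & exists s : seq 'M[F]_2, all (mem unitmx) s /\
        forall g, f g != 0 -> exists2 h, h \in s & inKZ (g *m h)].

Definition bra (g : 'M[F]_2) (v : W) : 'M[F]_2 -> W :=
  fun g' => if `[< inKZ (g' *m g) >] then act (Kpart (g' *m g)) v else 0.

(** Hecke operators T([g, v]) =
      sum_lambda [g (p [lambda]; 0 1), a lambda v] + [g (1 0; 0 p), b v]. *)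
Variables (a : Fq -> W -> W) (b : W -> W).

Definition hecke_bra (g : 'M[F]_2) (v : W) : 'M[F]_2 -> W :=
  \sum_(lam : Fq) bra (g *m mx2 p%:R (teich lam) 0 1) (a lam v)
  + bra (g *m mx2 1 0 0 p%:R) (b v).

(** The graph of the additive extension of [hecke_bra] to the induction:
    [hecke f f'] means f' = T f. *)
Definition hecke (f f' : 'M[F]_2 -> W) : Prop :=
  exists s : seq ('M[F]_2 * W),
    [/\ forall x, x \in s -> x.1 \in unitmx /\ inW x.2,
        f = \sum_(x <- s) bra x.1 x.2
      & f' = \sum_(x <- s) hecke_bra x.1 x.2].

End Induction.

Definition actE (g : 'M[F]_2) : {mpoly E[4]} -> {mpoly E[4]} :=
  subst2 (map_mx (fun x => x%:A) g) (map_mx (fun x => (sigma x)%:A) g).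

Definition inVO (r0 r1 : nat) (v : {mpoly E[4]}) : Prop :=
  bihom r0 r1 v /\ forall m, vge vE 0 v@_m.

Definition indVO (r0 r1 : nat) := ind (inVO r0 r1) actE.

Definition heckeE (r0 r1 : nat) :=
  hecke (@bihom E r0 r1) actE
    (fun lam => let t : E := (teich lam)%:A in
       subst2 (mx2 1 (- t) 0 p%:R) (mx2 1 ((- t) ^+ p) 0 p%:R))
    (subst2 (mx2 p%:R 0 0 1) (mx2 p%:R 0 0 1)).

Definition TsubE (r0 r1 : nat) (ap : E) (f : 'M[F]_2 -> {mpoly E[4]}) : Prop :=
  exists h h', heckeE r0 r1 h h' /\ f = h' - ap *: h.

(** Contains ind V(E) / (T - ap); [TsubE] is taken inside ind V(E), so
    quotienting the whole function space does no harm. *)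
Definition PiE (r0 r1 : nat) (ap : E) := quo (TsubE r0 r1 ap).

Definition inTheta (r0 r1 : nat) (ap : E) (y : PiE r0 r1 ap) : Prop :=
  exists2 f, indVO r0 r1 f & y = toquo _ f.

Definition Theta (r0 r1 : nat) (ap : E) :=
  {y : PiE r0 r1 ap | `[< inTheta y >]}.

(** [ThetaBar] is the tensor product of [Theta] and [k] over the ring of
    integers of [E]: the [k]-vector space with one generator for each element
    of [Theta], modulo additivity and compatibility with integral scalars. *)
Definition tensor_rel (r0 r1 : nat) (ap : E) (x : {freeg (Theta r0 r1 ap) / k})
    : Prop :=
  (exists y1 y2 y3 : Theta r0 r1 ap,
     val y3 = val y1 + val y2 /\ x = << y3 >> - << y1 >> - << y2 >>) \/
  (exists (c : E) (y1 y2 : Theta r0 r1 ap),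
     [/\ vge vE 0 c, val y2 = c *: val y1
       & x = << y2 >> - redE c *: << y1 >>]).

Definition ThetaBar (r0 r1 : nat) (ap : E) := quo (@tensor_rel r0 r1 ap).

Definition tensor1 (r0 r1 : nat) (ap : E) (y : Theta r0 r1 ap)
  : ThetaBar r0 r1 ap := toquo _ << y >>.

Definition actGamma (g : 'M[Fq]_2) : {mpoly k[4]} -> {mpoly k[4]} :=
  subst2 (map_mx iota g) (map_mx (fun x => iota x ^+ p) g).

Definition theta0 : {mpoly k[4]} := X0 k * Y1 k ^+ p - Y0 k * X1 k ^+ p.
Definition theta1 : {mpoly k[4]} := X1 k * Y0 k ^+ p - Y1 k * X0 k ^+ p.

Definition inVstar (r0 r1 : nat) (v : {mpoly k[4]}) : Prop :=
  bihom r0 r1 v /\ exists P0 P1, v = theta0 * P0 + theta1 * P1.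

Definition inXr (r0 r1 : nat) : {mpoly k[4]} -> Prop :=
  span (fun v => exists2 g : 'M[Fq]_2, g \in unitmx &
                   v = actGamma g (X0 k ^+ r0 * X1 k ^+ r1)).

(** The quotient of all polynomials by V_r^* + X_r; the space Q is the image
    of V_r in it. *)
Definition Q (r0 r1 : nat) :=
  quo (fun v : {mpoly k[4]} => inVstar r0 r1 v \/ inXr r0 r1 v).

Definition prQ (r0 r1 : nat) (v : {mpoly k[4]}) : Q r0 r1 := toquo _ v.

Definition inQ (r0 r1 : nat) (x : Q r0 r1) : Prop :=
  exists2 v, bihom r0 r1 v & x = prQ r0 r1 v.

(** Well defined on classes because V_r^* and X_r are stable. *)
Definition actGammaQ (r0 r1 : nat) (g : 'M[Fq]_2) (x : Q r0 r1) : Q r0 r1 :=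
  prQ r0 r1 (actGamma g (ofquo x)).

Definition actQ (r0 r1 : nat) (g : 'M[F]_2) : Q r0 r1 -> Q r0 r1 :=
  actGammaQ (map_mx (@redF p S) g).

Definition Gamma_submodule (r0 r1 : nat) (M : Q r0 r1 -> Prop) : Prop :=
  [/\ forall x, M x -> inQ x,
      M 0,
      forall c x y, M x -> M y -> M (c *: x + y)
    & forall g x, g \in unitmx -> M x -> M (actGammaQ g x)].

Definition Gamma_simple (r0 r1 : nat) (M : Q r0 r1 -> Prop) : Prop :=
  [/\ Gamma_submodule M,
      exists2 x, M x & x != 0
    & forall N, Gamma_submodule N -> (forall x, N x -> M x) ->
        (forall x, N x -> x = 0) \/ (forall x, M x -> N x)].

Definition socQ (r0 r1 : nat) : Q r0 r1 -> Prop :=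
  span (fun x => exists2 M, Gamma_simple M & M x).

Definition indQ (r0 r1 : nat) := ind (@inQ r0 r1) (@actQ r0 r1).
Definition indSocQ (r0 r1 : nat) := ind (@socQ r0 r1) (@actQ r0 r1).

(** The weight Sym^s0 (x) Sym^s1 (x) det^m, carried by [bihom s0 s1]. *)
Definition actWtGamma (m : nat) (g : 'M[Fq]_2) (v : {mpoly k[4]})
  : {mpoly k[4]} := iota (\det g) ^+ m *: actGamma g v.

Definition actWt (m : nat) (g : 'M[F]_2) : {mpoly k[4]} -> {mpoly k[4]} :=
  actWtGamma m (map_mx (@redF p S) g).

Definition heckeWt (s0 s1 m : nat) :=
  hecke (@bihom k s0 s1) (actWt m)
    (fun lam => let t : k := iota lam in
       subst2 (mx2 1 (- t) 0 0) (mx2 1 ((- t) ^+ p) 0 0))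
    (subst2 (mx2 0 0 0 1) (mx2 0 0 0 1)).

Definition wt_hom (r0 r1 s0 s1 m : nat)
    (j : {linear {mpoly k[4]} -> Q r0 r1}) : Prop :=
  (forall v, bihom s0 s1 v -> socQ (j v)) /\
  (forall g v, g \in unitmx -> bihom s0 s1 v ->
     j (actWtGamma m g v) = actGammaQ g (j v)).

(** [T] is the Hecke operator on ind soc(Q).  As soc(Q) is a direct sum of
    weights, [T] is determined by linearity and by its restriction to the
    induction of each weight occurring in soc(Q).  (It does not come from an
    operator on ind V_r: the formula defining T on ind V_r induces 0 on
    ind Q.) *)
Definition is_hecke_socQ (r0 r1 : nat)
    (T : ('M[F]_2 -> Q r0 r1) -> ('M[F]_2 -> Q r0 r1)) : Prop :=
  (forall (c : k) x y, indSocQ x -> indSocQ y ->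
     T (c *: x + y) = c *: T x + T y) /\
  (forall s0 s1 m (j : {linear {mpoly k[4]} -> Q r0 r1}),
     (s0 < p)%N -> (s1 < p)%N -> wt_hom s0 s1 m j ->
     forall f f', heckeWt s0 s1 m f f' -> T (j \o f) = j \o f').

(** [phi] is the k-linear map ind Q -> ThetaBar through which the natural
    surjection ind V_r -> ThetaBar factors; the latter sends the reduction of
    an element [f] of ind V(O_E) to (class of f) (x) 1. *)
Definition natural_on_indQ (r0 r1 : nat) (ap : E)
    (phi : ('M[F]_2 -> Q r0 r1) -> ThetaBar r0 r1 ap) : Prop :=
  (forall (c : k) x y, indQ x -> indQ y ->
     phi (c *: x + y) = c *: phi x + phi y) /\
  (forall f (y : Theta r0 r1 ap), indVO r0 r1 f -> val y = toquo _ f ->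
     phi (fun g => prQ r0 r1 (map_mpoly (@redE p S) (f g))) = tensor1 y).

End Setting.

Arguments vE {p s}.
Arguments indSocQ {p} S r0 r1.
Arguments Q {p} S r0 r1.

(* Main.v *)
From HB Require Import structures.
From mathcomp Require Import all_boot all_order all_algebra all_field.
From mathcomp Require Import generic_quotient ring_quotient.
From mathcomp Require Import boolp functions.
From mathcomp Require Import freeg mpoly.
From mathcomp Require Import ring zify.
Require Import Defs.

Set Implicit Arguments.
Unset Strict Implicit.
Unset Printing Implicit Defensive.

Import Order.TTheory GRing.Theory Num.Theory.
Local Open Scope ring_scope.

(** The natural map sends [g, v] to the class [tau g v] of [g, v~], for any
    integral lift v~ of v; it kills [V_r^*] and [X_r] because T [g, v~] is then
    divisible by p or is congruent to a single bracket, while v(ap) < 1.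

    A class in Q is determined by the values of a polynomial on pairs
    [(x, y, x^p, y^p)] with x, y in [Fq], that is by polynomials in two
    variables with each exponent taken modulo q - 1.  Acting with the unipotent
    radical one finds that every nonzero submodule contains the class of
    [X_0^r0 X_1^(r1-1) Y_1], and therefore that the socle is at most the weight
    [Sym^(a0-1) (x) Sym^(p-2) (x) det^p], the image of [j0].

    For this weight the formula for T on brackets reduces the vanishing to one
    relation per monomial, [hecke_relation].  It is obtained by applying
    [T - ap] to [p^-1 [g, y]], where y is a sum of translates of the lowest
    monomial twisted by a power of the Teichmueller character, plus a
    correction term multiplied by [ap / p]: the first-order terms in p of
    [T [g, y]] are power sums over [Fq], the coefficient r1 (prime to p) can be
    inverted, and the coefficient r0 only appears when a0 = 1, where p divides
    it.  The error has valuation at least [2 v(ap) - 1 > 0]. *)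

(** The formula for [T] on [ind V_r] induces zero on [ind Q], so the Hecke operator of the socle
    weight is visible only in the first-order terms in p; this forces the division by p. As [p^-1
    [g, y]] is not integral, [ap] times it cannot be discarded and has to be cancelled, whence the
    correction term. The twist in y is found as follows. [T] turns the translate by m of the lowest
    monomial into powers of m - l, and the first-order part along [Y_1] has exponent r - p,
    congruent to (a0 - 1) + p (p - 1) modulo q - 1. Multiplying by m^n with n = i + p j + p - a0 and
    summing over m extracts from its expansion exactly the term of the monomial with exponents (i,
    j), while the zeroth-order sums vanish modulo p. *)

(** * Valuations and residue maps *)

Section Valuation.
Variables (F : fieldType) (A : realDomainType) (v : F -> A).
Hypothesis vP : is_valuation v.

Lemma val1 : v 1 = 0.
Proof.
have := vP.1 1 1 (oner_neq0 _) (oner_neq0 _).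
by rewrite mulr1 => /eqP; rewrite -subr_eq0 opprD addrA subrr sub0r oppr_eq0 => /eqP.
Qed.

Lemma valN1 : v (- 1) = 0.
Proof.
have n0 : -1 != 0 :> F by rewrite oppr_eq0 oner_neq0.
have := vP.1 _ _ n0 n0; rewrite mulrNN mulr1 val1 => /esym/eqP.
by rewrite -mulr2n mulrn_eq0 /= => /eqP.
Qed.

Lemma valV x : x != 0 -> v x^-1 = - v x.
Proof.
move=> x0; have := vP.1 _ _ x0 (invr_neq0 x0); rewrite mulfV // val1.
by move/esym/eqP; rewrite addrC addr_eq0 => /eqP.
Qed.

Lemma valX x n : x != 0 -> v (x ^+ n) = v x *+ n.
Proof.
move=> x0; elim: n => [|n IH]; first by rewrite expr0 val1.
by rewrite exprS vP.1 ?expf_neq0 // IH mulrS.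
Qed.

Lemma vge_0 N : vge v N 0. Proof. by rewrite /vge eqxx. Qed.

Lemma vgeW N M x : N <= M -> vge v M x -> vge v N x.
Proof. by rewrite /vge => NM /orP[->//|/(le_trans NM) ->]; rewrite orbT. Qed.

Lemma vgeD N x y : vge v N x -> vge v N y -> vge v N (x + y).
Proof. exact: vP.2. Qed.

Lemma vgeM N M x y : vge v N x -> vge v M y -> vge v (N + M) (x * y).
Proof.
rewrite /vge; case: eqVneq => [->|x0] /=; first by rewrite mul0r eqxx.
case: eqVneq => [->|y0] /= vx vy; first by rewrite mulr0 eqxx.
by rewrite vP.1 // lerD // orbT.
Qed.

Lemma vgeMl N x y : vge v 0 x -> vge v N y -> vge v N (x * y).
Proof. by move=> vx vy; rewrite -[N]add0r vgeM. Qed.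

Lemma vge_1 : vge v 0 1. Proof. by rewrite /vge val1 lexx orbT. Qed.

Lemma vgeN N x : vge v N x -> vge v N (- x).
Proof. by rewrite -mulN1r; apply: vgeMl; rewrite /vge valN1 lexx orbT. Qed.

Lemma vgeB N x y : vge v N x -> vge v N y -> vge v N (x - y).
Proof. by move=> vx vy; apply/vgeD/vgeN. Qed.

Lemma vgeX x n : vge v 0 x -> vge v 0 (x ^+ n).
Proof. by move=> vx; elim: n => [|n IH]; rewrite ?vge_1 // exprS vgeMl. Qed.

Lemma vge_sum (I : Type) (r : seq I) (P : pred I) (f : I -> F) N :
  (forall i, P i -> vge v N (f i)) -> vge v N (\sum_(i <- r | P i) f i).
Proof. by move=> vf; apply: (big_ind (vge v N)) => //; [apply: vge_0|apply: vgeD]. Qed.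

Lemma vge_nat n : vge v 0 n%:R.
Proof. by elim: n => [|n IH]; rewrite ?vge_0 // -natr1 vgeD ?vge_1. Qed.

Lemma vgt_ge x : vgt v 0 x -> vge v 0 x.
Proof. by rewrite /vge /vgt => /orP[->//|/ltW ->]; rewrite orbT. Qed.

Lemma vge_gt N x : 0 < N -> vge v N x -> vgt v 0 x.
Proof. by rewrite /vge /vgt => N0 /orP[->//|/(lt_le_trans N0) ->]; rewrite orbT. Qed.

Section Residue.
Variables (k : fieldType) (red : F -> k).
Hypothesis redP : is_residue_map v red.

Lemma red_1 : red 1 = 1. Proof. by case: redP. Qed.

Lemma red_D x y : vge v 0 x -> vge v 0 y -> red (x + y) = red x + red y.
Proof. by case: redP => _ + _ _; apply. Qed.

Lemma red_M x y : vge v 0 x -> vge v 0 y -> red (x * y) = red x * red y.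
Proof. by case: redP => _ _ + _; apply. Qed.

Lemma red_eq0 x : vge v 0 x -> (red x == 0) = vgt v 0 x.
Proof. by case: redP => _ _ _; apply. Qed.

Lemma red_gt x : vgt v 0 x -> red x = 0.
Proof. by move=> vx; apply/eqP; rewrite red_eq0 ?vgt_ge. Qed.

Lemma red_0 : red 0 = 0.
Proof. by apply: red_gt; rewrite /vgt eqxx. Qed.

Lemma red_N x : vge v 0 x -> red (- x) = - red x.
Proof.
move=> vx; apply/eqP; rewrite eq_sym eqr_oppLR -subr_eq0 opprK.
by rewrite -red_D ?vgeN // subrr red_0.
Qed.

Lemma red_B x y : vge v 0 x -> vge v 0 y -> red (x - y) = red x - red y.
Proof. by move=> vx vy; rewrite red_D ?vgeN // red_N. Qed.

Lemma red_X x n : vge v 0 x -> red (x ^+ n) = red x ^+ n.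
Proof.
move=> vx; elim: n => [|n IH]; first by rewrite !expr0 red_1.
by rewrite !exprS red_M ?vgeX // IH.
Qed.

Lemma red_nat n : red n%:R = n%:R.
Proof.
by elim: n => [|n IH]; rewrite ?red_0 // -!natr1 red_D ?vge_nat ?vge_1 // IH red_1.
Qed.

Lemma red_sum (I : Type) (r : seq I) (P : pred I) (f : I -> F) :
  (forall i, vge v 0 (f i)) ->
  red (\sum_(i <- r | P i) f i) = \sum_(i <- r | P i) red (f i).
Proof.
move=> vf; elim: r => [|i r IH]; first by rewrite !big_nil red_0.
by rewrite !big_cons; case: ifP => // _; rewrite red_D ?vge_sum // IH.
Qed.

End Residue.
End Valuation.

(** * Power sums over a finite field *)

Section PowerSums.
Variable (Fq : finFieldType).
Local Notation q := #|Fq|.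

Lemma expf_mod (x : Fq) m n :
  (0 < m)%N -> (0 < n)%N -> (m = n %[mod q - 1])%N -> x ^+ m = x ^+ n.
Proof.
have q1 := finNzRing_gt1 Fq.
case: (eqVneq x 0) => [->|x0]; first by rewrite !expr0n; case: m n => [|m] [|n].
have xq : x ^+ (q - 1) = 1.
  by apply: (mulfI x0); rewrite -exprS mulr1 subn1 prednK ?expf_card // ltnW.
move=> _ _ e; rewrite (divn_eq m (q - 1)) (divn_eq n (q - 1)) e.
by rewrite !exprD ![(_ * (q - 1))%N]mulnC !exprM xq !expr1n.
Qed.

(** The polynomial [X^n - 1] has at most n < q - 1 roots, so it cannot vanish at all nonzero
    elements. *)
Lemma exists_expf_neq1 n : (0 < n < q - 1)%N -> exists2 x : Fq, x != 0 & x ^+ n != 1.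
Proof.
move=> /andP[n0 nq].
case: (boolP [exists x : Fq, (x != 0) && (x ^+ n != 1)]).
  by move/existsP=> [x /andP[]]; exists x.
rewrite negb_exists => /forallP H.
have pn : 'X^n - 1 != 0 :> {poly Fq} by rewrite -size_poly_eq0 size_XnsubC.
have := max_poly_roots (rs := enum (predC1 (0 : Fq))) pn.
have -> : all (root ('X^n - 1)) (enum (predC1 (0 : Fq))).
  apply/allP => x; rewrite mem_enum => x0.
  have := H x; rewrite -[x != 0]/(x \in predC1 0) x0 /= negbK => /eqP xn.
  by rewrite rootE !hornerE xn subrr.
move=> /(_ isT (enum_uniq _)); rewrite -cardE cardC1 size_XnsubC // ltnS -subn1.
by rewrite leqNgt nq.
Qed.

(** Multiplying the variable by some x with [x ^+ n != 1] permutes the terms and scales the sum by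
    [x ^+ n]. *)
Lemma power_sum_eq0 n : (0 < n < q - 1)%N -> \sum_(x : Fq) x ^+ n = 0.
Proof.
move=> /exists_expf_neq1[x x0 xn]; set s := \sum_x _.
have sx : x ^+ n * s = s.
  rewrite mulr_sumr /s [RHS](reindex_onto ( *%R x) ( *%R x^-1)) /=; last first.
    by move=> y _; rewrite mulVKf.
  by apply: eq_big => [y|y _]; rewrite ?mulKf ?eqxx // exprMn.
apply/eqP; move/eqP: sx; rewrite -subr_eq0 -{2}[s]mul1r -mulrBl mulf_eq0.
by rewrite subr_eq0 (negPf xn).
Qed.

Lemma power_sum_card : \sum_(x : Fq) x ^+ (q - 1) = -1.
Proof.
have q1 := finNzRing_gt1 Fq.
(* Translation by 1 permutes the field, so the sum of all its elements equals itself plus [q%:R]. *)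
have q0 : q%:R = 0 :> Fq.
  have : \sum_(x : Fq) (x + 1) = \sum_(x : Fq) x.
    rewrite [RHS](reindex_onto (+%R^~ 1) (+%R^~ (- 1))) /=; last first.
      by move=> y _; rewrite subrK.
    by apply: eq_bigl => y; rewrite addrK eqxx.
  by rewrite big_split sumr_const /= => /eqP; rewrite -subr_eq0 addrAC subrr add0r => /eqP.
rewrite (bigD1 0) //= expr0n subn_eq0 leqNgt q1 /= add0r.
rewrite (eq_bigr (fun=> 1)) => [|x x0]; last first.
  by apply: (mulfI x0); rewrite -exprS mulr1 subn1 prednK ?expf_card // ltnW.
rewrite sumr_const cardC1 -subn1 mulrnBr 1?ltnW //.
by rewrite q0 sub0r.
Qed.
End PowerSums.

Lemma sum_ord_eq1 (V : nmodType) n (f : 'I_n -> V) i :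
  (forall j, j != i -> f j = 0) -> \sum_j f j = f i.
Proof. by move=> f0; rewrite (bigD1 i) //= big1 ?addr0. Qed.

Lemma sum_ord2 (V : nmodType) (f : 'I_2 -> V) : \sum_i f i = f 0 + f 1.
Proof. by rewrite !big_ord_recl big_ord0 addr0; congr (f _ + f _); apply: val_inj. Qed.

(** * Polynomials in four variables: linear extension, monomials, substitutions *)

Section LinearExtension.
Variables (n : nat) (R : nzRingType) (V : lmodType R) (B : 'X_{1..n} -> V).

(** Both [j0] and [tau] are prescribed on monomials and extended in this way. Their domain is the
    whole polynomial ring, so that homogeneity enters only as a hypothesis of lemmas. *)
Definition mlin (v : {mpoly R[n]}) : V := \sum_(m <- msupp v) v@_m *: B m.

Lemma mlin_sub (s : seq 'X_{1..n}) v :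
  uniq s -> {subset msupp v <= s} -> mlin v = \sum_(m <- s) v@_m *: B m.
Proof.
move=> us sub; rewrite [RHS](bigID (mem (msupp v))) /= [X in _ + X]big1 ?addr0.
  rewrite -big_filter; apply: perm_big.
  apply: uniq_perm; rewrite ?filter_uniq // => m.
  by rewrite mem_filter; case: (boolP (m \in msupp v)) => //= /sub ->.
by move=> m; rewrite -mcoeff_eq0 => /eqP ->; rewrite scale0r.
Qed.

Fact mlin_linear : linear mlin.
Proof.
move=> c u v.
pose s := undup (msupp u ++ msupp v ++ msupp (c *: u + v)).
have us : uniq s by apply: undup_uniq.
rewrite (mlin_sub us (v := u)); last by move=> m mu; rewrite mem_undup !mem_cat mu.
rewrite (mlin_sub us (v := v)); last first.
  by move=> m mv; rewrite mem_undup !mem_cat mv orbT.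
rewrite (mlin_sub us); last by move=> m mw; rewrite mem_undup !mem_cat mw !orbT.
rewrite scaler_sumr -big_split; apply: eq_bigr => m _ /=.
by rewrite mcoeffD mcoeffZ scalerDl scalerA.
Qed.

HB.instance Definition _ := GRing.isLinear.Build R {mpoly R[n]} V *:%R mlin mlin_linear.

Lemma mlinX m : mlin 'X_[m] = B m.
Proof. by rewrite /mlin msuppX big_seq1 mcoeffX eqxx scale1r. Qed.

End LinearExtension.

Definition mm (a b c d : nat) : 'X_{1..4} := [multinom [tuple a; b; c; d]].

Lemma mm_eta (m : 'X_{1..4}) :
  m = mm (m (@Ordinal 4 0 isT)) (m (@Ordinal 4 1 isT))
         (m (@Ordinal 4 2 isT)) (m (@Ordinal 4 3 isT)).
Proof.
apply/mnmP => -[[|[|[|[|//]]]] i]; rewrite multinomE (tnth_nth 0%N) /=;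
  by congr (_ _); apply: val_inj.
Qed.

(* Locked, since unfolding monomials makes unification of polynomials diverge. *)
HB.lock Definition mon (R : comNzRingType) (a b c d : nat) : {mpoly R[4]} :=
  X0 R ^+ a * Y0 R ^+ b * X1 R ^+ c * Y1 R ^+ d.

Section Monomials.
Variable R : comNzRingType.
Implicit Types v : {mpoly R[4]}.
Local Notation mon := (mon R).

Lemma mpolyX_mm a b c d : 'X_[mm a b c d] = mon a b c d.
Proof.
rewrite mpolyXE_id !big_ord_recr big_ord0 /= mul1r mon.unlock /X0 /Y0 /X1 /Y1.
do !congr (_ * _); rewrite multinomE (tnth_nth 0%N) /=;
  by congr ('X_ _ ^+ _); apply: val_inj.
Qed.

Lemma monM a b c d a' b' c' d' :
  mon a b c d * mon a' b' c' d' = mon (a + a') (b + b') (c + c') (d + d').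
Proof. by rewrite mon.unlock !exprD; ring. Qed.

Lemma bihom0 r0 r1 : bihom r0 r1 (0 : {mpoly R[4]}).
Proof. by move=> m; rewrite msupp0. Qed.

Lemma bihomD r0 r1 v w : bihom r0 r1 v -> bihom r0 r1 w -> bihom r0 r1 (v + w).
Proof.
by move=> hv hw m /msuppD_le; rewrite mem_cat => /orP[/hv|/hw].
Qed.

Lemma bihomZ r0 r1 c v : bihom r0 r1 v -> bihom r0 r1 (c *: v).
Proof. by move=> hv m /msuppZ_le /hv. Qed.

Lemma bihomB r0 r1 v w : bihom r0 r1 v -> bihom r0 r1 w -> bihom r0 r1 (v - w).
Proof. by move=> hv hw; rewrite -scaleN1r; apply/bihomD/bihomZ. Qed.

Lemma bihom_sum r0 r1 (I : Type) (r : seq I) (f : I -> {mpoly R[4]}) :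
  (forall i, bihom r0 r1 (f i)) -> bihom r0 r1 (\sum_(i <- r) f i).
Proof.
by move=> hf; apply: (big_ind (@bihom R r0 r1)) => //; [apply: bihom0|apply: bihomD].
Qed.

Lemma bihomM a b a' b' v w :
  bihom a b v -> bihom a' b' w -> bihom (a + a') (b + b') (v * w).
Proof.
move=> hv hw m /msuppM_le /allpairsP[[m1 m2] /= [/hv[<- <-] /hw[<- <-] ->]].
by rewrite !mnmDE; lia.
Qed.

Lemma bihomX a b n v : bihom a b v -> bihom (n * a) (n * b) (v ^+ n).
Proof.
move=> hv; elim: n => [|n IH]; last by rewrite exprS !mulSn; apply: bihomM.
by rewrite expr0 => m; rewrite -mpolyC1 msupp1 inE => /eqP ->; rewrite !mnm0E.
Qed.

Lemma bihom_mon a b c d : bihom (a + b) (c + d) (mon a b c d).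
Proof.
by move=> m; rewrite -mpolyX_mm msuppX inE => /eqP ->; rewrite !multinomE !(tnth_nth 0%N).
Qed.

(** In a fixed bidegree a monomial is known by its exponents b in [Y_0] and d in [Y_1]; evaluation
    on pairs over [Fq] only sees b + p d. *)
Definition bmon (r0 r1 b d : nat) := mon (r0 - b) b (r1 - d) d.

Lemma bihom_bmon r0 r1 b d : (b <= r0)%N -> (d <= r1)%N -> bihom r0 r1 (bmon r0 r1 b d).
Proof.
by move=> hb hd; rewrite -{1}(subnK hb) -{1}(subnK hd); apply: bihom_mon.
Qed.

Lemma bihom_ind r0 r1 (P : {mpoly R[4]} -> Prop) :
  P 0 ->
  (forall c b d v, (b <= r0)%N -> (d <= r1)%N -> P v -> P (c *: bmon r0 r1 b d + v)) ->
  forall v, bihom r0 r1 v -> P v.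
Proof.
move=> P0 PS v hv; rewrite [v]mpolyE big_seq.
have : {subset msupp v <= msupp v} by [].
rewrite -big_seq; elim: {1 3}(msupp v) => [|m s IH] sub; first by rewrite big_nil.
rewrite big_cons; have [e0 e1] := hv m (sub _ (mem_head _ _)).
have /IH Ps : {subset s <= msupp v} by move=> x xs; rewrite sub // inE xs orbT.
have -> : 'X_[m] = bmon r0 r1 (m (@Ordinal 4 1 isT)) (m (@Ordinal 4 3 isT)).
  by rewrite {1}[m]mm_eta mpolyX_mm /bmon -e0 -e1 !addnK.
by apply: PS => //; rewrite -?e0 -?e1 leq_addl.
Qed.

Lemma bihom_X0Y0 a b : bihom 1 0 (a *: X0 R + b *: Y0 R).
Proof.
have -> : X0 R = mon 1 0 0 0 by rewrite mon.unlock; ring.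
have -> : Y0 R = mon 0 1 0 0 by rewrite mon.unlock; ring.
by apply: bihomD; apply: bihomZ; apply: bihom_mon.
Qed.

Lemma bihom_X1Y1 a b : bihom 0 1 (a *: X1 R + b *: Y1 R).
Proof.
have -> : X1 R = mon 0 0 1 0 by rewrite mon.unlock; ring.
have -> : Y1 R = mon 0 0 0 1 by rewrite mon.unlock; ring.
by apply: bihomD; apply: bihomZ; apply: bihom_mon.
Qed.

Section Subst.
Variables A0 A1 : 'M[R]_2.

Fact subst2_linear : linear (subst2 A0 A1).
Proof. by move=> c u v; rewrite /subst2 linearP. Qed.
HB.instance Definition _ := GRing.isLinear.Build R {mpoly R[4]} {mpoly R[4]} *:%R
  (subst2 A0 A1) subst2_linear.
Fact subst2_monoid : monoid_morphism (subst2 A0 A1).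
Proof. by split=> [|u v]; rewrite /subst2 ?rmorph1 ?rmorphM. Qed.
HB.instance Definition _ := GRing.isMonoidMorphism.Build {mpoly R[4]} {mpoly R[4]}
  (subst2 A0 A1) subst2_monoid.

Lemma subst2_mon a b c d : subst2 A0 A1 (mon a b c d) =
  (A0 0 0 *: X0 R + A0 1 0 *: Y0 R) ^+ a * (A0 0 1 *: X0 R + A0 1 1 *: Y0 R) ^+ b *
  (A1 0 0 *: X1 R + A1 1 0 *: Y1 R) ^+ c * (A1 0 1 *: X1 R + A1 1 1 *: Y1 R) ^+ d.
Proof. by rewrite mon.unlock !rmorphM !rmorphXn /= /subst2 /X0 /Y0 /X1 /Y1 !comp_mpolyXU. Qed.

Lemma bihom_subst2 r0 r1 v : bihom r0 r1 v -> bihom r0 r1 (subst2 A0 A1 v).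
Proof.
move: v; apply: bihom_ind => [|c b d v hb hd IH].
  by rewrite linear0; apply: bihom0.
rewrite linearP /=; apply: bihomD => //; apply: bihomZ.
rewrite /bmon subst2_mon -{1}(subnK hb) -{1}(subnK hd).
have e (x y u w : nat) : @bihom R (x + y) (u + w) =
   @bihom R (x * 1 + y * 1 + u * 0 + w * 0) (x * 0 + y * 0 + u * 1 + w * 1).
  by congr bihom; lia.
rewrite e; do 3 (apply: bihomM; last by apply: bihomX; (apply: bihom_X1Y1 || apply: bihom_X0Y0)).
by apply/bihomX/bihom_X0Y0.
Qed.

Lemma meval_subst2 v (x0 y0 x1 y1 : R) :
  (subst2 A0 A1 v).@[tnth [tuple x0; y0; x1; y1]] =
  v.@[tnth [tuple A0 0 0 * x0 + A0 1 0 * y0; A0 0 1 * x0 + A0 1 1 * y0;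
                  A1 0 0 * x1 + A1 1 0 * y1; A1 0 1 * x1 + A1 1 1 * y1]].
Proof.
rewrite /subst2 comp_mpoly_meval; apply: meval_eq => -[[|[|[|[|//]]]] i];
  by rewrite !(tnth_nth 0) /= mevalD !mevalZ !mevalXU !(tnth_nth 0).
Qed.

End Subst.

Lemma mpoly_linear_ext (V : lmodType R) (f g : {linear {mpoly R[4]} -> V}) :
  (forall a b c d, f (mon a b c d) = g (mon a b c d)) -> f =1 g.
Proof.
move=> fg v; elim/mpolyind: v => [|c m v _ _ IH]; first by rewrite !linear0.
by rewrite !linearP IH [m]mm_eta mpolyX_mm fg.
Qed.

Lemma subst2M (A0 A1 B0 B1 : 'M[R]_2) v :
  subst2 A0 A1 (subst2 B0 B1 v) = subst2 (A0 *m B0) (A1 *m B1) v.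
Proof.
apply: (@mpoly_linear_ext _ (subst2 A0 A1 \o subst2 B0 B1)%FUN
  (subst2 (A0 *m B0) (A1 *m B1))) => a b c d /=.
have e (C D : 'M[R]_2) (x y : {mpoly R[4]}) j :
    D 0 j *: (C 0 0 *: x + C 1 0 *: y) + D 1 j *: (C 0 1 *: x + C 1 1 *: y)
    = (C *m D) 0 j *: x + (C *m D) 1 j *: y.
  by rewrite !mxE !sum_ord2 !scalerDr !scalerA !scalerDl addrACA ![_ * D _ _]mulrC.
have eX0 : subst2 A0 A1 (X0 R) = A0 0 0 *: X0 R + A0 1 0 *: Y0 R.
  by rewrite /subst2 {1}/X0 comp_mpolyXU.
have eY0 : subst2 A0 A1 (Y0 R) = A0 0 1 *: X0 R + A0 1 1 *: Y0 R.
  by rewrite /subst2 {1}/Y0 comp_mpolyXU.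
have eX1 : subst2 A0 A1 (X1 R) = A1 0 0 *: X1 R + A1 1 0 *: Y1 R.
  by rewrite /subst2 {1}/X1 comp_mpolyXU.
have eY1 : subst2 A0 A1 (Y1 R) = A1 0 1 *: X1 R + A1 1 1 *: Y1 R.
  by rewrite /subst2 {1}/Y1 comp_mpolyXU.
have eL s t x y : subst2 A0 A1 (s *: x + t *: y) =
    s *: subst2 A0 A1 x + t *: subst2 A0 A1 y by rewrite linearP linearZ.
rewrite !subst2_mon !rmorphM !rmorphXn /= !eL eX0 eY0 eX1 eY1 !e.
done.
Qed.

End Monomials.

(** * Cosets of KZ and compact induction *)

Section Group.
Variables (p : nat) (S : setting p).
Hypothesis p_prime : prime p.

Local Notation F := (F S).
Local Notation vF := (@vF p S).
Local Notation inK := (@inK p S).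
Local Notation inKZ := (@inKZ p S).
Local Notation Kpart := (@Kpart p S).

Lemma pF_neq0 : p%:R != 0 :> F.
Proof.
case: (QpP S) => _ [p0 _] _ _.
by rewrite -scaler_nat scaler_eq0 negb_or p0 oner_neq0.
Qed.

Lemma vF_p : vF p%:R = 1.
Proof.
case: (QpP S) => _ [p0 vp1] _ _.
by rewrite -scaler_nat vFE.
Qed.

Lemma vF_pz (n : int) : vF (p%:R ^ n) = n.
Proof.
have vX (m : nat) : vF (p%:R ^+ m) = m%:Z.
  by rewrite (valX (vFP S)) ?pF_neq0 // vF_p natz.
case: n => n; first by rewrite -exprnP vX.
by rewrite NegzE -invr_expz -exprnP (valV (vFP S)) ?vX // expf_neq0 ?pF_neq0.
Qed.

Lemma inK1 : inK 1%:M.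
Proof.
split=> [i j|]; last by rewrite det1 oner_neq0 (val1 (vFP S)).
by rewrite mxE; case: eqP => _; rewrite ?(vge_1 (vFP S)) ?vge_0.
Qed.

Lemma inKM g h : inK g -> inK h -> inK (g *m h).
Proof.
move=> [ig [dg vg]] [ih [dh vh]]; split=> [i j|].
  by rewrite mxE; apply: (vge_sum (vFP S)) => l _; apply: (vgeMl (vFP S)).
by rewrite det_mulmx mulf_neq0 // (vFP S).1 // vg vh.
Qed.

Lemma inK_unit g : inK g -> g \in unitmx.
Proof. by case=> _ [dg _]; rewrite unitmxE unitfE. Qed.

Lemma inKV g : inK g -> inK (invmx g).
Proof.
move=> Kg; case: (Kg) => ig [dg vg].
split=> [i j|]; last by rewrite det_inv invr_eq0 dg (valV (vFP S)) // vg oppr0.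
rewrite /invmx (inK_unit Kg) !mxE; apply: (vgeMl (vFP S)).
  by rewrite /vge (valV (vFP S)) // vg oppr0 lexx orbT.
rewrite /cofactor; apply: (vgeMl (vFP S)).
  by apply: (vgeX (vFP S)); apply: (vgeN (vFP S)); apply: (vge_1 (vFP S)).
by rewrite det_mx11 !mxE.
Qed.

Lemma inK_scale u g : u != 0 -> vF u = 0 -> inK g -> inK (u *: g).
Proof.
move=> u0 vu [ig [dg vg]]; split=> [i j|].
  by rewrite mxE; apply: (vgeMl (vFP S)) => //; rewrite /vge vu lexx orbT.
by rewrite detZ mulf_neq0 ?expf_neq0 // (vFP S).1 ?expf_neq0 // (valX (vFP S)) // vu mul0rn vg.
Qed.

(** The determinant of [z *: kappa] has valuation 2 v(z), which recovers the power of p; the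
    remaining unit of z is absorbed into K. *)
Lemma inKZ_scaleP g : inKZ g ->
  exists n : int, vF (\det g) = n * 2 /\ inK (p%:R ^ (- n) *: g).
Proof.
move=> [z [kap [z0 Kk ->]]]; exists (vF z); split.
  case: Kk => _ [dk vk].
  by rewrite detZ (vFP S).1 ?expf_neq0 // (valX (vFP S)) // vk addr0 mulr_natr.
rewrite scalerA; apply: inK_scale => //.
  by rewrite mulf_neq0 // expfz_neq0 // pF_neq0.
by rewrite (vFP S).1 ?expfz_neq0 ?pF_neq0 // vF_pz addrC subrr.
Qed.

Lemma inK_KZ g : inK g -> inKZ g.
Proof. by move=> Kg; exists 1, g; rewrite oner_neq0 scale1r. Qed.

Lemma inKZ_unit g : inKZ g -> g \in unitmx.
Proof. by move=> [z [h [z0 Kh ->]]]; rewrite unitmxZ ?inK_unit // unitfE. Qed.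

Lemma inKZ_M g h : inKZ g -> inKZ h -> inKZ (g *m h).
Proof.
move=> [z [g' [z0 Kg ->]]] [w [h' [w0 Kh ->]]].
exists (z * w), (g' *m h'); split; [exact: mulf_neq0 | exact: inKM|].
by rewrite -scalemxAl -scalemxAr scalerA.
Qed.

Lemma inKZ_V g : inKZ g -> inKZ (invmx g).
Proof.
move=> gKZ; case: (gKZ) => z [g' [z0 Kg e]].
exists z^-1, (invmx g'); split; [by rewrite invr_eq0|exact: inKV|].
by rewrite e invmxZ // unitmxZ ?unitfE // inK_unit.
Qed.

Lemma inKZ_Ml g h : inKZ g -> inKZ (g *m h) <-> inKZ h.
Proof.
move=> gKZ; split=> [|/(inKZ_M gKZ)//].
by move=> /(inKZ_M (inKZ_V gKZ)); rewrite mulmxA mulVmx ?inKZ_unit // mul1mx.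
Qed.

Lemma inKZ_Mr g h : inKZ h -> inKZ (g *m h) <-> inKZ g.
Proof.
move=> hKZ; split=> [|/inKZ_M/(_ hKZ)//].
by move=> /inKZ_M/(_ (inKZ_V hKZ)); rewrite -mulmxA mulmxV ?inKZ_unit // mulmx1.
Qed.

Lemma Kpart_in g : inKZ g -> inK (Kpart g).
Proof. by move=> /inKZ_scaleP[n [e]]; rewrite /Kpart e mulzK. Qed.

Lemma KpartM g h : inKZ g -> inKZ h -> Kpart (g *m h) = Kpart g *m Kpart h.
Proof.
move=> gKZ hKZ; have [n [en _]] := inKZ_scaleP gKZ; have [m [em _]] := inKZ_scaleP hKZ.
have dg : \det g != 0 by rewrite -unitfE -unitmxE inKZ_unit.
have dh : \det h != 0 by rewrite -unitfE -unitmxE inKZ_unit.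
rewrite /Kpart det_mulmx (vFP S).1 // en em -mulrDl !mulzK //.
rewrite -scalemxAl -scalemxAr scalerA opprD expfzDr //.
exact: pF_neq0.
Qed.

Lemma Kpart_id g : inK g -> Kpart g = g.
Proof. by move=> [_ [_ vg]]; rewrite /Kpart vg div0z oppr0 expr0z scale1r. Qed.

Section Induction.
Variables (A : nzRingType) (W : lmodType A).
Variables (inW : W -> Prop) (act : 'M[F]_2 -> W -> W).
Hypothesis actP : forall g, inK g -> linear (act g).
Hypothesis actM : forall g h v, inK g -> inK h -> act (g *m h) v = act g (act h v).
Local Notation bra := (bra act).
Local Notation ind := (ind inW act).

Lemma act0 g : inK g -> act g 0 = 0.
Proof.
by move=> Kg; have := actP Kg (-1) 0 0; rewrite scaler0 addr0 scaleN1r addNr.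
Qed.

Lemma bra_linear g : linear (bra g).
Proof.
move=> c u v; apply/funext => g' /=.
rewrite -[RHS]/(c *: bra g u g' + bra g v g') /bra.
by case: asboolP => [/Kpart_in/actP->//|_]; rewrite scaler0 addr0.
Qed.

Lemma bra_act g h v : inK h -> bra g (act h v) = bra (g *m h) v.
Proof.
move=> Kh; apply/funext => g'; rewrite /bra mulmxA.
have -> : `[< inKZ (g' *m g *m h) >] = `[< inKZ (g' *m g) >].
  by apply: asbool_equiv_eq; apply/inKZ_Mr/inK_KZ.
case: asboolP => // KZ.
by rewrite (KpartM KZ (inK_KZ Kh)) (Kpart_id Kh) actM //; apply: Kpart_in.
Qed.

(** The value of [choose] depends only on the extension of its predicate, so all elements of a coset
    KZ g receive the same representative. *)
Definition crep (g : 'M[F]_2) : 'M[F]_2 :=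
  choose (fun h => `[< inKZ (h *m invmx g) >]) g.

Lemma crepP g : g \in unitmx -> inKZ (crep g *m invmx g).
Proof.
move=> ug; apply/asboolP.
apply: (@chooseP _ (fun h => `[< inKZ (h *m invmx g) >]) g).
by rewrite mulmxV //; apply/asboolP/inK_KZ/inK1.
Qed.

Lemma crep_unit g : g \in unitmx -> crep g \in unitmx.
Proof. by move=> /crepP/inKZ_unit; rewrite unitmx_mul => /andP[]. Qed.

Lemma crep_eq g h : g \in unitmx -> inKZ (h *m invmx g) -> crep h = crep g.
Proof.
move=> ug hg; have uh : h \in unitmx.
  by have := inKZ_unit hg; rewrite unitmx_mul => /andP[].
have e x : inKZ (x *m invmx h) <-> inKZ (x *m invmx g).
  by rewrite -(inKZ_Mr (x *m invmx h) hg) mulmxA mulmxKV.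
rewrite /crep (@eq_choose _ _ (fun x => `[< inKZ (x *m invmx g) >])); last first.
  by move=> x; apply: asbool_equiv_eq.
apply: choose_id; first by apply/asboolP.
by rewrite mulmxV //; apply/asboolP/inK_KZ/inK1.
Qed.

Lemma crep_id g : g \in unitmx -> crep (crep g) = crep g.
Proof. by move=> ug; apply: crep_eq => //; apply: crepP. Qed.

Definition crep_list (C : seq 'M[F]_2) : Prop :=
  uniq C /\ forall c, c \in C -> c \in unitmx /\ crep c = c.

Definition supported (f : 'M[F]_2 -> W) (C : seq 'M[F]_2) : Prop :=
  forall c, c \in unitmx -> crep c = c -> f c != 0 -> c \in C.

(** Only finiteness of the support on coset representatives is kept: the map [phi] is defined and
    proved linear on all such functions, with no appeal to equivariance. *)
Definition weak_ind (f : 'M[F]_2 -> W) : Prop :=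
  exists C, crep_list C /\ supported f C.

Lemma ind_weak f : ind f -> weak_ind f.
Proof.
move=> [_ _ _ [s [us sP]]].
exists (undup [seq crep (invmx h) | h <- s]); split.
  split=> [|c]; first exact: undup_uniq.
  rewrite mem_undup => /mapP[h /(allP us) uh ->].
  have uh' : invmx h \in unitmx by rewrite unitmx_inv.
  by rewrite crep_unit // crep_id.
move=> c uc cc /sP[h hs ch]; rewrite mem_undup -cc; apply/mapP; exists h => //.
apply: crep_eq; last by rewrite invmxK.
by rewrite unitmx_inv; apply: (allP us).
Qed.

(** Equivariance carries each value from the representative of its coset, and the bracket at
    [invmx c] is supported on the coset KZ c alone. *)
Lemma ind_decomp f C : ind f -> crep_list C -> supported f C ->
  f = \sum_(c <- C) bra (invmx c) (f c).
Proof.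
move=> [fW f0 fact _] [uC CP] sf; apply/funext => g.
rewrite fct_sumE; case: (boolP (g \in unitmx)) => [ug|nug]; last first.
  rewrite f0 // big1 // => c _; rewrite /bra; case: asboolP => // /inKZ_unit.
  by rewrite unitmx_mul (negPf nug).
have gc : inKZ (g *m invmx (crep g)).
  apply/(inKZ_Ml _ (crepP ug)).
  by rewrite mulmxA mulmxKV // mulmxV ?crep_unit //; apply/inK_KZ/inK1.
have fgE : f g = act (Kpart (g *m invmx (crep g))) (f (crep g)).
  by rewrite -fact // ?mulmxKV // crep_unit.
case: (boolP (crep g \in C)) => cC.
  rewrite (bigD1_seq (crep g)) //= /bra; case: asboolP => // _.
  rewrite -fgE big_seq_cond big1 ?addr0 // => c /andP[/CP[uc cc] cg].
  by case: asboolP => // gc'; rewrite -cc (crep_eq uc gc') eqxx in cg.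
rewrite fgE (_ : f (crep g) = 0); last first.
  by apply/eqP; apply: contraNT cC => h; apply: sf; rewrite ?crep_unit ?crep_id.
rewrite (act0 (Kpart_in gc)) big_seq big1 // => c /[dup] cC' /CP[uc cc].
rewrite /bra; case: asboolP => // /(crep_eq uc) e.
by rewrite e cc cC' in cC.
Qed.

Hypothesis act_in : forall g v, inK g -> inW v -> inW (act g v).
Hypothesis inW0 : inW 0.
Hypothesis inWP : forall c u v, inW u -> inW v -> inW (c *: u + v).

Lemma bra_ind g v : g \in unitmx -> inW v -> ind (bra g v).
Proof.
move=> ug Wv; split.
- by move=> g'; rewrite /bra; case: asboolP => // KZ; apply: act_in => //; apply: Kpart_in.
- move=> g' nug; rewrite /bra; case: asboolP => // /inKZ_unit.
  by rewrite unitmx_mul (negPf nug).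
- move=> h g' hKZ ug'; rewrite /bra -mulmxA.
  have -> : `[< inKZ (h *m (g' *m g)) >] = `[< inKZ (g' *m g) >].
    by apply: asbool_equiv_eq; apply: inKZ_Ml.
  case: asboolP => KZ; last by rewrite act0 //; apply: Kpart_in.
  by rewrite KpartM // actM //; apply: Kpart_in.
- exists [:: g]; split=> [|g']; first by rewrite /= ug.
  by rewrite /bra; case: asboolP => [KZ _|]; [exists g; rewrite ?inE | rewrite eqxx].
Qed.

Lemma ind0 : ind 0.
Proof.
split=> // [h g hKZ _|]; first by rewrite act0 //; apply: Kpart_in.
by exists [::]; split=> // g; rewrite eqxx.
Qed.

Lemma indP c f f' : ind f -> ind f' -> ind (c *: f + f').
Proof.
move=> [fW f0 fact [s [us sP]]] [fW' f0' fact' [s' [us' sP']]]; split.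
- by move=> g; apply: inWP.
- by move=> g ng; rewrite -[LHS]/(c *: f g + f' g) f0 // f0' // scaler0 addr0.
- move=> h g hKZ ug; rewrite -[LHS]/(c *: f (h *m g) + f' (h *m g)).
  rewrite fact // fact' //; apply: esym; apply: actP; exact: Kpart_in.
- exists (s ++ s'); split=> [|g]; first by rewrite all_cat us us'.
  rewrite -[X in X != _]/(c *: f g + f' g).
  case: (eqVneq (f g) 0) => [->|/sP[h hs ?] _]; last first.
    by exists h => //; rewrite mem_cat hs.
  rewrite scaler0 add0r => /sP'[h hs ?].
  by exists h => //; rewrite mem_cat hs orbT.
Qed.

Lemma indD f f' : ind f -> ind f' -> ind (f + f').
Proof. by move=> If If'; rewrite -[f]scale1r; apply: indP. Qed.

Lemma ind_sum (I : eqType) (r : seq I) (f : I -> 'M[F]_2 -> W) :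
  (forall i, i \in r -> ind (f i)) -> ind (\sum_(i <- r) f i).
Proof.
elim: r => [|i r IH] If; first by rewrite big_nil; apply: ind0.
rewrite big_cons; apply: indD; first by apply: If; rewrite mem_head.
by apply: IH => j jr; apply: If; rewrite inE jr orbT.
Qed.

End Induction.
End Group.

(** * Binomial coefficients modulo p and congruences modulo two polynomials *)

Section BinomialModP.
Variables (p : nat) (K : fieldType).
Hypothesis charK : p \in [pchar K].

Let p_prime : prime p := pcharf_prime charK.

Lemma natr_eq0_pchar n : (n%:R == 0 :> K) = (p %| n)%N.
Proof. by rewrite (dvdn_pcharf charK). Qed.

Lemma natr_neq0_lt n : (0 < n < p)%N -> n%:R != 0 :> K.
Proof. by move=> /andP[n0 np]; rewrite natr_eq0_pchar gtnNdvd. Qed.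

Lemma fact_neq0_lt n : (n < p)%N -> n`!%:R != 0 :> K.
Proof.
elim: n => [|n IH] np; first by rewrite oner_neq0.
by rewrite factS natrM; apply: mulf_neq0; [apply: natr_neq0_lt | apply/IH/ltnW].
Qed.

Lemma binr_neq0_lt n m : (m <= n)%N -> (n < p)%N -> 'C(n, m)%:R != 0 :> K.
Proof.
move=> mn np; have := fact_neq0_lt np; rewrite -(bin_fact mn) natrM mulf_eq0.
by rewrite negb_or => /andP[].
Qed.

Lemma binr_p i : (0 < i < p)%N -> 'C(p, i)%:R = 0 :> K.
Proof. by move=> ip; apply/eqP; rewrite natr_eq0_pchar prime_dvd_bin. Qed.

Lemma binr_addp n : 'C(n + p, p)%:R = 'C(n, p)%:R + 1 :> K.
Proof.
have p0 := prime_gt0 p_prime.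
rewrite -binomial.Vandermonde natr_sum big_ord_recr /= subnn bin0 muln1 addrC.
congr (_ + _).
rewrite (bigD1 (Ordinal p0)) //= bin0 mul1n subn0 binn big1 ?addr0 // => i i0.
rewrite natrM binr_p ?mulr0 //; case: i i0 => i /= hi; rewrite -val_eqE /=; lia.
Qed.

(** A case of Lucas's congruence: by Vandermonde, adding p to the upper entry raises the coefficient
    by 1 modulo p. *)
Lemma binr_digit n m : (n < p)%N -> 'C(n + m * p, p)%:R = m%:R :> K.
Proof.
move=> np; elim: m => [|m IH]; first by rewrite mul0n addn0 bin_small.
by rewrite mulSn addnA [(n + p)%N]addnC -addnA addnC binr_addp IH natr1.
Qed.

Lemma binr_pred j : (j < p)%N -> 'C(p.-1, j)%:R = (-1) ^+ j :> K.
Proof.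
have p0 := prime_gt0 p_prime.
elim: j => [|j IH] jp; first by rewrite bin0 expr0.
have := binS p.-1 j; rewrite prednK // => /(congr1 (fun n => n%:R : K)).
rewrite natrD binr_p ?jp // IH 1?ltnW // => /esym/eqP.
by rewrite addr_eq0 exprS mulN1r => /eqP.
Qed.

(** Follows from (j + 1) C(p - 1, j + 1) = (p - 1) C(p - 2, j). It explains the factor 1/(j + 1) in
    [j0]: it turns the binomial coefficients of degree p - 2 into the alternating signs of a (p -
    1)-st power. *)
Lemma binr_pred2 j : (j.+1 < p)%N -> (j.+1)%:R^-1 * 'C(p.-2, j)%:R = (-1) ^+ j :> K.
Proof.
move=> jp; have p0 := prime_gt0 p_prime; have p1 := prime_gt1 p_prime.
have j0 : j.+1%:R != 0 :> K by apply: natr_neq0_lt.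
apply: (mulfI j0); rewrite mulVKf //.
have := mul_bin_diag p.-1 j; move/(congr1 (fun n => n%:R : K)).
rewrite !natrM binr_pred //.
have -> : p.-1%:R = -1 :> K.
  by apply/eqP; rewrite -subr_eq0 opprK natr1 prednK // (pcharf0 charK).
by rewrite mulN1r exprS mulN1r mulrN => /oppr_inj.
Qed.

End BinomialModP.

(** The alternating sum [S n] is [(AX + CY)^n] for [n = p - 1] in characteristic p. *)
Lemma alternating_sum_mul (K : comNzRingType) n (A B C D X Y : K) :
  let S n := \sum_(j < n.+1) (-1) ^+ j * (A * X) ^+ (n - j) * (C * Y) ^+ j in
  ~~ odd n -> (0 < n)%N ->
  S n * (B * X + D * Y) = B * A ^+ n * X ^+ n.+1 + D * C ^+ n * Y ^+ n.+1
     + (A * D - B * C) * (X * Y * S n.-1).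
Proof.
case: n => // n S en _.
have e1 : S n.+1 = (A * X) ^+ n.+1 - C * Y * S n.
  rewrite /S big_ord_recl /= expr0 mul1r subn0 expr0 mulr1; congr (_ + _).
  rewrite mulr_sumr -sumrN; apply: eq_bigr => i _.
  by rewrite /bump add1n subSS !exprS; ring.
have e2 : S n.+1 = A * X * S n + (C * Y) ^+ n.+1.
  rewrite /S big_ord_recr /= subnn expr0 mulr1 -signr_odd (negPf en) expr0 mul1r.
  congr (_ + _); rewrite mulr_sumr; apply: eq_bigr => i _ /=.
  by rewrite subSn ?exprS; [ring | case: i].
rewrite mulrDr {1}e1 e2 /= !exprMn !exprS; ring.
Qed.

Section IdealCongruence.
Variables (K : comNzRingType) (n : nat) (t0 t1 : {mpoly K[n]}).

Definition cong2 (u v : {mpoly K[n]}) : Prop :=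
  exists P0 P1, u - v = t0 * P0 + t1 * P1.

Lemma cong2_refl u : cong2 u u.
Proof. by exists 0, 0; rewrite subrr !mulr0 addr0. Qed.

Lemma cong2_trans v u w : cong2 u v -> cong2 v w -> cong2 u w.
Proof.
move=> [P0 [P1 e]] [Q0 [Q1 e']]; exists (P0 + Q0), (P1 + Q1).
have -> : u - w = (u - v) + (v - w) by rewrite addrA subrK.
by rewrite e e' addrACA -!mulrDr.
Qed.

Lemma cong2P c u u' v v' :
  cong2 u u' -> cong2 v v' -> cong2 (c *: u + v) (c *: u' + v').
Proof.
move=> [P0 [P1 e]] [Q0 [Q1 e']]; exists (c *: P0 + Q0), (c *: P1 + Q1).
by rewrite opprD addrACA -scalerBr e e' scalerDr !scalerAr addrACA -!mulrDr.
Qed.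

Lemma cong2_left u v P : u - v = t0 * P -> cong2 u v.
Proof. by move=> e; exists P, 0; rewrite e mulr0 addr0. Qed.

Lemma cong2_right u v P : u - v = t1 * P -> cong2 u v.
Proof. by move=> e; exists 0, P; rewrite e mulr0 add0r. Qed.

End IdealCongruence.

(** * Evaluation on pairs over the residue field, with kernel [V_r^*] *)

Section ResidueField.
Variables (p : nat) (S : setting p).
Hypothesis p_prime : prime p.

Local Notation Fq := (Fq S).
Local Notation k := (k S).
Local Notation iota := (@iota p S).
Local Notation q := (p ^ 2)%N.

Lemma pcharFq : p \in [pchar Fq].
Proof. exact: card_finPcharP (cardFq S) p_prime. Qed.

Lemma pchark : p \in [pchar k].
Proof. exact: rmorph_pchar iota _ pcharFq. Qed.

Lemma iota_expp (x y : Fq) : iota (x + y) ^+ p = iota x ^+ p + iota y ^+ p.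
Proof. by rewrite -!rmorphXn -rmorphD exprDn_pchar // pnatE // pcharFq. Qed.

Lemma iota_q x : iota x ^+ q = iota x.
Proof. by rewrite -rmorphXn -(cardFq S) expf_card. Qed.

Lemma iota_mod x m n :
  (0 < m)%N -> (0 < n)%N -> (m = n %[mod q - 1])%N -> iota x ^+ m = iota x ^+ n.
Proof. by rewrite -!rmorphXn -(cardFq S) => m0 n0 /(expf_mod x m0 n0) ->. Qed.

Lemma q_gt1 : (1 < q)%N.
Proof. by rewrite -(cardFq S) finNzRing_gt1. Qed.

(** Above q - 1 the exponent may be lowered by q - 1 while staying positive, so the bound 2 (q - 1)
    leaves q - 1 as the only exponent with a nonzero sum. *)
Lemma iota_power_sum n : (0 < n < 2 * (q - 1))%N ->
  \sum_(x : Fq) iota x ^+ n = if (n == q - 1)%N then -1 else 0.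
Proof.
have q1 := q_gt1 => /andP[n0 nq].
rewrite (eq_bigr (fun x => iota (x ^+ n))) => [|x _]; last by rewrite rmorphXn.
rewrite -rmorph_sum; case: eqP => [->|/eqP nq'].
  by rewrite -(cardFq S) power_sum_card rmorphN1.
case: (ltnP n (q - 1)) => nlt.
  by rewrite power_sum_eq0 ?rmorph0 // n0 cardFq.
rewrite (eq_bigr (fun x => x ^+ (n - (q - 1)))) => [|x _].
  by rewrite power_sum_eq0 ?rmorph0 // cardFq; lia.
apply: expf_mod => //; rewrite ?cardFq; first by lia.
by rewrite -[in LHS](subnK nlt) modnDr.
Qed.

Definition ev (x y : Fq) (v : {mpoly k[4]}) : k :=
  v.@[tnth [tuple iota x; iota y; iota x ^+ p; iota y ^+ p]].

Lemma evZ x y c v : ev x y (c *: v) = c * ev x y v.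
Proof. exact: mevalZ. Qed.
Lemma evD x y u v : ev x y (u + v) = ev x y u + ev x y v.
Proof. exact: mevalD. Qed.
Lemma evB x y u v : ev x y (u - v) = ev x y u - ev x y v.
Proof. exact: mevalB. Qed.
Lemma evM x y u v : ev x y (u * v) = ev x y u * ev x y v.
Proof. exact: mevalM. Qed.
Lemma ev_sum x y (I : Type) (r : seq I) (f : I -> {mpoly k[4]}) :
  ev x y (\sum_(i <- r) f i) = \sum_(i <- r) ev x y (f i).
Proof. exact: raddf_sum. Qed.

Lemma ev_mon x y a b c d :
  ev x y (mon k a b c d) = iota x ^+ (a + p * c) * iota y ^+ (b + p * d).
Proof.
rewrite /ev mon.unlock !mevalM !rmorphXn /= /X0 /Y0 /X1 /Y1 !mevalXU !(tnth_nth 0) /=.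
by rewrite -!exprM !exprD; ring.
Qed.

Lemma ev_bmon x y r0 r1 b d : (d <= r1)%N -> (b <= r0)%N ->
  ev x y (bmon k r0 r1 b d) =
  iota x ^+ (r0 + p * r1 - (b + p * d)) * iota y ^+ (b + p * d).
Proof.
move=> hd hb; rewrite ev_mon; congr (iota x ^+ _ * _).
have := leq_mul (leqnn p) hd; rewrite mulnBr; lia.
Qed.

Lemma ev_act x y g v :
  ev x y (actGamma g v) = ev (g 0 0 * x + g 1 0 * y) (g 0 1 * x + g 1 1 * y) v.
Proof.
by rewrite /ev /actGamma meval_subst2 !mxE !iota_expp !rmorphD !rmorphM /= !exprMn.
Qed.

Lemma actGammaM g h (v : {mpoly k[4]}) : actGamma (g *m h) v = actGamma g (actGamma h v).
Proof.
rewrite /actGamma subst2M -map_mxM; congr (subst2 _ _ v).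
by apply/matrixP => i j; rewrite !mxE !sum_ord2 !mxE iota_expp !rmorphM !exprMn.
Qed.

Lemma actGamma_linear g : linear (@actGamma p S g).
Proof. by move=> c u v; rewrite /actGamma linearP. Qed.
HB.instance Definition _ g := GRing.isLinear.Build k {mpoly k[4]} {mpoly k[4]} *:%R
  (@actGamma p S g) (actGamma_linear g).

Lemma bihom_act r0 r1 g v : bihom r0 r1 v -> bihom r0 r1 (@actGamma p S g v).
Proof. exact: bihom_subst2. Qed.

Lemma theta0E : theta0 S = mon k 1 0 0 p - mon k 0 1 p 0.
Proof. by rewrite /theta0 mon.unlock !expr0 !expr1 !mulr1 !mul1r. Qed.

Lemma theta1E : theta1 S = mon k 0 p 1 0 - mon k p 0 0 1.
Proof. by rewrite /theta1 mon.unlock !expr0 !expr1 !mulr1 !mul1r; congr (_ - _); rewrite mulrC. Qed.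

Lemma ev_theta0 x y : ev x y (theta0 S) = 0.
Proof.
rewrite theta0E evB !ev_mon !muln0 !addn0 !add0n -[(p * p)%N]/(p ^ 2)%N.
by rewrite !iota_q !expr1 mulrC subrr.
Qed.

Lemma ev_theta1 x y : ev x y (theta1 S) = 0.
Proof. by rewrite theta1E evB !ev_mon !muln0 !muln1 !addn0 !add0n subrr. Qed.

Lemma ev_comb x y t0 t1 P0 P1 :
  ev x y t0 = 0 -> ev x y t1 = 0 -> ev x y (t0 * P0 + t1 * P1) = 0.
Proof. by move=> e0 e1; rewrite evD !evM e0 e1 !mul0r addr0. Qed.

Lemma ev_Vstar r0 r1 v x y : inVstar r0 r1 v -> ev x y v = 0.
Proof. by move=> [_ [P0 [P1 ->]]]; exact: (ev_comb _ _ (ev_theta0 x y) (ev_theta1 x y)). Qed.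

Local Notation cong_theta := (cong2 (theta0 S) (theta1 S)).

(** [theta1] replaces [Y_0^p X_1] by [X_0^p Y_1], which preserves b + p d. *)
Lemma theta1_move r0 r1 b d : (p <= b <= r0)%N -> (d < r1)%N ->
  cong_theta (bmon k r0 r1 b d) (bmon k r0 r1 (b - p) d.+1).
Proof.
move=> /andP[pb br] dr; apply: (@cong2_right _ _ _ _ _ _ (mon k (r0 - b) (b - p) (r1 - d.+1) d)).
rewrite theta1E mulrBl !monM /bmon.
by congr (_ - _); congr (mon _ _ _ _); lia.
Qed.

(** [theta0] replaces [X_0 Y_1^p] by [Y_0 X_1^p], which lowers b + p d by q - 1. *)
Lemma theta0_move r0 r1 b d : (p <= d <= r1)%N -> (b < r0)%N ->
  cong_theta (bmon k r0 r1 b d) (bmon k r0 r1 b.+1 (d - p)).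
Proof.
move=> /andP[pd dr] br; apply: (@cong2_left _ _ _ _ _ _ (mon k (r0 - b.+1) b (r1 - d) (d - p))).
rewrite theta0E mulrBl !monM /bmon.
by congr (_ - _); congr (mon _ _ _ _); lia.
Qed.

Section Weights.
Variables r0 r1 : nat.
Hypothesis r0_ge : (q <= r0)%N.
Hypothesis r1_ge : (q <= r1)%N.

Let p0 : (0 < p)%N := prime_gt0 p_prime.
Let p1 : (1 < p)%N := prime_gt1 p_prime.
Let pq : (p < q)%N. Proof. by rewrite ltn_Pmull. Qed.
Let pr0 : (p < r0)%N := leq_trans pq r0_ge.
Let pr1 : (p < r1)%N := leq_trans pq r1_ge.

(** The normal forms: the base p digits of N are the exponents of [Y_0] and [Y_1], so that for N < q
    the monomial evaluates to [x^(r - N) y^N]. *)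
Definition eb (N : nat) := bmon k r0 r1 (N %% p) (N %/ p).

Lemma ebE N : eb N = bmon k r0 r1 (N %% p) (N %/ p). Proof. by []. Qed.

Lemma eb_bound N : (N < q)%N -> (N %% p < p)%N /\ (N %/ p < p)%N.
Proof. by move=> Nq; rewrite ltn_pmod // ltn_divLR. Qed.

Lemma bihom_eb N : (N < q)%N -> bihom r0 r1 (eb N).
Proof.
by move=> /eb_bound[h1 h2]; apply: bihom_bmon; apply: ltnW; apply: ltn_trans; eauto.
Qed.

Lemma ev_eb x y N : (N < q)%N ->
  ev x y (eb N) = iota x ^+ (r0 + p * r1 - N) * iota y ^+ N.
Proof.
move=> /eb_bound[h1 h2].
rewrite ev_bmon 1?ltnW 1?(ltn_trans h1) 1?(ltn_trans h2) //.
have -> : (N %% p + p * (N %/ p))%N = N by rewrite mulnC addnC -divn_eq.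
by [].
Qed.

(** Each move lowers b + d by p - 1, and the process stops when both exponents are below p. A move
    consumes a factor [X_0] or [X_1], so the pure power of [Y_0] and [Y_1] admits none and is
    excluded. *)
Lemma bmon_normal b d : (b <= r0)%N -> (d <= r1)%N -> (b, d) != (r0, r1) ->
  exists2 N, (N < q)%N & cong_theta (bmon k r0 r1 b d) (eb N).
Proof.
have [n] := ubnP (b + d); elim: n b d => // n IH b d bdn br dr bd.
case: (ltnP b p) => [bp|pb].
  case: (ltnP d p) => [dp|pd].
    exists (d * p + b)%N; last first.
      by rewrite /eb modnMDl divnMDl // modn_small // divn_small // addn0; apply: cong2_refl.
    rewrite -mulnn; apply: (@leq_trans (d.+1 * p)); last by rewrite leq_mul2r dp orbT.
    by rewrite mulSn addnC ltn_add2r.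
  have [||||N Nq e] := IH b.+1 (d - p)%N; rewrite ?xpair_eqE; try lia.
  exists N => //; apply: cong2_trans e; apply: theta0_move; lia.
case: (ltnP d r1) => [dr'|rd].
  have [||||N Nq e] := IH (b - p)%N d.+1; rewrite ?xpair_eqE; try lia.
  exists N => //; apply: cong2_trans e; apply: theta1_move; lia.
have e : d = r1 by lia.
have br' : (b < r0)%N by move: bd; rewrite e xpair_eqE eqxx andbT; lia.
have [||||N Nq e'] := IH b.+1 (d - p)%N; rewrite ?xpair_eqE; try lia.
exists N => //; apply: cong2_trans e'; apply: theta0_move; lia.
Qed.

Lemma bihom_normal v : bihom r0 r1 v ->
  exists c (C : nat -> k),
    cong_theta v (c *: bmon k r0 r1 r0 r1 + \sum_(N < q) C N *: eb N).
Proof.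
move: v; apply: bihom_ind => [|t b d v br dr [c [C IH]]].
  exists 0, (fun=> 0); rewrite scale0r big1 ?addr0; first exact: cong2_refl.
  by move=> i _; rewrite scale0r.
case: (eqVneq (b, d) (r0, r1)) => [[-> ->]|bd].
  exists (t + c), C; rewrite scalerDl -addrA.
  by apply: cong2P => //; apply: cong2_refl.
have [N Nq e] := bmon_normal br dr bd.
exists c, (fun n => (if n == N then t else 0) + C n).
have -> : \sum_(n < q) ((if n == N :> nat then t else 0) + C n) *: eb n
   = t *: eb N + \sum_(n < q) C n *: eb n.
  under eq_bigr do rewrite scalerDl.
  rewrite big_split /= (sum_ord_eq1 (i := Ordinal Nq)) /= ?eqxx //.
  by move=> j jN; rewrite (_ : (_ == N) = false) ?scale0r //; apply: negbTE.
by rewrite addrCA; apply: cong2P.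
Qed.

(** On [x = 1] a normal form is a polynomial of degree less than q in y. *)
Lemma ev0_Vstar v : bihom r0 r1 v -> (forall x y, ev x y v = 0) -> inVstar r0 r1 v.
Proof.
move=> hv v0; split=> //; have [c [C e]] := bihom_normal hv.
set w := _ + _ in e.
have w0 x y : ev x y w = 0.
  case: e => [P0 [P1 e]]; have := congr1 (ev x y) e.
  have -> : ev x y (theta0 S * P0 + theta1 S * P1) = 0.
    exact: (ev_comb _ _ (ev_theta0 x y) (ev_theta1 x y)).
  rewrite evB v0 sub0r.
  by move/eqP; rewrite oppr_eq0 => /eqP.
have evw x y : ev x y w = c * iota y ^+ (r0 + p * r1) +
    \sum_(N < q) C N * (iota x ^+ (r0 + p * r1 - N) * iota y ^+ N).
  rewrite evD evZ ev_sum ev_bmon // subnn expr0 mul1r; congr (_ + _).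
  by apply: eq_bigr => N _; rewrite evZ ev_eb.
(* At x = 0 every normal form vanishes, since N < q <= r, and only the pure power of y is left. *)
have c0 : c = 0.
  have := w0 0 1; rewrite evw !rmorph1 !expr1n mulr1 big1 ?addr0 // => N _.
  rewrite rmorph0 expr0n (_ : (_ == 0)%N = false) ?mul0r ?mulr0 //.
  by have := ltn_ord N; case: N => N /= _ Nq; apply/eqP; lia.
have C0 (N : 'I_q) : C N = 0.
  pose P := \poly_(N < q) C N.
  have P0 : P = 0.
    apply: (@roots_geq_poly_eq0 _ _ [seq iota y | y <- enum Fq]).
    - apply/allP => z /mapP[y _ ->]; have := w0 1 y.
      rewrite evw c0 mul0r add0r => e0.
      rewrite rootE horner_poly -[X in _ == X]e0; apply/eqP/eq_bigr => i _.
      by rewrite rmorph1 expr1n mul1r.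
    - by rewrite map_inj_uniq ?enum_uniq //; apply: fmorph_inj.
    - by rewrite size_map -cardE cardFq size_poly.
  by have := congr1 (fun P : {poly k} => P`_N) P0; rewrite coef_poly ltn_ord coef0.
case: e => [P0 [P1 e]]; exists P0, P1; rewrite -e /w c0 scale0r add0r big1 ?subr0 //.
by move=> N _; rewrite C0 scale0r.
Qed.

End Weights.
End ResidueField.

(** * The module Q: spanning classes, group action, nonzero submodules *)

Section QStructure.
Variables (p : nat) (S : setting p).
Hypothesis p_prime : prime p.

Local Notation Fq := (Fq S).
Local Notation k := (k S).
Local Notation iota := (@iota p S).
Local Notation q := (p ^ 2)%N.

Variables r0 r1 a0 : nat.
Hypothesis r0_ge : (q <= r0)%N.
Hypothesis r1_ge : (q <= r1)%N.
Hypothesis r_mod : (r0 + p * r1 = a0 %[mod q - 1])%N.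
Hypothesis a0_bnd : (1 <= a0 <= p - 1)%N.

Local Notation r := (r0 + p * r1)%N.
Local Notation eb := (@eb p S r0 r1).
Local Notation prQ := (@prQ p S r0 r1).

Local Notation iota_power_sum := (iota_power_sum S p_prime).
Local Notation ev_act := (ev_act p_prime).
Local Notation ev_eb := (ev_eb p_prime r0_ge r1_ge).
Local Notation bihom_eb := (bihom_eb p_prime r0_ge r1_ge).

Let p0 : (0 < p)%N := prime_gt0 p_prime.
Let p1 : (1 < p)%N := prime_gt1 p_prime.
Let p2 : (2 * p <= q)%N. Proof. by rewrite -mulnn leq_mul2r p1 orbT. Qed.
Let rq : (2 * q <= r)%N.
Proof. by have := leq_mul p0 (leqnn r1); rewrite mul1n; lia. Qed.

Lemma prQ_linear : linear prQ.
Proof. by move=> c u v; rewrite /Defs.prQ linearP. Qed.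
HB.instance Definition _ := GRing.isLinear.Build k {mpoly k[4]} (Q S r0 r1) *:%R
  prQ prQ_linear.

Lemma prQ_eq0 v : inVstar r0 r1 v \/ inXr r0 r1 v -> prQ v = 0.
Proof.
move=> h; rewrite -(linear0 prQ); apply/toquo_eq; rewrite subr0.
by rewrite -[v]addr0 -[v]scale1r; apply: span_step => //; apply: span_zero.
Qed.

Lemma prQ_ev u v : bihom r0 r1 u -> bihom r0 r1 v ->
  (forall x y, ev x y u = ev x y v) -> prQ u = prQ v.
Proof.
move=> hu hv e; apply/eqP; rewrite -subr_eq0 -linearB; apply/eqP/prQ_eq0; left.
by apply: (ev0_Vstar p_prime r0_ge r1_ge) => [|x y]; [apply: bihomB | rewrite evB e subrr].
Qed.

Lemma mx2E (R : Type) (a b c d : R) : (mx2 a b c d 0 0 = a) * (mx2 a b c d 0 1 = b)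
  * (mx2 a b c d 1 0 = c) * (mx2 a b c d 1 1 = d).
Proof. by rewrite !mxE. Qed.

Lemma det_mx2 (R : comNzRingType) (a b c d : R) : \det (mx2 a b c d) = a * d - b * c.
Proof.
rewrite (expand_det_row _ 0) sum_ord2 /cofactor !det_mx11 !mxE /=.
by rewrite expr0 expr1 mul1r mulN1r mulrN.
Qed.

Lemma unit_mx2 (R : fieldType) (a b c d : R) :
  (mx2 a b c d \in unitmx) = (a * d - b * c != 0).
Proof. by rewrite unitmxE det_mx2 unitfE. Qed.

Lemma inXr_act g : g \in unitmx -> inXr r0 r1 (@actGamma p S g (bmon k r0 r1 0 0)).
Proof.
move=> ug; rewrite -[X in inXr _ _ X]addr0 -[X in X + 0]scale1r.
apply: span_step; last exact: span_zero.
by exists g => //; rewrite /bmon !subn0 mon.unlock !expr0 !mulr1.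
Qed.

Lemma ev_act_X g x y :
  ev x y (@actGamma p S g (bmon k r0 r1 0 0)) = iota (g 0 0 * x + g 1 0 * y) ^+ a0.
Proof.
rewrite ev_act ev_bmon // muln0 addn0 subn0 expr0 mulr1; apply: iota_mod => //; lia.
Qed.

(** The translates of the generator by lower unipotents evaluate to [(x + c y)^a0]. A character sum
    over c isolates one term of the expansion, whose binomial coefficient is nonzero because a0 <
    p. *)
Lemma Xr_monomial i : (i <= a0)%N -> exists xi : {mpoly k[4]},
  [/\ bihom r0 r1 xi, inXr r0 r1 xi
    & forall x y, ev x y xi = iota x ^+ (a0 - i) * iota y ^+ i].
Proof.
move=> ia.
have hX : bihom r0 r1 (bmon k r0 r1 0 0) by apply: bihom_bmon.
case: (posnP i) => [->|i0].
  exists (actGamma 1%:M (bmon k r0 r1 0 0)); split; first exact: bihom_act.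
    by apply: inXr_act; rewrite unitmx1.
  by move=> x y; rewrite ev_act_X !mxE /= mul1r mul0r addr0 subn0 expr0 mulr1.
case: (ltngtP i a0) ia => // [ia _|-> _]; last first.
  exists (actGamma (mx2 0 1 1 0) (bmon k r0 r1 0 0)); split; first exact: bihom_act.
    by apply: inXr_act; rewrite unit_mx2 mul0r mul1r sub0r oppr_eq0 oner_neq0.
  by move=> x y; rewrite ev_act_X !mx2E mul0r mul1r add0r subnn expr0 mul1r.
pose f c := @actGamma p S (mx2 1 0 c 1) (bmon k r0 r1 0 0).
pose B : k := 'C(a0, i)%:R.
have B0 : B != 0 by apply: (binr_neq0_lt (pchark S p_prime)); lia.
exists ((- B^-1) *: \sum_(c : Fq) iota c ^+ (q - 1 - i) *: f c); split.
- by apply: bihomZ; apply: bihom_sum => c; apply/bihomZ/bihom_act.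
- apply: spanZ; apply: big_ind => [||c _]; [exact: span_zero | exact: spanD|].
  by apply/spanZ/inXr_act; rewrite unit_mx2 mul1r mul0r subr0 oner_neq0.
move=> x y; rewrite evZ ev_sum.
have -> : \sum_(c : Fq) ev x y (iota c ^+ (q - 1 - i) *: f c) =
   \sum_(l < a0.+1) (\sum_(c : Fq) iota c ^+ (q - 1 - i + l))
      * (iota x ^+ (a0 - l) * iota y ^+ l * 'C(a0, l)%:R).
  under [RHS]eq_bigr do rewrite mulr_suml.
  rewrite exchange_big; apply: eq_bigr => c _ /=.
  rewrite evZ /f ev_act_X !mx2E mul1r rmorphD rmorphM exprDn mulr_sumr.
  by apply: eq_bigr => l _; rewrite exprMn -mulr_natr exprD; ring.
have ia' : (i < a0.+1)%N by lia.
rewrite (sum_ord_eq1 (i := Ordinal ia')) => [|l li] /=.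
  rewrite iota_power_sum //; last lia.
  by rewrite subnK ?eqxx; [rewrite -/B mulN1r mulrNN mulrCA mulVf // mulr1 | lia].
rewrite iota_power_sum; last by case: l li => l /= hl _; lia.
rewrite (_ : (_ == _) = false) ?mul0r //.
by case: l li => l /= hl; rewrite -val_eqE /= => li; apply/eqP; lia.
Qed.

(** As [V_r^*] is the kernel of evaluation, only the function of v matters, and every form of degree
    a0 is the function of an element of [X_r]. *)
Lemma prQ_sym v (d : nat -> k) : bihom r0 r1 v ->
  (forall x y, ev x y v = \sum_(i < a0.+1) d i * (iota x ^+ (a0 - i) * iota y ^+ i)) ->
  prQ v = 0.
Proof.
move=> hv e.
have /choice[xi xiP] (i : 'I_a0.+1) := Xr_monomial (ltn_ord i : (i <= a0)%N).
have -> : prQ v = prQ (\sum_(i < a0.+1) d i *: xi i).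
  apply: prQ_ev => // [|x y].
    by apply: bihom_sum => i; apply: bihomZ; case: (xiP i).
  by rewrite e ev_sum; apply: eq_bigr => i _; rewrite evZ; case: (xiP i) => _ _ ->.
rewrite linear_sum big1 // => i _; rewrite linearZ /= prQ_eq0 ?scaler0 //; right.
by case: (xiP i).
Qed.

Lemma prQ_sym_eq u v (d : nat -> k) : bihom r0 r1 u -> bihom r0 r1 v ->
  (forall x y, ev x y u = ev x y v +
     \sum_(i < a0.+1) d i * (iota x ^+ (a0 - i) * iota y ^+ i)) ->
  prQ u = prQ v.
Proof.
move=> hu hv e; apply/eqP; rewrite -subr_eq0 -linearB; apply/eqP.
apply: (@prQ_sym _ d) => [|x y]; first exact: bihomB.
by rewrite evB e addrC addKr.
Qed.

(** The action is defined through chosen representatives. They do not matter, since g preserves the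
    kernel of evaluation and maps generators of [X_r] to generators. *)
Lemma actGammaQ_pr g v : g \in unitmx -> actGammaQ g (prQ v) = prQ (actGamma g v).
Proof.
move=> ug; rewrite /actGammaQ; apply/toquo_eq; rewrite -linearB.
set u := _ - v; have : span (fun v => inVstar r0 r1 v \/ inXr r0 r1 v) u.
  by apply/toquo_eq; rewrite ofquoK.
elim=> [|c w w' h _ IH]; first by rewrite linear0; apply: span_zero.
rewrite linearP; apply: span_step => //; case: h => h; [left|right].
  apply: (ev0_Vstar p_prime r0_ge r1_ge) => [|x y]; first by apply: bihom_act; case: h.
  by rewrite ev_act (ev_Vstar _ _ h).
elim: h => [|t x x' [h uh ->] _ IH']; first by rewrite linear0; apply: span_zero.
rewrite linearP /= -(actGammaM p_prime); apply: span_step => //.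
by exists (g *m h) => //; rewrite unitmx_mul ug.
Qed.

Lemma actGammaQ_linear g : g \in unitmx -> linear (@actGammaQ p S r0 r1 g).
Proof.
move=> ug c x y; rewrite -[x]ofquoK -[y]ofquoK -!/(prQ _) -linearP.
by rewrite !actGammaQ_pr // linearP /= linearP.
Qed.

Lemma actGammaQ_0 g : g \in unitmx -> @actGammaQ p S r0 r1 g 0 = 0.
Proof.
move=> ug; have := actGammaQ_linear ug (-1) 0 0.
by rewrite scaler0 addr0 scaleN1r addNr.
Qed.

Lemma actGammaQ_Z g c x : g \in unitmx ->
  actGammaQ g (c *: x) = c *: @actGammaQ p S r0 r1 g x.
Proof.
by move=> ug; have := actGammaQ_linear ug c x 0; rewrite actGammaQ_0 // !addr0.
Qed.

Lemma actGammaQ_sum g (I : Type) (s : seq I) (f : I -> Q S r0 r1) : g \in unitmx ->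
  actGammaQ g (\sum_(i <- s) f i) = \sum_(i <- s) actGammaQ g (f i).
Proof.
move=> ug; elim: s => [|i s IH]; last first.
  by rewrite !big_cons -{1}[f i]scale1r (actGammaQ_linear ug) scale1r IH.
by rewrite !big_nil actGammaQ_0.
Qed.

Lemma actGammaQ_M g h x : g \in unitmx -> h \in unitmx ->
  actGammaQ (g *m h) x = actGammaQ g (@actGammaQ p S r0 r1 h x).
Proof.
move=> ug uh; have ugh : g *m h \in unitmx by rewrite unitmx_mul ug.
have -> : x = prQ (ofquo x) by rewrite /Defs.prQ ofquoK.
rewrite (actGammaQ_pr _ ugh) (actGammaQ_pr _ uh) (actGammaQ_pr _ ug).
by rewrite (actGammaM p_prime).
Qed.

Lemma inQ_act g x : g \in unitmx -> inQ x -> inQ (@actGammaQ p S r0 r1 g x).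
Proof.
move=> ug [v hv ->]; rewrite actGammaQ_pr //; exists (actGamma g v) => //.
exact: bihom_act.
Qed.

Definition eq_ (N : nat) : Q S r0 r1 := prQ (eb N).

(** Here r - N and a0 - N are positive and congruent modulo q - 1, so the function is
    [x^(a0 - N) y^N], a form of degree a0. At N = a0 the comparison with [y^a0] breaks down at x =
    0, which is why the indices that count start at a0. *)
Lemma eq_small N : (N < a0)%N -> eq_ N = 0.
Proof.
move=> Na; have Nq : (N < q)%N by lia.
apply: (@prQ_sym _ (fun i => (i == N)%:R)); first exact: bihom_eb.
move=> x y; rewrite ev_eb //.
have Na' : (N < a0.+1)%N by lia.
rewrite (sum_ord_eq1 (i := Ordinal Na')) /= ?eqxx ?mul1r => [|i iN]; last first.
  by rewrite -val_eqE /= in iN; rewrite (negPf iN) mul0r.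
congr (_ * _); apply: iota_mod; try lia.
by apply/eqP; rewrite -(eqn_modDr N) !subnK ?r_mod //; lia.
Qed.

(** The coefficients are indexed by all of [nat] and vanish from q on, so that the shifted
    coefficients of the lowering operators can be written without a bound. *)
Lemma inQ_basis x : inQ x -> exists2 C : nat -> k,
  forall N, (q <= N)%N -> C N = 0 & x = \sum_(N < q) C N *: eq_ N.
Proof.
move=> [v hv ->]; have [c [C [P0 [P1 e]]]] := bihom_normal p_prime r0_ge r1_ge hv.
exists (fun N => if (N < q)%N then C N else 0) => [N qN|]; first by rewrite ltnNge qN.
set w := c *: _ + _ in e.
have hw : bihom r0 r1 w.
  apply: bihomD; first by apply: bihomZ; apply: bihom_bmon.
  by apply: bihom_sum => N; apply/bihomZ/bihom_eb.
have -> : prQ v = prQ w.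
  apply/eqP; rewrite -subr_eq0 -linearB; apply/eqP/prQ_eq0; left.
  by split; [apply: bihomB | exists P0, P1].
(* The one monomial that is not reducible to a normal form evaluates to [y^a0], a form of degree
   a0. *)
have Y0 : prQ (bmon k r0 r1 r0 r1) = 0.
  apply: (@prQ_sym _ (fun i => (i == a0)%:R)) => [|x' y']; first exact: bihom_bmon.
  rewrite ev_bmon // subnn expr0 mul1r (sum_ord_eq1 (i := ord_max)) /= => [|i ia].
    by rewrite eqxx mul1r subnn expr0 mul1r; apply: iota_mod => //; lia.
  by rewrite -val_eqE /= in ia; rewrite (negPf ia) mul0r.
rewrite /w linearD linearZ /= Y0 scaler0 add0r linear_sum.
by apply: eq_bigr => N _; rewrite linearZ /= ltn_ord.
Qed.

Lemma eq_sum1 (C : nat -> k) N0 : (N0 < q)%N ->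
  (forall N, (a0 <= N < q)%N -> N != N0 -> C N = 0) ->
  \sum_(N < q) C N *: eq_ N = C N0 *: eq_ N0.
Proof.
move=> Nq C0; rewrite (sum_ord_eq1 (i := Ordinal Nq)) //= => N; rewrite -val_eqE /= => NN.
case: (ltnP N a0) => [/eq_small ->|aN]; first by rewrite scaler0.
by rewrite C0 ?scale0r ?aN /=.
Qed.

Lemma unip_eq b N : (N < q)%N -> actGammaQ (mx2 1 b 0 1) (eq_ N) =
  \sum_(l < q) ('C(N, l)%:R * iota b ^+ (N - l)) *: eq_ l.
Proof.
move=> Nq; rewrite actGammaQ_pr ?unit_mx2 ?mul1r ?mulr0 ?subr0 ?oner_neq0 //.
rewrite -(eq_bigr _ (fun l _ => linearZ _ _)) -linear_sum /=.
apply: prQ_ev => [||x y]; first exact/bihom_act/bihom_eb.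
  by apply: bihom_sum => l; apply/bihomZ/bihom_eb.
rewrite ev_act !mx2E ev_eb // mul0r addr0 mul1r ev_sum.
rewrite rmorphD rmorphM exprDn mulr_sumr -[in RHS](big_mkord xpredT
  (fun l => ev x y (('C(N, l)%:R * iota b ^+ (N - l)) *: eb l))).
rewrite [RHS](big_cat_nat _ (n := N.+1)) //= [X in _ = _ + X]big_nat_cond.
rewrite [X in _ = _ + X]big1 ?addr0; last first.
  by move=> l /andP[/andP[Nl lq] _]; rewrite evZ bin_small // mul0r mul0r.
rewrite big_mkord; apply: eq_bigr => l _; have lN : (l <= N)%N by case: l.
rewrite evZ ev_eb; last by lia.
have -> : (r - l = r - N + (N - l))%N by lia.
by rewrite mul1r exprD exprMn -mulr_natl; ring.
Qed.

Lemma torus_eq a N : a != 0 -> (N < q)%N ->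
  actGammaQ (mx2 a 0 0 1) (eq_ N) = iota a ^+ (r - N) *: eq_ N.
Proof.
move=> an0 Nq; rewrite actGammaQ_pr ?unit_mx2 ?mulr1 ?mulr0 ?subr0 //.
rewrite -linearZ; apply: prQ_ev => [||x y]; first exact/bihom_act/bihom_eb.
  exact/bihomZ/bihom_eb.
by rewrite ev_act !mx2E evZ !ev_eb // !mul0r addr0 add0r mul1r rmorphM exprMn mulrA.
Qed.

(** The exchange of variables gives [x^a0 y^(r - a0)]; both exponents are then replaced by positive
    ones in the same class modulo q - 1. *)
Lemma weyl_eq : actGammaQ (mx2 0 1 1 0) (eq_ a0) = eq_ (q - 1).
Proof.
rewrite actGammaQ_pr ?unit_mx2 ?mul0r ?mul1r ?sub0r ?oppr_eq0 ?oner_neq0 //.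
apply: prQ_ev => [||x y]; first by apply/bihom_act/bihom_eb; lia.
  by apply: bihom_eb; lia.
rewrite ev_act !mx2E !ev_eb; [|lia..].
rewrite !mul0r !mul1r addr0 add0r mulrC; congr (_ * _); apply: iota_mod; try lia.
  apply/eqP; rewrite -(eqn_modDr (q - 1)) subnK; last lia.
  by rewrite r_mod modnDr.
apply/eqP; rewrite -(eqn_modDr a0) subnK; last lia.
by rewrite r_mod modnDl.
Qed.

Section Submodule.
Variable M : Q S r0 r1 -> Prop.
Hypothesis MP : Gamma_submodule M.

Lemma subQ0 : M 0. Proof. by case: MP. Qed.
Lemma subQP c x y : M x -> M y -> M (c *: x + y).
Proof. by case: MP => _ _ + _; apply. Qed.
Lemma subQZ c x : M x -> M (c *: x).
Proof. by move=> Mx; rewrite -[_ *: x]addr0; apply: subQP => //; apply: subQ0. Qed.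
Lemma subQZ_neq0 c x : c != 0 -> M (c *: x) -> M x.
Proof. by move=> c0 /(subQZ c^-1); rewrite scalerA mulVf // scale1r. Qed.
Lemma subQD x y : M x -> M y -> M (x + y).
Proof. by move=> Mx; rewrite -[x]scale1r; apply: subQP. Qed.
Lemma subQ_sum (I : Type) (s : seq I) (f : I -> Q S r0 r1) :
  (forall i, M (f i)) -> M (\sum_(i <- s) f i).
Proof. by move=> Mf; apply: big_ind => //; [apply: subQ0 | apply: subQD]. Qed.
Lemma subQ_act g x : g \in unitmx -> M x -> M (actGammaQ g x).
Proof. by case: MP => _ _ _; apply. Qed.

(** The divided-power lowering operator of degree t, as a character sum over
    the unipotent radical. *)
Lemma subQ_lower (C : nat -> k) t : (0 < t < q - 1)%N ->
  (forall N, (q <= N)%N -> C N = 0) ->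
  M (\sum_(N < q) C N *: eq_ N) ->
  M (\sum_(l < q) (C (l + t)%N * 'C(l + t, t)%:R) *: eq_ l).
Proof.
move=> tq Cq Mf; set f := \sum_(N < q) _ in Mf.
have ub b : mx2 1 b 0 1 \in @unitmx Fq 2.
  by rewrite unit_mx2 mul1r mulr0 subr0 oner_neq0.
have Mg : M (\sum_(b : Fq) iota b ^+ (q - 1 - t) *: actGammaQ (mx2 1 b 0 1) f).
  by apply: subQ_sum => b; apply/subQZ/subQ_act.
move: (subQZ (-1) Mg); congr M.
have actf b : actGammaQ (mx2 1 b 0 1) f = \sum_(N < q) C N *: \sum_(l < q)
      ('C(N, l)%:R * iota b ^+ (N - l)) *: eq_ l.
  by rewrite /f actGammaQ_sum //; apply: eq_bigr => N _; rewrite actGammaQ_Z // unip_eq.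
under eq_bigr do rewrite actf scaler_sumr.
rewrite exchange_big /=.
have -> : \sum_(N < q) \sum_(b : Fq) iota b ^+ (q - 1 - t) *: (C N *: \sum_(l < q)
      ('C(N, l)%:R * iota b ^+ (N - l)) *: eq_ l) =
  \sum_(N < q) \sum_(l < q) (C N * 'C(N, l)%:R *
       \sum_(b : Fq) iota b ^+ (q - 1 - t + (N - l))) *: eq_ l.
  apply: eq_bigr => N _; under [RHS]eq_bigr do rewrite mulr_sumr scaler_suml.
  rewrite exchange_big; apply: eq_bigr => b _ /=.
  rewrite scalerA scaler_sumr; apply: eq_bigr => l _.
  by rewrite scalerA exprD; congr (_ *: _); ring.
rewrite exchange_big scaler_sumr; apply: eq_bigr => l _ /=.
rewrite -scaler_suml scalerA; congr (_ *: _).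
(* For l <= N the exponent lies strictly between 0 and 2 (q - 1), so the sum over b selects N = l +
   t. *)
have hS (N : 'I_q) : C N * 'C(N, l)%:R * \sum_(b : Fq) iota b ^+ (q - 1 - t + (N - l))
   = if (N == l + t :> nat)%N then - (C N * 'C(N, l)%:R) else 0.
  case: (ltnP N l) => Nl.
    by rewrite bin_small // mulr0 mul0r oppr0 if_same.
  rewrite iota_power_sum; last by case: N Nl => N /= hN; lia.
  have -> : (q - 1 - t + (N - l) == q - 1)%N = (N == l + t :> nat)%N.
    by apply/eqP/eqP; lia.
  by case: ifP; rewrite ?mulr0 // mulrN1.
rewrite (eq_bigr _ (fun N _ => hS N)).
case: (ltnP (l + t) q) => ltq; last first.
  rewrite Cq // mul0r big1 ?mulr0 // => N _; case: eqP => // e.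
  by have := ltn_ord N; rewrite e ltnNge ltq.
rewrite (sum_ord_eq1 (i := Ordinal ltq)) /= ?eqxx => [|N]; last first.
  by rewrite -val_eqE /= => /negPf ->.
by rewrite mulN1r opprK -(bin_sub (leq_addl _ _)) addnK.
Qed.

Lemma binp_neq0 N : (p <= N < q)%N -> 'C(N, p)%:R != 0 :> k.
Proof.
move=> /andP[pN Nq]; rewrite (divn_eq N p) addnC.
rewrite (binr_digit (pchark S p_prime)) ?ltn_pmod //.
apply: (natr_neq0_lt (pchark S p_prime)).
by rewrite divn_gt0 // pN ltn_divLR.
Qed.

(** The Weyl element moves the index a0 to q - 1; lowering by q - 1 - p then reaches p, with
    coefficient C(q - 1, p), nonzero modulo p. *)
Lemma subQ_weyl : M (eq_ a0) -> M (eq_ p).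
Proof.
move=> /(subQ_act (g := mx2 0 1 1 0)); rewrite weyl_eq => Mq.
have {Mq} : M (eq_ (q - 1)).
  by apply: Mq; rewrite unit_mx2 mul0r mul1r sub0r oppr_eq0 oner_neq0.
pose C N : k := (N == q - 1)%N%:R.
have -> : eq_ (q - 1) = \sum_(N < q) C N *: eq_ N.
  rewrite (@eq_sum1 _ (q - 1)) /C ?eqxx ?scale1r //; first by lia.
  by move=> N _ /negPf ->.
move/(@subQ_lower _ (q - 1 - p)).
rewrite (@eq_sum1 (fun l => C (l + (q - 1 - p))%N * 'C(l + (q - 1 - p), q - 1 - p)%:R) p); [|lia|].
  move=> H; apply: subQZ_neq0 (H _ _); rewrite ?/C; try lia.
    rewrite subnKC ?eqxx ?mul1r; last by lia.
    rewrite bin_sub ?binp_neq0 //; lia.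
  by move=> N qN; rewrite (_ : (_ == _) = false) //; apply/eqP; lia.
by move=> N Nq Np; rewrite /C (_ : (_ == _) = false) ?mul0r //; apply/eqP; lia.
Qed.

(** If some coefficient strictly between a0 and p is nonzero, lowering the largest such index to a0
    leaves a nonzero multiple of [eq_ a0]: the index p contributes nothing because its binomial
    coefficient is divisible by p. Otherwise only the indices a0 and p remain, and the torus
    separates them. *)
Lemma subQ_step (C : nat -> k) : M (\sum_(N < q) C N *: eq_ N) ->
  (forall N, (p < N)%N -> C N = 0) -> (exists2 N, (a0 <= N <= p)%N & C N != 0) ->
  M (eq_ p).
Proof.
move=> Mf Cp [N0 N0b CN0].
case: (pselect (exists2 N, (a0 < N < p)%N & C N != 0)) => [|none].
  move=> exN; pose P N := (a0 < N < p)%N && (C N != 0).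
  have exP : exists N, P N by case: exN => N h1 h2; exists N; rewrite /P h1.
  have ubP N : P N -> (N <= p)%N by move=> /andP[/andP[_ /ltnW]].
  case: (ex_maxnP exP ubP) => L /andP[aL CL] Lmax.
  apply: subQ_weyl; have tq : (0 < L - a0 < q - 1)%N by lia.
  have Cq N : (q <= N)%N -> C N = 0 by move=> qN; apply: Cp; lia.
  have := subQ_lower tq Cq Mf; 
  rewrite (@eq_sum1 (fun l => C (l + (L - a0))%N * 'C(l + (L - a0), L - a0)%:R) a0); [|lia|].
    apply: subQZ_neq0; rewrite subnKC ?mulf_neq0 //; last lia.
    by apply: (binr_neq0_lt (pchark S p_prime)); lia.
  move=> N Nq Na; case: (ltngtP (N + (L - a0)) p) => h.
  - apply/eqP; rewrite mulf_eq0; apply/orP; left; apply: contraT => CN.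
    by have := Lmax (N + (L - a0))%N; rewrite /P CN andbT => /(_ _); lia.
  - by rewrite Cp // mul0r.
  - by rewrite h (binr_p (pchark S p_prime)) ?mulr0 //; lia.
have Cmid N : (a0 < N < p)%N -> C N = 0.
  by move=> Nb; apply/eqP; apply: contraT => CN; case: none; exists N.
have fE : \sum_(N < q) C N *: eq_ N = C p *: eq_ p + C a0 *: eq_ a0.
  have aq : (a0 < q)%N by lia.
  have pq : (p < q)%N by lia.
  rewrite (bigD1 (Ordinal pq)) //=; congr (_ + _).
  rewrite (bigD1 (Ordinal aq)) /=; last by rewrite -val_eqE /=; apply/eqP; lia.
  rewrite big1 ?addr0 // => N /andP[]; rewrite -!val_eqE /= => Np Na.
  case: (ltnP N a0) => [/eq_small ->|aN]; first by rewrite scaler0.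
  case: (ltnP N p) => Np'; first by rewrite Cmid ?scale0r //; lia.
  by rewrite Cp ?scale0r //; lia.
rewrite fE in Mf.
case: (eqVneq (C p) 0) => [Cp0|Cpn0].
  move: Mf; rewrite Cp0 scale0r add0r => Mf; apply: subQ_weyl.
  case: (eqVneq (C a0) 0) => [Ca0|Ca0]; last exact: subQZ_neq0 Mf.
  have e : N0 = p.
    case: (eqVneq N0 a0) => h; first by rewrite h Ca0 eqxx in CN0.
    case: (eqVneq N0 p) => // h'; suff Cm : C N0 = 0 by rewrite Cm eqxx in CN0.
    by apply: Cmid; lia.
  by rewrite e Cp0 eqxx in CN0.
(* The torus fixes [eq_ a0] and acts on [eq_ p] by the character of exponent r - p, congruent to q -
   1 + a0 - p, which is nontrivial since a0 < p. *)
have nb : (0 < q - 1 + a0 - p < #|Fq| - 1)%N by rewrite cardFq; lia.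
have [a an0 aN] := exists_expf_neq1 nb.
have ua : mx2 a 0 0 1 \in @unitmx Fq 2 by rewrite unit_mx2 mulr1 mul0r subr0.
have := subQP (-1) Mf (subQ_act ua Mf).
rewrite (actGammaQ_linear ua) torus_eq //; last lia.
rewrite actGammaQ_Z // torus_eq //; last lia.
have -> : iota a ^+ (r - a0) = 1.
  rewrite (@iota_mod _ _ a (r - a0) (q - 1)); [|lia|lia|]; last first.
    apply/eqP; rewrite -(eqn_modDr a0) subnK; last lia.
    by rewrite r_mod modnDl.
  by rewrite -rmorphXn -(rmorph1 iota); congr (iota _); apply: (mulfI an0);
     rewrite -exprS mulr1 subn1 prednK ?expn_gt0 ?p0 // -(cardFq S) expf_card.
rewrite scale1r scaleN1r opprD addrACA [X in _ + X]addrC subrr addr0 scalerA.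
rewrite -scaleNr -scalerDl; apply: subQZ_neq0.
rewrite addrC -{2}[C p]mulr1 -mulrBr mulf_neq0 // subr_eq0.
rewrite (@iota_mod _ _ a (r - p) (q - 1 + a0 - p)); [|lia|lia|]; last first.
  apply/eqP; rewrite -(eqn_modDr p) !subnK; try lia.
  by rewrite r_mod modnDl.
by rewrite -rmorphXn fmorph_eq1.
Qed.

(** When the top index L exceeds p, lowering it to p multiplies its coefficient by C(L, p), which
    modulo p is the upper digit of L, hence nonzero. Only indices at most p remain, the case already
    treated. *)
Lemma subQ_contains_p x : M x -> x != 0 -> M (eq_ p).
Proof.
move=> Mx x0; have Qx : inQ x by case: MP => + _ _ _; apply.
have [C Cq xE] := inQ_basis Qx; rewrite xE in Mx x0.
pose P N := (a0 <= N < q)%N && (C N != 0).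
have exP : exists N, P N.
  apply: contrapT => nP; move/eqP: x0; apply; rewrite big1 // => N _.
  case: (ltnP N a0) => [/eq_small ->|aN]; first by rewrite scaler0.
  case: (eqVneq (C N) 0) => [->|CN]; first by rewrite scale0r.
  by case: nP; exists N; rewrite /P aN ltn_ord CN.
have ubP N : P N -> (N <= q)%N by move=> /andP[/andP[_ /ltnW]].
case: (ex_maxnP exP ubP) => L /andP[aL CL] Lmax.
have CL0 N : (L < N)%N -> C N = 0.
  move=> LN; case: (ltnP N q) => Nq; last exact: Cq.
  apply/eqP; apply: contraT => CN; have := Lmax N; rewrite /P CN; lia.
case: (leqP L p) => Lp.
  apply: (subQ_step Mx) => [N pN|]; first by apply: CL0; lia.
  by exists L => //; lia.
have tq : (0 < L - p < q - 1)%N by lia.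
have := subQ_lower tq Cq Mx; 
move/(@subQ_step (fun l => C (l + (L - p))%N * 'C(l + (L - p), L - p)%:R)); apply.
  by move=> N pN; rewrite CL0 ?mul0r //; lia.
exists p; first by lia.
rewrite subnKC ?mulf_neq0 //; last lia.
rewrite -(bin_sub (_ : (L - p <= L)%N)); last lia.
rewrite subKn ?binp_neq0 //; lia.
Qed.

End Submodule.
End QStructure.

(** * The weight in the socle *)

Lemma form_mul_linear (K : comNzRingType) n (d : nat -> K) (al be : K) :
  exists d' : nat -> K, forall X Y,
    (\sum_(i < n.+1) d i * (X ^+ (n - i) * Y ^+ i)) * (al * X + be * Y) =
    \sum_(i < n.+2) d' i * (X ^+ (n.+1 - i) * Y ^+ i).
Proof.
exists (fun i => (if (i <= n)%N then al * d i else 0)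
               + (if i is j.+1 then be * d j else 0)) => X Y.
under [RHS]eq_bigr do rewrite mulrDl.
rewrite [RHS]big_split /= mulrDr; congr (_ + _).
  rewrite [RHS]big_ord_recr /= ltnn mul0r addr0 mulr_suml; apply: eq_bigr => i _.
  have i_n : (i <= n)%N by case: i.
  by rewrite i_n subSn // exprS; ring.
rewrite [RHS]big_ord_recl /= mul0r add0r mulr_suml; apply: eq_bigr => i _.
by rewrite /bump /= add1n subSS exprS; ring.
Qed.

(** Only the existence of coefficients independent of X and Y matters: with n + 1 = a0 such a form
    is zero in Q. *)
Lemma form_linear_power (K : comNzRingType) n (al ga b1 b2 : K) :
  exists d : nat -> K, forall X Y,
    (al * X + ga * Y) ^+ n * (b1 * X + b2 * Y) =
    \sum_(i < n.+2) d i * (X ^+ (n.+1 - i) * Y ^+ i).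
Proof.
elim: n => [|n [d IH]].
  have [d e] := @form_mul_linear K 0 (fun=> 1) b1 b2.
  by exists d => X Y; rewrite -e big_ord1 expr0 !mul1r.
have [d' e] := @form_mul_linear K n.+1 d al ga.
by exists d' => X Y; rewrite -e -IH exprSr; ring.
Qed.

Lemma subst2_power (R : comNzRingType) (A0 A1 : 'M[R]_2) s0 s1 :
  subst2 A0 A1 (bmon R s0 s1 0 0) =
  \sum_(i < s0.+1) \sum_(j < s1.+1)
    ('C(s0, i)%:R * (A0 0 0 ^+ (s0 - i) * A0 1 0 ^+ i) *
    ('C(s1, j)%:R * (A1 0 0 ^+ (s1 - j) * A1 1 0 ^+ j))) *: bmon R s0 s1 i j.
Proof.
have e (al be : R) (x y : {mpoly R[4]}) m n N : (al *: x) ^+ m * (be *: y) ^+ n *+ N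
    = (N%:R * (al ^+ m * be ^+ n)) *: (x ^+ m * y ^+ n).
  by rewrite !exprZn -scalerAl -scalerAr scalerA -scaler_nat scalerA.
rewrite /bmon !subn0 subst2_mon !expr0 !mulr1 !exprDn mulr_suml.
apply: eq_bigr => i _; rewrite mulr_sumr; apply: eq_bigr => j _.
by rewrite !e -scalerAl -scalerAr scalerA mon.unlock !mulrA.
Qed.

Lemma digit_bound p a i j : (1 < p)%N -> (1 <= a <= p - 1)%N ->
  (i <= a - 1)%N -> (j <= p - 2)%N -> (i + p * j < p ^ 2 - 1 - p)%N.
Proof.
move=> p1 ha hi hj; have h1 : (p * j <= p * (p - 2))%N by rewrite leq_mul2l hj orbT.
have h2 : (p ^ 2 = p * (p - 2) + 2 * p)%N by rewrite mulnC -mulnDl subnK // -mulnn.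
by move: h1; rewrite h2; lia.
Qed.

Section Socle.
Variables (p : nat) (S : setting p).
Hypothesis p_prime : prime p.
Hypothesis p_gt2 : (2 < p)%N.

Local Notation Fq := (Fq S).
Local Notation k := (k S).
Local Notation iota := (@iota p S).
Local Notation q := (p ^ 2)%N.

Variables r0 r1 a0 : nat.
Hypothesis r0_ge : (q <= r0)%N.
Hypothesis r1_ge : (q <= r1)%N.
Hypothesis r_mod : (r0 + p * r1 = a0 %[mod q - 1])%N.
Hypothesis a0_bnd : (1 <= a0 <= p - 1)%N.

Local Notation r := (r0 + p * r1)%N.
Local Notation eb := (@eb p S r0 r1).
Local Notation prQ := (@prQ p S r0 r1).
Local Notation eq_ := (@eq_ p S r0 r1).
Local Notation iota_power_sum := (iota_power_sum S p_prime).
Local Notation ev_act := (ev_act p_prime).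
Local Notation ev_eb := (ev_eb p_prime r0_ge r1_ge).
Local Notation bihom_eb := (bihom_eb p_prime r0_ge r1_ge).
Local Notation s0 := (a0 - 1)%N.
Local Notation s1 := (p - 2)%N.

Let p0 : (0 < p)%N := prime_gt0 p_prime.
Let p1 : (1 < p)%N := prime_gt1 p_prime.
Let p2 : (2 * p <= q)%N. Proof. by rewrite -mulnn leq_mul2r p1 orbT. Qed.
Let rq : (2 * q <= r)%N.
Proof. by have := leq_mul p0 (leqnn r1); rewrite mul1n; lia. Qed.

(** The isomorphism of [Sym^(p-2) (x) det] with [Sym^p / <X^p, Y^p>] sends
    [X^(p-2-j) Y^j] to [(j+1)^-1 X^(p-1-j) Y^(j+1)]; [j0] is its product with
    [Sym^(a0-1)], mapped to Q. *)
Definition j0_mon (m : 'X_{1..4}) : Q S r0 r1 :=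
  (m (@Ordinal 4 3 isT)).+1%:R^-1 *:
    prQ (bmon k r0 r1 (m (@Ordinal 4 1 isT)) (m (@Ordinal 4 3 isT)).+1).

Definition j0 : {linear {mpoly k[4]} -> Q S r0 r1} := mlin j0_mon.

Lemma j0_bmon i j :
  j0 (bmon k s0 s1 i j) = j.+1%:R^-1 *: prQ (bmon k r0 r1 i j.+1).
Proof.
by rewrite /j0 /= /bmon -mpolyX_mm mlinX /j0_mon !multinomE !(tnth_nth 0%N).
Qed.

Lemma j0P c u v : j0 (c *: u + v) = c *: j0 u + j0 v. Proof. exact: linearP. Qed.
Lemma j0Z c u : j0 (c *: u) = c *: j0 u. Proof. exact: linearZ_LR. Qed.
Lemma prQP c u v : prQ (c *: u + v) = c *: prQ u + prQ v. Proof. exact: linearP. Qed.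
Lemma prQZ c u : prQ (c *: u) = c *: prQ u. Proof. exact: linearZ_LR. Qed.

Lemma det2 (R : comNzRingType) (h : 'M[R]_2) : \det h = h 0 0 * h 1 1 - h 0 1 * h 1 0.
Proof.
rewrite -det_mx2; congr (\det _); apply/matrixP => i j; rewrite mxE.
by case: i => [[|[|//]] ?]; case: j => [[|[|//]] ?] /=; congr (h _ _); apply: val_inj.
Qed.

Lemma bihom_j0 i j : (i <= s0)%N -> (j <= s1)%N -> bihom r0 r1 (bmon k r0 r1 i j.+1).
Proof. by move=> hi hj; apply: bihom_bmon; move: p2; lia. Qed.

(** As a function [eq_ p] is [x^(a0 - 1) X^(p - 1) Y] with [X = x^p] and [Y = y^p]. After the
    substitution by h, [alternating_sum_mul] splits off two terms containing [X^p = x] and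
    [Y^p = y]; they make up a form of degree a0, zero in Q. The rest is the p-th power of the
    determinant times the image of [j0]. *)
Lemma j0_highest h : h \in unitmx ->
  iota (\det h) ^+ p *: j0 (actGamma h (bmon k s0 s1 0 0)) = actGammaQ h (eq_ p).
Proof.
move=> uh; rewrite actGammaQ_pr //.
pose a := iota (h 0 0); pose b := iota (h 0 1); pose c := iota (h 1 0); pose d := iota (h 1 1).
pose V := \sum_(i < s0.+1) \sum_(j < s1.+1)
    ('C(s0, i)%:R * (a ^+ (s0 - i) * c ^+ i) *
    ('C(s1, j)%:R * ((a ^+ p) ^+ (s1 - j) * (c ^+ p) ^+ j)) * j.+1%:R^-1)
      *: bmon k r0 r1 i j.+1.
have -> : j0 (actGamma h (bmon k s0 s1 0 0)) = prQ V.
  rewrite /actGamma subst2_power !mxE /V !linear_sum; apply: eq_bigr => i _.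
  rewrite !linear_sum; apply: eq_bigr => j _.
  by rewrite j0Z j0_bmon scalerA -prQZ.
have hV : bihom r0 r1 V.
  apply: bihom_sum => i; apply: bihom_sum => j; apply/bihomZ/bihom_j0.
    by case: i.
  by case: j.
have [D De] := form_linear_power s0 a c (b ^+ p * (a ^+ p) ^+ p.-1) (d ^+ p * (c ^+ p) ^+ p.-1).
rewrite -linearZ; apply: esym.
apply: (prQ_sym_eq p_prime r0_ge r1_ge r_mod a0_bnd (d := D)).
- by apply/bihom_act/bihom_eb; lia.
- exact: bihomZ.
move=> x y; rewrite ev_act ev_eb; last lia.
have e1 : s0.+1 = a0 by lia.
have -> : \sum_(i < a0.+1) D i * (iota x ^+ (a0 - i) * iota y ^+ i) =
   (a * iota x + c * iota y) ^+ s0 * (b ^+ p * (a ^+ p) ^+ p.-1 * iota x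
     + d ^+ p * (c ^+ p) ^+ p.-1 * iota y).
  by rewrite De e1.
pose X := iota x ^+ p; pose Y := iota y ^+ p.
pose A := a ^+ p; pose B := b ^+ p; pose C := c ^+ p; pose D' := d ^+ p.
pose Sm n := \sum_(j < n.+1) (-1) ^+ j * (A * X) ^+ (n - j) * (C * Y) ^+ j.
have ez : iota (h 0 0 * x + h 1 0 * y) = a * iota x + c * iota y.
  by rewrite rmorphD !rmorphM.
set z := a * iota x + c * iota y in ez *.
have zp : z ^+ p = A * X + C * Y.
  by rewrite -ez iota_expp // !rmorphM !exprMn.
have zr : iota (h 0 0 * x + h 1 0 * y) ^+ (r - p) = z ^+ s0 * Sm p.-1.
  rewrite (@iota_mod _ _ _ _ (s0 + p * p.-1)); first last.
  - apply/eqP; rewrite -(eqn_modDr p) subnK; last lia.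
    have -> : (s0 + p * p.-1 + p = a0 + (q - 1))%N.
      have : (p * p.-1 + p = q)%N by rewrite -mulnSr prednK // -mulnn.
      by lia.
    by rewrite r_mod modnDr.
  - have pp : (0 < p.-1)%N by lia.
    by rewrite addn_gt0 muln_gt0 p0 pp orbT.
  - by lia.
  rewrite ez exprD exprM zp; congr (_ * _); rewrite exprDn /Sm prednK //.
  rewrite (eq_bigr (fun j : 'I_p => (-1) ^+ j * (A * X) ^+ (p.-1 - j) * (C * Y) ^+ j)) //.
  move=> j _; rewrite -mulr_natl (binr_pred (pchark S p_prime)) ?mulrA //.
have ewp : iota (h 0 1 * x + h 1 1 * y) ^+ p = B * X + D' * Y.
  by rewrite iota_expp // !rmorphM !exprMn.
have podd : ~~ odd p.-1.
  have [e|] := even_prime p_prime; first by move: p_gt2; rewrite e.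
  by rewrite -{1}(prednK p0).
have pp : (0 < p.-1)%N by lia.
have key := @alternating_sum_mul k p.-1 A B C D' X Y podd pp.
rewrite zr ewp -mulrA (key : Sm p.-1 * _ = _) -/(Sm _).
have Xp : X ^+ p = iota x by rewrite -exprM mulnn iota_q.
have Yp : Y ^+ p = iota y by rewrite -exprM mulnn iota_q.
rewrite prednK // Xp Yp mulrDr addrC -/A -/B -/C -/D'; congr (_ + _).
rewrite evZ.
have -> : iota (\det h) ^+ p = A * D' - B * C.
  rewrite det2 rmorphB !rmorphM -/a -/b -/c -/d.
  have := pFrobenius_autB_comm (pchark S p_prime) (mulrC (a * d) (b * c)).
  by rewrite !pFrobenius_autE => ->; rewrite !exprMn.
rewrite mulrCA; congr (_ * _).
rewrite /V ev_sum.
have -> : z ^+ s0 * (X * Y * Sm p.-1.-1) = \sum_(i < s0.+1) \sum_(j < s1.+1)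
   ('C(s0, i)%:R * ((a * iota x) ^+ (s0 - i) * (c * iota y) ^+ i)) *
   (X * Y * ((-1) ^+ j * (A * X) ^+ (s1 - j) * (C * Y) ^+ j)).
  rewrite {1}/z exprDn mulr_suml; apply: eq_bigr => i _.
  rewrite /Sm (_ : p.-1.-1 = s1) ?subn2 // !mulr_sumr; apply: eq_bigr => j _.
  by rewrite -mulr_natl.
apply: eq_bigr => i _; rewrite ev_sum; apply: eq_bigr => j _.
have hi : (i <= s0)%N by case: i.
have hj : (j <= s1)%N by case: j.
have hi0 : (i <= r0)%N by lia.
have hj1 : (j.+1 <= r1)%N by lia.
rewrite evZ ev_bmon //.
rewrite -(binr_pred2 (pchark S p_prime)); last by lia.
rewrite -subn2.
have -> : iota x ^+ (r - (i + p * j.+1)) = iota x ^+ (s0 - i) * X * X ^+ (s1 - j).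
  rewrite -mulrA -exprS /X -exprM -exprD; apply: iota_mod.
  - by have := digit_bound p1 a0_bnd hi hj; rewrite mulnSr; lia.
  - by rewrite addn_gt0 muln_gt0 p0 orbT.
  apply/eqP; rewrite -(eqn_modDr (i + p * j.+1)) subnK; last first.
    by have := digit_bound p1 a0_bnd hi hj; rewrite mulnSr; lia.
  have -> : (s0 - i + p * (s1 - j).+1 + (i + p * j.+1) = a0 + (q - 1))%N.
    have : (p * (s1 - j).+1 + p * j.+1 = q)%N.
      by rewrite -mulnDr -mulnn; congr (p * _)%N; lia.
    by lia.
  by rewrite r_mod modnDr.
have -> : iota y ^+ (i + p * j.+1) = iota y ^+ i * (Y * Y ^+ j).
  by rewrite -exprS /Y -exprM -exprD.
by rewrite !exprMn -/A -/C; ring.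
Qed.

Lemma unit_lower c : mx2 1 0 c 1 \in @unitmx Fq 2.
Proof. by rewrite unit_mx2 mul1r mul0r subr0 oner_neq0. Qed.

(** The weight is generated by its highest monomial. Translates by lower unipotents have
    coefficients proportional to [c^(i + p j)], with distinct exponents below q - 1, so a character
    sum recovers each monomial up to binomial coefficients prime to p. *)
Lemma weight_ind (P : {mpoly k[4]} -> Prop) :
  P 0 -> (forall c u v, P u -> P v -> P (c *: u + v)) ->
  (forall h, h \in unitmx -> P (actGamma h (bmon k s0 s1 0 0))) ->
  forall v, bihom s0 s1 v -> P v.
Proof.
move=> P0 PP Pact; apply: bihom_ind => // c i j v hi hj Pv; apply: (PP) => //.
pose f c := @actGamma p S (mx2 1 0 c 1) (bmon k s0 s1 0 0).
have fE c' : f c' = \sum_(i < s0.+1) \sum_(j < s1.+1)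
    ('C(s0, i)%:R * 'C(s1, j)%:R * iota c' ^+ (i + p * j)) *: bmon k s0 s1 i j.
  rewrite /f /actGamma subst2_power !mxE /= rmorph1 expr1n.
  apply: eq_bigr => i' _; apply: eq_bigr => j' _; congr (_ *: _).
  by rewrite !expr1n !mul1r exprD exprM; ring.
pose e := (i + p * j)%N; have eq := digit_bound p1 a0_bnd hi hj; rewrite -/e in eq.
pose B : k := 'C(s0, i)%:R * 'C(s1, j)%:R.
have B0 : B != 0 by rewrite mulf_neq0 // (binr_neq0_lt (pchark S p_prime)) //; lia.
case: (posnP e) => [e0|e0].
  have -> : bmon k s0 s1 i j = f 0.
    have [i0 j0] : i = 0%N /\ j = 0%N.
      by move: e0; rewrite /e => /eqP; rewrite addn_eq0 muln_eq0 => /andP[/eqP ->]; lia.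
    rewrite fE (sum_ord_eq1 (i := ord0)) => [|i' hi']; last first.
      apply: big1 => j' _; rewrite rmorph0 expr0n addn_eq0 -val_eqE /= in hi' *.
      by rewrite (negPf hi') mulr0 scale0r.
    rewrite (sum_ord_eq1 (i := ord0)) => [|j' hj']; last first.
      rewrite rmorph0 expr0n add0n muln_eq0 -val_eqE /= in hj' *.
      by rewrite (negPf hj') orbF eqn0Ngt p0 mulr0 scale0r.
    by rewrite /= !bin0 muln0 expr0 !mulr1 scale1r i0 j0.
  exact/Pact/unit_lower.
have -> : bmon k s0 s1 i j = - B^-1 *: \sum_(c : Fq) iota c ^+ (q - 1 - e) *: f c.
  have -> : \sum_(c : Fq) iota c ^+ (q - 1 - e) *: f c =
     \sum_(i < s0.+1) \sum_(j < s1.+1) ('C(s0, i)%:R * 'C(s1, j)%:R *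
         \sum_(c : Fq) iota c ^+ (q - 1 - e + (i + p * j))) *: bmon k s0 s1 i j.
    under eq_bigr do rewrite fE scaler_sumr.
    rewrite exchange_big; apply: eq_bigr => i' _ /=.
    under eq_bigr do rewrite scaler_sumr.
    rewrite exchange_big; apply: eq_bigr => j' _ /=.
    rewrite mulr_sumr scaler_suml; apply: eq_bigr => c' _.
    by rewrite scalerA [_ ^+ (_ - e + _)]exprD; congr (_ *: _); ring.
  have hsum (i' : 'I_s0.+1) (j' : 'I_s1.+1) :
      \sum_(c : Fq) iota c ^+ (q - 1 - e + (i' + p * j')) =
      if (i' == i :> nat) && (j' == j :> nat) then -1 else 0.
    have hi' : (i' <= s0)%N by case: i'.
    have hj' : (j' <= s1)%N by case: j'.
    have eq' := digit_bound p1 a0_bnd hi' hj'.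
    have ip : (i < p)%N by lia.
    have ip' : (i' < p)%N by lia.
    rewrite iota_power_sum; last by lia.
    congr (if _ then _ else _).
    have -> : (q - 1 - e + (i' + p * j') == q - 1)%N = (j' * p + i' == j * p + i)%N.
      by rewrite /e ![(_ * p)%N]mulnC; apply/eqP/eqP; rewrite /e in eq *; lia.
    apply/eqP/andP => [E|[/eqP -> /eqP ->]//].
    have := congr1 (fun n => n %% p)%N E; have := congr1 (fun n => n %/ p)%N E.
    rewrite /= !divnMDl // !divn_small // !addn0 => ->.
    by rewrite !modnMDl !modn_small // => ->; rewrite !eqxx.
  have hi' : (i < s0.+1)%N by lia.
  have hj' : (j < s1.+1)%N by lia.
  rewrite (sum_ord_eq1 (i := Ordinal hi')) => [|i' ni]; last first.
    by apply: big1 => j' _; rewrite hsum -val_eqE /= in ni *; rewrite (negPf ni) mulr0 scale0r.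
  rewrite (sum_ord_eq1 (i := Ordinal hj')) => [|j' nj]; last first.
    by rewrite hsum -val_eqE /= in nj *; rewrite (negPf nj) andbF mulr0 scale0r.
  by rewrite hsum /= !eqxx /= scalerA -/B mulrN1 mulrNN mulVf // scale1r.
rewrite -[X in P X]addr0; apply: (PP) => //.
apply: big_ind => //= [u w Pu Pw|c' _]; first by rewrite -[u]scale1r; apply: PP.
by rewrite -[X in P X]addr0; apply: PP => //; apply/Pact/unit_lower.
Qed.

(** On a translate by h of the highest monomial, compare [j0_highest] for h and for the product of g
    and h. *)
Lemma j0_equiv g v : g \in unitmx -> bihom s0 s1 v ->
  j0 (actWtGamma p g v) = actGammaQ g (j0 v).
Proof.
move=> ug; move: v; apply: weight_ind => [|c u v IHu IHv|h uh].
- by rewrite /actWtGamma !linear0 ?scaler0 ?linear0 (actGammaQ_0 p_prime).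
- rewrite j0P (actGammaQ_linear p_prime) // -IHu -IHv /actWtGamma linearP /=.
  by rewrite scalerDr scalerA mulrC -scalerA j0P.
have dh : iota (\det h) ^+ p != 0.
  by rewrite expf_neq0 // fmorph_eq0 -unitfE -unitmxE.
apply: (scalerI dh); rewrite -(actGammaQ_Z p_prime) // j0_highest //.
rewrite -(actGammaQ_M p_prime) // -j0_highest ?unitmx_mul ?ug //.
rewrite /actWtGamma (actGammaM p_prime) det_mulmx rmorphM exprMn !j0Z scalerA.
by rewrite mulrC.
Qed.

Lemma inQ_j0 v : bihom s0 s1 v -> inQ (j0 v).
Proof.
move: v; apply: bihom_ind => [|c i j v hi hj [u hu e]].
  by exists 0; rewrite ?linear0 //; apply: bihom0.
exists (c *: (j.+1%:R^-1 *: bmon k r0 r1 i j.+1) + u).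
  by apply: bihomD => //; do 2 apply: bihomZ; apply: bihom_j0.
by rewrite j0P j0_bmon e prQP prQZ.
Qed.

Lemma j0_submodule : Gamma_submodule (fun x => exists2 v, bihom s0 s1 v & x = j0 v).
Proof.
split.
- by move=> x [v hv ->]; apply: inQ_j0.
- by exists 0; rewrite ?linear0 //; apply: bihom0.
- move=> c x y [u hu ->] [v hv ->]; exists (c *: u + v); last by rewrite j0P.
  by apply: bihomD => //; apply: bihomZ.
- move=> g x ug [v hv ->]; exists (actWtGamma p g v); last by rewrite j0_equiv.
  by apply: bihomZ; apply: bihom_act.
Qed.

Lemma ev_Xr v : inXr r0 r1 v -> exists d : nat -> k, forall y,
  ev 1 y v = \sum_(i < a0.+1) d i * iota y ^+ i.
Proof.
elim=> [|c u w [g ug ->] _ [d IH]].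
  by exists (fun=> 0) => y; rewrite /ev raddf0 big1 // => i _; rewrite mul0r.
exists (fun i => c * ('C(a0, i)%:R * iota (g 0 0) ^+ (a0 - i) * iota (g 1 0) ^+ i) + d i).
move=> y; rewrite evD evZ IH.
have -> : X0 k ^+ r0 * X1 k ^+ r1 = bmon k r0 r1 0 0.
  by rewrite /bmon !subn0 mon.unlock !expr0 !mulr1.
rewrite (ev_act_X p_prime r0_ge r1_ge r_mod a0_bnd) mulr1 rmorphD rmorphM exprDn mulr_sumr.
rewrite -big_split; apply: eq_bigr => i _ /=.
by rewrite mulrDl exprMn -mulr_natl; ring.
Qed.

(** On the line x = 1 an element of [V_r^* + X_r] is a polynomial function of degree at most a0 < p
    in y, whereas this class would give [y^p]; as p < q the two cannot agree on all of [Fq]. *)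
Lemma eq_p_neq0 : eq_ p != 0.
Proof.
apply/eqP; rewrite -(linear0 prQ) => /toquo_eq; rewrite subr0 => H.
have [d hd] : exists d : nat -> k, forall y,
    ev 1 y (eb p) = \sum_(i < a0.+1) d i * iota y ^+ i.
  elim: H => [|c u w h _ [d IH]].
    by exists (fun=> 0) => y; rewrite /ev raddf0 big1 // => i _; rewrite mul0r.
  have [d' hd'] : exists d : nat -> k, forall y,
     ev 1 y u = \sum_(i < a0.+1) d i * iota y ^+ i.
    case: h => [h|]; last exact: ev_Xr.
    by exists (fun=> 0) => y; rewrite (ev_Vstar _ _ h) big1 // => i _; rewrite mul0r.
  exists (fun i => c * d' i + d i) => y; rewrite evD evZ IH hd' mulr_sumr -big_split.
  by apply: eq_bigr => i _ /=; ring.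
pose P : {poly k} := 'X^p - \poly_(i < a0.+1) d i.
have sP : size P = p.+1.
  rewrite size_polyDl size_polyXn // size_polyN.
  by apply: (leq_ltn_trans (size_poly _ _)); lia.
suff P0 : P = 0 by move: sP; rewrite P0 size_poly0.
apply: (@roots_geq_poly_eq0 _ _ [seq iota y | y <- enum Fq]).
- apply/allP => z /mapP[y _ ->]; have := hd y; rewrite ev_eb; last lia.
  rewrite rmorph1 expr1n mul1r => e.
  by rewrite rootE hornerD hornerN hornerXn horner_poly e subrr.
- by rewrite map_inj_uniq ?enum_uniq //; apply: fmorph_inj.
- by rewrite size_map -cardE cardFq sP; lia.
Qed.

Lemma eq_p_j0 : eq_ p = j0 (bmon k s0 s1 0 0).
Proof. by rewrite j0_bmon invr1 scale1r -[LHS]/(prQ (eb p)) ebE modnn divnn p0. Qed.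

Lemma j0_in_submodule M : Gamma_submodule M -> M (eq_ p) ->
  forall v, bihom s0 s1 v -> M (j0 v).
Proof.
move=> MP Mp; apply: weight_ind => [|c u v Mu Mv|h uh].
- by rewrite linear0; apply: subQ0 MP.
- by rewrite j0P; apply: subQP MP _ _ _ Mu Mv.
have dh : iota (\det h) ^+ p != 0.
  by rewrite expf_neq0 // fmorph_eq0 -unitfE -unitmxE.
apply: (subQZ_neq0 MP dh); rewrite j0_highest //.
exact: subQ_act MP _ _ uh Mp.
Qed.

(** M contains [eq_ p], hence the image of [j0], which this vector generates. Minimality of M
    applied to its intersection with that image gives the other inclusion. *)
Lemma simple_j0 M : Gamma_simple M ->
  forall x, M x <-> exists2 v, bihom s0 s1 v & x = j0 v.
Proof.
move=> [MP [x Mx x0] Mmin].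
have Mp := subQ_contains_p p_prime r0_ge r1_ge r_mod a0_bnd MP Mx x0.
have NP : Gamma_submodule (fun x => M x /\ exists2 v, bihom s0 s1 v & x = j0 v).
  have JP := j0_submodule; split.
  - by move=> y [My _]; case: MP => + _ _ _; apply.
  - by split; [apply: subQ0 MP | apply: subQ0 JP].
  - by move=> c y z [My Jy] [Mz Jz]; split; [apply: subQP MP _ _ _ My Mz | apply: subQP JP _ _ _ Jy Jz].
  - by move=> g y ug [My Jy]; split; [apply: subQ_act MP _ _ ug My | apply: subQ_act JP _ _ ug Jy].
have [N0|MN] := Mmin _ NP (fun y => @proj1 _ _).
  have := N0 (eq_ p); move/(_ _)/eqP; rewrite (negPf eq_p_neq0) => H.
  have // : false by apply: H; split=> //; exists (bmon k s0 s1 0 0); rewrite ?eq_p_j0 //; apply: bihom_bmon.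
move=> y; split=> [/MN[]//|[v hv ->]].
exact: j0_in_submodule.
Qed.

Lemma soc_j0 x : socQ x -> exists2 v, bihom s0 s1 v & x = j0 v.
Proof.
elim=> [|c u w [M Ms Mu] _ IH]; first by apply: subQ0 j0_submodule.
by apply: subQP j0_submodule _ _ _ _ IH; apply/(simple_j0 Ms).
Qed.

(** A nonzero vector of the socle supplies a simple submodule, necessarily the image of [j0]. In
    this way [j0] is known to land in the socle without a proof that the weight is irreducible. *)
Lemma wt_hom_j0 (x : Q S r0 r1) : socQ x -> x != 0 -> wt_hom s0 s1 p j0.
Proof.
move=> sx x0; split=> [v hv|g v ug hv]; last exact: j0_equiv.
have [M Ms] : exists M : Q S r0 r1 -> Prop, Gamma_simple M.
  by case: sx x0 => [|c u w [M Ms Mu] _ _]; [rewrite eqxx | exists M].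
rewrite -[j0 v]addr0 -[j0 v]scale1r; apply: span_step; last exact: span_zero.
by exists M => //; apply/(simple_j0 Ms); exists v.
Qed.

End Socle.

(** * Integral polynomials: expansions to first order and reduction *)

Section IntegralPolynomials.
Variables (K : fieldType) (A : realDomainType) (v : K -> A) (n : nat).
Hypothesis vP : is_valuation v.
Implicit Types u w : {mpoly K[n]}.

Definition intp (N : A) u : Prop := forall m, vge v N u@_m.

Lemma intp_0 N : intp N 0.
Proof. by move=> m; rewrite mcoeff0; apply: vge_0. Qed.

Lemma intpW N M u : N <= M -> intp M u -> intp N u.
Proof. by move=> NM iu m; apply: vgeW NM (iu m). Qed.

Lemma intpD N u w : intp N u -> intp N w -> intp N (u + w).
Proof. by move=> iu iw m; rewrite mcoeffD; apply: (vgeD vP). Qed.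

Lemma intpZ N M c u : vge v N c -> intp M u -> intp (N + M) (c *: u).
Proof. by move=> ic iu m; rewrite mcoeffZ; apply: (vgeM vP). Qed.

Lemma intpZl N c u : vge v 0 c -> intp N u -> intp N (c *: u).
Proof. by move=> ic iu; rewrite -[N]add0r; apply: intpZ. Qed.

Lemma intpZr N c u : vge v N c -> intp 0 u -> intp N (c *: u).
Proof. by move=> ic iu; rewrite -[N]addr0; apply: intpZ. Qed.

Lemma intpN N u : intp N u -> intp N (- u).
Proof. by move=> iu m; rewrite mcoeffN; apply: (vgeN vP). Qed.

Lemma intpB N u w : intp N u -> intp N w -> intp N (u - w).
Proof. by move=> iu iw; apply: intpD => //; apply: intpN. Qed.

Lemma intpM N M u w : intp N u -> intp M w -> intp (N + M) (u * w).
Proof.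
move=> iu iw m; rewrite mcoeffM; apply: (vge_sum vP) => x _.
exact: (vgeM vP).
Qed.

Lemma intpMl N u w : intp 0 u -> intp N w -> intp N (u * w).
Proof. by move=> iu iw; rewrite -[N]add0r; apply: intpM. Qed.

Lemma intp_sum N (I : Type) (r : seq I) (f : I -> {mpoly K[n]}) :
  (forall i, intp N (f i)) -> intp N (\sum_(i <- r) f i).
Proof. by move=> hf; apply: big_ind => //; [apply: intp_0 | apply: intpD]. Qed.

Lemma intp_X m : intp 0 'X_[m].
Proof. by move=> m'; rewrite mcoeffX; case: eqP; rewrite ?(vge_1 vP) ?vge_0. Qed.

Lemma intp_exp u e : intp 0 u -> intp 0 (u ^+ e).
Proof.
move=> iu; elim: e => [|e IH]; last by rewrite exprS; apply: intpMl.
by rewrite expr0 -mpolyX0; apply: intp_X.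
Qed.

Lemma exp_cong1 c x z e : vge v 0 c -> intp 0 x -> intp 0 z ->
  exists2 w, intp 0 w & (x + c *: z) ^+ e = x ^+ e + c *: w.
Proof.
move=> ic ix iz; elim: e => [|e [w iw IH]].
  by exists 0; [apply: intp_0 | rewrite scaler0 addr0].
exists (z * (x ^+ e + c *: w) + x * w).
  apply: intpD; last exact: intpMl.
  by apply: intpMl => //; apply: intpD; [apply: intp_exp | apply: intpZl].
by rewrite exprS IH mulrDl mulrDr -scalerAr -scalerAl [RHS]addrC scalerDr
  -[RHS]addrA [RHS]addrC [c *: (x * w) + _]addrC exprS.
Qed.

Lemma exp_cong2 c x z e : vge v 0 c -> intp 0 x -> intp 0 z ->
  exists2 w, intp 0 w & (x + c *: z) ^+ e =
    x ^+ e + c *: (e%:R *: (x ^+ e.-1 * z)) + (c ^+ 2) *: w.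
Proof.
move=> ic ix iz; elim: e => [|e [w iw IH]].
  by exists 0; [apply: intp_0 | rewrite scale0r !scaler0 !addr0].
exists (e%:R *: (x ^+ e.-1 * z * z) + x * w + c *: (z * w)).
  apply: intpD; first (apply: intpD; last exact: intpMl).
    apply: intpZl; first exact: vge_nat.
    by do 2 apply: intpMl => //; apply: intp_exp.
  by apply: intpZl => //; apply: intpMl.
rewrite exprS IH /= -!mul_mpolyC !mpolyCM ?rmorphXn /=.
(* At e = 0 the truncated [e.-1] is harmless because its coefficient [e%:R] is zero. *)
have xe : e%:R%:MP_[n] * (x * x ^+ e.-1) = e%:R%:MP_[n] * x ^+ e.
  by case: (e) => [|e']; rewrite ?mpolyC0 ?mul0r // -exprS.
have -> : (e.+1%:R : K)%:MP_[n] = 1 + e%:R%:MP_[n] by rewrite -natr1 mpolyCD addrC mpolyC1.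
transitivity (x ^+ e.+1 + c%:MP_[n] * (x ^+ e * z) + c%:MP_[n] * z * (e%:R%:MP_[n] * (x * x ^+ e.-1))
  + c%:MP_[n] ^+ 2 * (e%:R%:MP_[n] * (x ^+ e.-1 * z * z) + x * w + c%:MP_[n] * (z * w))).
  by rewrite exprS -!rmorphXn; ring.
by rewrite xe; ring.
Qed.

Section Reduction.
Variables (k : fieldType) (red : K -> k).
Hypothesis redP : is_residue_map v red.
Local Notation redp := (@map_mpoly n _ _ red).

(** As [red] is a morphism only on the valuation ring, coefficients are read off the sum that
    defines [map_mpoly]; off the support this needs [red 0 = 0]. *)
Lemma mcoeff_redp u m : (redp u)@_m = red u@_m.
Proof.
rewrite /map_mpoly /mmap raddf_sum /=.
under eq_bigr => m' _ do rewrite mmap1_id /= mcoeffCM mcoeffX.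
case: (boolP (m \in msupp u)) => mu.
  rewrite (bigD1_seq m) //= eqxx mulr1 big1 ?addr0 // => m' /negPf ->.
  by rewrite mulr0.
rewrite big_seq big1 => [|m' m'u].
  by move: mu; rewrite -mcoeff_eq0 => /eqP ->; rewrite (red_0 redP).
by case: eqP mu => [<-|]; rewrite ?m'u // mulr0.
Qed.

Lemma redpD u w : intp 0 u -> intp 0 w -> redp (u + w) = redp u + redp w.
Proof.
by move=> iu iw; apply/mpolyP => m; rewrite mcoeffD !mcoeff_redp mcoeffD (red_D redP).
Qed.

Lemma redpZ c u : vge v 0 c -> intp 0 u -> redp (c *: u) = red c *: redp u.
Proof.
by move=> ic iu; apply/mpolyP => m; rewrite mcoeffZ !mcoeff_redp mcoeffZ (red_M redP).
Qed.

Lemma redpM u w : intp 0 u -> intp 0 w -> redp (u * w) = redp u * redp w.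
Proof.
move=> iu iw; apply/mpolyP => m; rewrite mcoeff_redp (mcoeffM u w) (mcoeffM (redp u)).
rewrite (red_sum vP redP) => [|x]; last exact: (vgeMl vP).
by apply: eq_bigr => x _; rewrite (red_M redP) // !mcoeff_redp.
Qed.

Lemma redpX m : redp 'X_[m] = 'X_[m].
Proof.
apply/mpolyP => m'; rewrite mcoeff_redp !mcoeffX.
by case: eqP; rewrite ?(red_1 redP) ?(red_0 redP).
Qed.

Lemma redp_exp u e : intp 0 u -> redp (u ^+ e) = redp u ^+ e.
Proof.
move=> iu; elim: e => [|e IH]; first by rewrite !expr0 -mpolyX0 redpX mpolyX0.
by rewrite !exprS redpM ?IH //; apply: intp_exp.
Qed.

Lemma redp_small u N : 0 < N -> intp N u -> redp u = 0.
Proof.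
move=> N0 iu; apply/mpolyP => m; rewrite mcoeff_redp mcoeff0; apply: (red_gt redP).
exact: vge_gt N0 (iu m).
Qed.

End Reduction.
End IntegralPolynomials.

(** * Integrality and reduction over F and E *)

Section FieldE.
Variables (p : nat) (S : setting p).
Hypothesis p_prime : prime p.
Local Notation F := (F S).
Local Notation E := (E S).
Local Notation Fq := (Fq S).
Local Notation k := (k S).
Local Notation vF := (@vF p S).
Local Notation redF := (@redF p S).
Local Notation redE := (@redE p S).
Local Notation iota := (@iota p S).
Local Notation teich := (@teich p S).
Local Notation sigma := (@sigma p S).
Local Notation intp := (@intp E rat vE 4).
Local Notation redp := (@map_mpoly 4 _ _ redE).

Lemma algD (x y : F) : (x + y)%:A = x%:A + y%:A :> E. Proof. exact: scalerDl. Qed.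
Lemma algM (x y : F) : (x * y)%:A = x%:A * y%:A :> E.
Proof. by rewrite -!in_algE rmorphM. Qed.
Lemma algX (x : F) n : (x ^+ n)%:A = x%:A ^+ n :> E.
Proof. by rewrite -!in_algE rmorphXn. Qed.
Lemma algN (x : F) : (- x)%:A = - x%:A :> E. Proof. exact: scaleNr. Qed.
Lemma alg_nat n : (n%:R : F)%:A = n%:R :> E. Proof. exact: scaler_nat. Qed.
Lemma alg_sum (I : Type) (r : seq I) (f : I -> F) :
  (\sum_(i <- r) f i)%:A = \sum_(i <- r) (f i)%:A :> E.
Proof. exact: scaler_suml. Qed.

Lemma alg_neq0 (x : F) : x != 0 -> x%:A != 0 :> E.
Proof. by move=> x0; rewrite scaler_eq0 negb_or x0 oner_neq0. Qed.

Lemma pE_neq0 : p%:R != 0 :> E.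
Proof. by rewrite -alg_nat alg_neq0 // pF_neq0. Qed.

Lemma vE_p : vE (p%:R : E) = 1.
Proof. by rewrite -alg_nat vEE ?pF_neq0 // vF_p. Qed.

Lemma vge_alg (n : int) (x : F) : vge vF n x -> vge vE n%:~R (x%:A : E).
Proof.
rewrite /vge; case: (eqVneq x 0) => [->|x0] /=; first by rewrite scale0r eqxx.
by move=> vx; rewrite vEE // ler_int vx orbT.
Qed.

Lemma vge_alg0 (x : F) : vge vF 0 x -> vge vE 0 (x%:A : E).
Proof. exact: (@vge_alg 0). Qed.

(** F is unramified: the maximal ideal is generated by p. *)
Lemma vge_alg1 (x : F) : vge vF 0 x -> redF x = 0 -> vge vE 1 (x%:A : E).
Proof.
move=> vx /eqP; rewrite (red_eq0 (redFP S)) // => gx; apply: (@vge_alg 1).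
by move: gx; rewrite /vgt /vge => /orP[->//|]; rewrite gtz0_ge1 => ->; rewrite orbT.
Qed.

Lemma vge_p : vge vE 1 (p%:R : E).
Proof. by rewrite /vge vE_p lexx orbT. Qed.

Lemma vge_p0 : vge vE 0 (p%:R : E).
Proof. exact: vge_nat (vEP S) _. Qed.

Lemma vge_teich l : vge vF 0 (teich l). Proof. by case: (teich_red l). Qed.
Lemma red_teich l : redF (teich l) = l. Proof. by case: (teich_red l). Qed.

Lemma vge_sigma x : vge vF 0 x -> vge vF 0 (sigma x).
Proof. by move=> /sigma_red[]. Qed.
Lemma red_sigma x : vge vF 0 x -> redF (sigma x) = redF x ^+ p.
Proof. by move=> /sigma_red[]. Qed.

Lemma intp_mon a b c d : intp 0 (mon E a b c d).
Proof. by rewrite -mpolyX_mm; apply: (intp_X (vEP S)). Qed.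

Lemma redp_mon a b c d : redp (mon E a b c d) = mon k a b c d.
Proof. by rewrite -!mpolyX_mm (redpX (redEP S)). Qed.

Lemma X0E (R : comNzRingType) : X0 R = mon R 1 0 0 0.
Proof. by rewrite mon.unlock !expr0 expr1 !mulr1. Qed.
Lemma Y0E (R : comNzRingType) : Y0 R = mon R 0 1 0 0.
Proof. by rewrite mon.unlock !expr0 expr1 !mulr1 mul1r. Qed.
Lemma X1E (R : comNzRingType) : X1 R = mon R 0 0 1 0.
Proof. by rewrite mon.unlock !expr0 expr1 !mulr1 !mul1r. Qed.
Lemma Y1E (R : comNzRingType) : Y1 R = mon R 0 0 0 1.
Proof. by rewrite mon.unlock !expr0 expr1 !mul1r. Qed.

Lemma intp_form a b c d a' b' c' d' (s t : E) : vge vE 0 s -> vge vE 0 t ->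
  intp 0 (s *: mon E a b c d + t *: mon E a' b' c' d').
Proof.
by move=> is_ it; apply: (intpD (vEP S)); apply: (intpZl (vEP S)) => //; apply: intp_mon.
Qed.

Lemma redp_form a b c d a' b' c' d' (s t : E) : vge vE 0 s -> vge vE 0 t ->
  redp (s *: mon E a b c d + t *: mon E a' b' c' d') =
  redE s *: mon k a b c d + redE t *: mon k a' b' c' d'.
Proof.
move=> is_ it.
have iZ (c0 : E) a1 b1 c1 d1 : vge vE 0 c0 -> intp 0 (c0 *: mon E a1 b1 c1 d1).
  by move=> h; apply: (intpZl (vEP S)) => //; apply: intp_mon.
rewrite (redpD (redEP S)) ?(redpZ (redEP S)) ?redp_mon //; do ?exact: iZ; exact: intp_mon.
Qed.

Section IntegralSubst.
Variables A0 A1 : 'M[E]_2.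
Hypothesis iA0 : forall i j, vge vE 0 (A0 i j).
Hypothesis iA1 : forall i j, vge vE 0 (A1 i j).

Lemma intp_subst2_mon a b c d : intp 0 (subst2 A0 A1 (mon E a b c d)).
Proof.
rewrite subst2_mon X0E Y0E X1E Y1E; have iX e u : intp 0 u -> intp 0 (u ^+ e).
  exact: (intp_exp (vEP S)).
by do 3 (apply: (intpMl (vEP S)); last (by apply: iX; apply: intp_form)); apply: iX; apply: intp_form.
Qed.

Lemma intp_subst2 N u : intp N u -> intp N (subst2 A0 A1 u).
Proof.
move=> iu; rewrite /subst2 comp_mpolyEX; apply: (intp_sum (vEP S)) => m.
apply: (intpZr (vEP S)) => //; rewrite [m]mm_eta mpolyX_mm.
exact: intp_subst2_mon.
Qed.

Lemma redp_subst2_mon a b c d : redp (subst2 A0 A1 (mon E a b c d)) =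
  subst2 (map_mx redE A0) (map_mx redE A1) (mon k a b c d).
Proof.
rewrite !subst2_mon !X0E !Y0E !X1E !Y1E.
have iX e a1 b1 c1 d1 a2 b2 c2 d2 (s t : E) : vge vE 0 s -> vge vE 0 t ->
    intp 0 ((s *: mon E a1 b1 c1 d1 + t *: mon E a2 b2 c2 d2) ^+ e).
  by move=> is_ it; apply: (intp_exp (vEP S)); apply: intp_form.
have iM u w : intp 0 u -> intp 0 w -> intp 0 (u * w) by apply: (intpMl (vEP S)).
have rX e a1 b1 c1 d1 a2 b2 c2 d2 (s t : E) : vge vE 0 s -> vge vE 0 t ->
    redp ((s *: mon E a1 b1 c1 d1 + t *: mon E a2 b2 c2 d2) ^+ e) =
    (redE s *: mon k a1 b1 c1 d1 + redE t *: mon k a2 b2 c2 d2) ^+ e.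
  by move=> is_ it; rewrite (redp_exp (vEP S) (redEP S)) ?redp_form //; apply: intp_form.
have := redpM (vEP S) (redEP S); move=> rM.
rewrite rM; [|by apply: (iM); [apply: (iM)|]; apply: iX|by apply: iX].
rewrite rM; [|by apply: (iM); apply: iX|by apply: iX].
rewrite rM; [|by apply: iX|by apply: iX].
by rewrite !mxE; congr (_ * _ * _ * _); apply: rX.
Qed.

End IntegralSubst.

Local Notation inK := (@inK p S).

Lemma map_alg_int g : inK g -> forall i j, vge vE 0 (map_mx (fun x => x%:A : E) g i j).
Proof. by move=> [ig _] i j; rewrite mxE; apply: vge_alg0. Qed.

Lemma map_sigma_int g : inK g ->
  forall i j, vge vE 0 (map_mx (fun x => (sigma x)%:A : E) g i j).
Proof. by move=> [ig _] i j; rewrite mxE; apply/vge_alg0/vge_sigma. Qed.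

Lemma redp_actE g a b c d : inK g ->
  redp (actE g (mon E a b c d)) = actGamma (map_mx redF g) (mon k a b c d).
Proof.
move=> Kg; rewrite /actE /actGamma redp_subst2_mon; [|exact: map_alg_int|exact: map_sigma_int].
case: (Kg) => ig _.
have -> : map_mx redE (map_mx (fun x => x%:A) g) = map_mx iota (map_mx redF g).
  by apply/matrixP => i j; rewrite !mxE redE_F.
congr subst2; apply/matrixP => i j; rewrite !mxE redE_F; last exact: vge_sigma.
by rewrite red_sigma // rmorphXn.
Qed.

Lemma actE_linear g : linear (@actE p S g).
Proof. by move=> c u v; rewrite /actE linearP. Qed.

Lemma actE_M g h v : actE (g *m h) v = actE g (@actE p S h v).
Proof.
rewrite /actE subst2M.
have -> : map_mx (fun x => x%:A : E) (g *m h) =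
    map_mx (fun x => x%:A) g *m map_mx (fun x => x%:A) h.
  by apply/matrixP => i j; rewrite !mxE !sum_ord2 !mxE algD !algM.
have -> // : map_mx (fun x => (sigma x)%:A : E) (g *m h) =
    map_mx (fun x => (sigma x)%:A) g *m map_mx (fun x => (sigma x)%:A) h.
by apply/matrixP => i j; rewrite !mxE !sum_ord2 !mxE rmorphD !rmorphM algD !algM.
Qed.

Lemma inVO_act r0 r1 g v : inK g -> inVO r0 r1 v -> inVO r0 r1 (@actE p S g v).
Proof.
move=> Kg [hv iv]; split; first exact: bihom_subst2.
by apply: intp_subst2 => //; [apply: map_alg_int | apply: map_sigma_int].
Qed.

Lemma map_redM g h : inK g -> inK h ->
  map_mx redF (g *m h) = map_mx redF g *m map_mx redF h.
Proof.
move=> [ig _] [ih _]; apply/matrixP => i j; rewrite !mxE !sum_ord2 !mxE.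
by rewrite (red_D (redFP S)) ?(red_M (redFP S)) //; apply: (vgeMl (vFP S)).
Qed.

Lemma map_red_det g : inK g -> \det (map_mx redF g) = redF (\det g).
Proof.
move=> [ig _]; rewrite !det2 !mxE.
have iM i j i' j' : vge vF 0 (g i j * g i' j') by apply: (vgeMl (vFP S)).
by rewrite (red_B (vFP S) (redFP S)) // !(red_M (redFP S)).
Qed.

Lemma map_red_unit g : inK g -> map_mx redF g \in unitmx.
Proof.
move=> Kg; rewrite unitmxE map_red_det // unitfE; case: Kg => _ [d0 vd].
rewrite (red_eq0 (redFP S)) /vgt ?negb_or ?d0 ?vd ?ltxx //.
by rewrite /vge vd lexx orbT.
Qed.

(** The entries are lifted by Teichmueller representatives; the determinant is a unit because its
    reduction is nonzero. *)
Lemma lift_Gamma (g : 'M[Fq]_2) : g \in unitmx ->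
  exists2 h, inK h & map_mx redF h = g.
Proof.
move=> ug; pose h := map_mx teich g.
have ih i j : vge vF 0 (h i j) by rewrite mxE; apply: vge_teich.
have hg : map_mx redF h = g by apply/matrixP => i j; rewrite !mxE red_teich.
have id : vge vF 0 (\det h).
  by rewrite det2; apply: (vgeB (vFP S)); apply: (vgeMl (vFP S)).
have rd : redF (\det h) = \det g.
  have eh i j : g i j = redF (h i j) by rewrite -hg mxE.
  have iM i j i' j' : vge vF 0 (h i j * h i' j') by apply: (vgeMl (vFP S)).
  by rewrite !det2 !eh (red_B (vFP S) (redFP S)) // !(red_M (redFP S)).
have ngt : ~~ vgt vF 0 (\det h).
  by rewrite -(red_eq0 (redFP S)) // rd -unitfE -unitmxE.
exists h => //; split=> //; move: ngt; rewrite /vgt negb_or -leNgt => /andP[d0 vd].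
by split=> //; move: id; rewrite /vge (negPf d0) /= => id; apply/eqP; rewrite eq_le vd.
Qed.

End FieldE.

(** * Classes of brackets in the reduced lattice; factorisation through Q *)

Lemma mul_scale4 (R : comNzRingType) n (x y z t : {mpoly R[n]}) (al be : R) :
  x * (al *: y) * z * (be *: t) = (al * be) *: (x * y * z * t).
Proof. by rewrite -!mul_mpolyC mpolyCM; ring. Qed.

Lemma mul_expand1 (R : comNzRingType) n (x y u0 w0 u1 w1 : {mpoly R[n]}) (c : R) :
  x * (u0 + c *: w0) * y * (u1 + c *: w1) - x * u0 * y * u1 =
  c *: (x * w0 * y * (u1 + c *: w1) + x * u0 * y * w1).
Proof. by rewrite -!mul_mpolyC; ring. Qed.

Lemma sub_cong (V : zmodType) (x y z t : V) : y - x = (y - z) - (x - t) + (z - t).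
Proof.
rewrite opprB -addrA; have -> : t - x + (z - t) = z - x by rewrite addrC addrA subrK.
by rewrite addrA subrK.
Qed.

Lemma sub_telescope (V : zmodType) (x y z t : V) : y = t + x - z - (t + (x - y) - z).
Proof. by rewrite addrA [t + x - y - z]addrAC opprB [RHS]addrC subrK. Qed.

Section ThetaBar.
Variables (p : nat) (S : setting p).
Hypothesis p_prime : prime p.
Local Notation F := (F S).
Local Notation E := (E S).
Local Notation Fq := (Fq S).
Local Notation k := (k S).
Local Notation vF := (@vF p S).
Local Notation redF := (@redF p S).
Local Notation redE := (@redE p S).
Local Notation teich := (@teich p S).
Local Notation intp := (@intp E rat vE 4).
Local Notation redp := (@map_mpoly 4 _ _ redE).
Local Notation q := (p ^ 2)%N.

Variables (r0 r1 : nat) (ap : E).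
Local Notation inVO := (@inVO p S r0 r1).
Local Notation indVO := (@indVO p S r0 r1).
Local Notation TB := (ThetaBar r0 r1 ap).
Local Notation toPi := (toquo (TsubE r0 r1 ap)).

(** The value 0 is a default when the class of f lies outside [Theta]; it keeps membership proofs
    out of identities between classes. *)
Definition cls (f : 'M[F]_2 -> {mpoly E[4]}) : TB :=
  if pselect (inTheta (toPi f)) is left h then tensor1 (exist _ (toPi f) (asboolT h))
  else 0.

Lemma clsE f (y : Theta r0 r1 ap) : indVO f -> val y = toPi f -> cls f = tensor1 y.
Proof.
move=> If e; rewrite /cls; case: pselect => [h|[]]; last by exists f.
by congr tensor1; apply: val_inj.
Qed.

Lemma cls_lift f : indVO f -> exists2 y : Theta r0 r1 ap, val y = toPi f & cls f = tensor1 y.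
Proof.
move=> If; have h : inTheta (toPi f) by exists f.
by exists (exist _ (toPi f) (asboolT h)) => //; apply: clsE.
Qed.

Lemma tensor1D (y1 y2 y3 : Theta r0 r1 ap) :
  val y3 = val y1 + val y2 -> tensor1 y3 = tensor1 y1 + tensor1 y2.
Proof.
move=> e; apply/eqP; rewrite -subr_eq0 opprD addrA -!linearB -(linear0 (toquo _)).
apply/eqP/toquo_eq; rewrite subr0 -[X in span _ X]addr0 -[X in X + 0]scale1r.
by apply: span_step; [left; exists y1, y2, y3 | exact: span_zero].
Qed.

Lemma tensor1Z c (y1 y2 : Theta r0 r1 ap) : vge vE 0 c ->
  val y2 = c *: val y1 -> tensor1 y2 = redE c *: tensor1 y1.
Proof.
move=> ic e; apply/eqP; rewrite -subr_eq0 /tensor1 -linearZ -linearB -(linear0 (toquo _)).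
apply/eqP/toquo_eq; rewrite subr0 -[X in span _ X]addr0 -[X in X + 0]scale1r.
by apply: span_step; [right; exists c, y1, y2 | exact: span_zero].
Qed.

Lemma inVO0 : inVO 0.
Proof. by split; [exact: bihom0 | exact: intp_0]. Qed.

Lemma inVOP c u v : vge vE 0 c -> inVO u -> inVO v -> inVO (c *: u + v).
Proof.
move=> ic [hu iu] [hv iv]; split; first by apply: bihomD => //; apply: bihomZ.
by apply: (intpD (vEP S)) => //; apply: (intpZl (vEP S)).
Qed.

Local Notation bra := (bra (@actE p S)).

Lemma braE_linear g : linear (bra g).
Proof. by apply: bra_linear => h _; apply: actE_linear. Qed.

Lemma braE_Z g c v : bra g (c *: v) = c *: bra g v.
Proof.
have b0 : bra g 0 = 0.
  by have := braE_linear g (-1) 0 0; rewrite scaler0 addr0 scaleN1r addNr.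
by rewrite -[c *: v]addr0 braE_linear b0 addr0.
Qed.

Lemma braE_D g u v : bra g (u + v) = bra g u + bra g v.
Proof. by rewrite -{1}[u]scale1r braE_linear scale1r. Qed.

Lemma braE_B g u v : bra g (u - v) = bra g u - bra g v.
Proof. by rewrite braE_D -scaleN1r braE_Z scaleN1r. Qed.

Lemma braE_sum g (I : Type) (s : seq I) (f : I -> {mpoly E[4]}) :
  bra g (\sum_(i <- s) f i) = \sum_(i <- s) bra g (f i).
Proof.
elim: s => [|i s IH]; last by rewrite !big_cons braE_D IH.
by rewrite !big_nil -{1}(scale0r 0) braE_Z scale0r.
Qed.

Lemma braE_act g h v : inK h -> bra g (actE h v) = bra (g *m h) v.
Proof.
by apply: bra_act => h1 h2 w _ _; apply: actE_M.
Qed.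

Lemma braE_ind g v : g \in unitmx -> inVO v -> indVO (bra g v).
Proof.
apply: bra_ind; [by move=> h _; apply: actE_linear|by move=> *; apply: actE_M|
  exact: inVO_act|exact: inVO0].
Qed.

Lemma indVO0 : indVO 0.
Proof. by apply: ind0; [move=> h _; apply: actE_linear | apply: inVO0]. Qed.

Lemma indVOP c f f' : vge vE 0 c -> indVO f -> indVO f' -> indVO (c *: f + f').
Proof.
move=> ic [fW f0 fact [s [us sP]]] [fW' f0' fact' [s' [us' sP']]]; split.
- by move=> g; apply: inVOP.
- by move=> g ng; rewrite -[LHS]/(c *: f g + f' g) f0 // f0' // scaler0 addr0.
- move=> h g hKZ ug; rewrite -[LHS]/(c *: f (h *m g) + f' (h *m g)).
  by rewrite fact // fact' // -actE_linear.
- exists (s ++ s'); split=> [|g]; first by rewrite all_cat us us'.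
  rewrite -[X in X != _]/(c *: f g + f' g).
  case: (eqVneq (f g) 0) => [->|/sP[h hs ?] _]; last first.
    by exists h => //; rewrite mem_cat hs.
  rewrite scaler0 add0r => /sP'[h hs ?].
  by exists h => //; rewrite mem_cat hs orbT.
Qed.

Lemma indVOD f f' : indVO f -> indVO f' -> indVO (f + f').
Proof. by move=> If If'; rewrite -[f]scale1r; apply: indVOP => //; apply: (vge_1 (vEP S)). Qed.

Lemma indVOZ c f : vge vE 0 c -> indVO f -> indVO (c *: f).
Proof. by move=> ic If; rewrite -[_ *: f]addr0; apply: indVOP => //; apply: indVO0. Qed.

Lemma indVO_sum (I : Type) (s : seq I) (f : I -> 'M[F]_2 -> {mpoly E[4]}) :
  (forall i, indVO (f i)) -> indVO (\sum_(i <- s) f i).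
Proof. by move=> If; apply: big_ind => //; [apply: indVO0 | apply: indVOD]. Qed.

Lemma clsD f f' : indVO f -> indVO f' -> cls (f + f') = cls f + cls f'.
Proof.
move=> If If'; have [y1 e1 ->] := cls_lift If; have [y2 e2 ->] := cls_lift If'.
have [y3 e3 ->] := cls_lift (indVOD If If').
by apply: tensor1D; rewrite e1 e2 e3 linearD.
Qed.

Lemma clsZ c f : vge vE 0 c -> indVO f -> cls (c *: f) = redE c *: cls f.
Proof.
move=> ic If; have [y1 e1 ->] := cls_lift If.
have [y2 e2 ->] := cls_lift (indVOZ ic If).
by apply: tensor1Z => //; rewrite e1 e2 linearZ.
Qed.

Lemma cls_0 : cls 0 = 0.
Proof.
have e := clsZ (vge_0 vE 0) indVO0.
by rewrite scaler0 (red_0 (redEP S)) scale0r in e.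
Qed.

Lemma cls_toPi0 f : indVO f -> toPi f = 0 -> cls f = 0.
Proof.
move=> If e; have [y ey ->] := cls_lift If; have [z ez ez'] := cls_lift indVO0.
rewrite -cls_0 ez'; congr tensor1; apply: val_inj.
by rewrite ey ez e linear0.
Qed.

Lemma cls_sum (I : Type) (s : seq I) (f : I -> 'M[F]_2 -> {mpoly E[4]}) :
  (forall i, indVO (f i)) -> cls (\sum_(i <- s) f i) = \sum_(i <- s) cls (f i).
Proof.
move=> If; elim: s => [|i s IH]; first by rewrite !big_nil cls_0.
by rewrite !big_cons clsD ?IH //; apply: indVO_sum.
Qed.

Lemma inVO_bmon b d : (b <= r0)%N -> (d <= r1)%N -> inVO (bmon E r0 r1 b d).
Proof. by move=> hb hd; split; [apply: bihom_bmon | apply: intp_mon]. Qed.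

Lemma inVO_ind (P : {mpoly E[4]} -> Prop) :
  P 0 ->
  (forall c b d v, vge vE 0 c -> (b <= r0)%N -> (d <= r1)%N -> inVO v -> P v ->
     P (c *: bmon E r0 r1 b d + v)) ->
  forall v, inVO v -> P v.
Proof.
move=> P0 PS v [hv iv]; rewrite [v]mpolyE.
suff [//] : inVO (\sum_(m <- msupp v) v@_m *: 'X_[m]) /\ P (\sum_(m <- msupp v) v@_m *: 'X_[m]).
have : {subset msupp v <= msupp v} by [].
elim: {1 3 4}(msupp v) => [|m s IH] sub; first by rewrite big_nil; split=> //; apply: inVO0.
rewrite big_cons; have [e0 e1] := hv m (sub _ (mem_head _ _)).
have /IH[Vs Ps] : {subset s <= msupp v} by move=> x xs; rewrite sub // inE xs orbT.
have -> : 'X_[m] = bmon E r0 r1 (m (@Ordinal 4 1 isT)) (m (@Ordinal 4 3 isT)).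
  by rewrite {1}[m]mm_eta mpolyX_mm /bmon -e0 -e1 !addnK.
have hb : (m (@Ordinal 4 1 isT) <= r0)%N by rewrite -e0 leq_addl.
have hd : (m (@Ordinal 4 3 isT) <= r1)%N by rewrite -e1 leq_addl.
by split; [apply: inVOP => //; apply: inVO_bmon | apply: PS].
Qed.

(** A polynomial over k need not lift to the integers of E, because k may be larger than the residue
    field; hence a definition on monomials, to be extended k-linearly. The value 0 in other
    bidegrees allows arbitrary cofactors of [theta0] and [theta1] later on. *)
Definition tau_mon (g : 'M[F]_2) (m : 'X_{1..4}) : TB :=
  if ((m (@Ordinal 4 0 isT) + m (@Ordinal 4 1 isT) == r0)
      && (m (@Ordinal 4 2 isT) + m (@Ordinal 4 3 isT) == r1))%N
  then cls (bra g 'X_[m]) else 0.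

Definition tau g : {linear {mpoly k[4]} -> TB} := mlin (tau_mon g).

Lemma tauP g c u v : tau g (c *: u + v) = c *: tau g u + tau g v.
Proof. exact: linearP. Qed.
Lemma tauZ g c u : tau g (c *: u) = c *: tau g u. Proof. exact: linearZ_LR. Qed.
Lemma tauD g u v : tau g (u + v) = tau g u + tau g v. Proof. exact: linearD. Qed.
Lemma tauB g u v : tau g (u - v) = tau g u - tau g v. Proof. exact: linearB. Qed.
Lemma tau0 g : tau g 0 = 0. Proof. exact: linear0. Qed.

Lemma tau_bmon g b d : (b <= r0)%N -> (d <= r1)%N ->
  tau g (bmon k r0 r1 b d) = cls (bra g (bmon E r0 r1 b d)).
Proof.
move=> hb hd; rewrite /tau /= /bmon -!mpolyX_mm mlinX /tau_mon !multinomE !(tnth_nth 0%N) /=.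
by rewrite !subnK // !eqxx.
Qed.

Lemma tau_mon0 g a b c d : ((a + b == r0) && (c + d == r1))%N = false ->
  tau g (mon k a b c d) = 0.
Proof.
move=> h; rewrite /tau /= -!mpolyX_mm mlinX /tau_mon !multinomE !(tnth_nth 0%N) /=.
by rewrite h.
Qed.

Lemma redp_bmon b d : redp (bmon E r0 r1 b d) = bmon k r0 r1 b d.
Proof. exact: redp_mon. Qed.

Lemma cls_bra g v : g \in unitmx -> inVO v -> cls (bra g v) = tau g (redp v).
Proof.
move=> ug; move: v; apply: inVO_ind => [|c b d v ic hb hd Vv IH].
  have -> : bra g 0 = 0 by rewrite -{1}(scale0r 0) braE_Z scale0r.
  have -> : redp 0 = 0 by apply/mpolyP => m; rewrite (mcoeff_redp (redEP S)) !mcoeff0 (red_0 (redEP S)).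
  by rewrite cls_0 tau0.
have Vb := inVO_bmon hb hd.
have iZ : intp 0 (c *: bmon E r0 r1 b d) by apply: (intpZl (vEP S)) => //; case: Vb.
rewrite braE_linear clsD; [|by apply: indVOZ => //; apply: braE_ind|exact: braE_ind].
rewrite (clsZ ic (braE_ind ug Vb)).
rewrite (redpD (redEP S)) //; last by case: Vv.
rewrite (redpZ (redEP S)) //; last by case: Vb.
by rewrite redp_bmon tauP (tau_bmon g hb hd) IH.
Qed.

Definition null f : Prop := indVO f /\ cls f = 0.

Lemma null_bra g N v : g \in unitmx -> bihom r0 r1 v -> 0 < N -> intp N v -> null (bra g v).
Proof.
move=> ug hv N0 iv; have Vv : inVO v by split=> //; apply: intpW (ltW N0) iv.
by split; [apply: braE_ind | rewrite cls_bra // (redp_small (redEP S) N0 iv) tau0].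
Qed.

Lemma nullD f f' : null f -> null f' -> null (f + f').
Proof. by move=> [If e] [If' e']; split; [apply: indVOD | rewrite clsD // e e' addr0]. Qed.

Lemma nullZ c f : vge vE 0 c -> null f -> null (c *: f).
Proof. by move=> ic [If e]; split; [apply: indVOZ | rewrite clsZ // e scaler0]. Qed.

Lemma null_sum (I : Type) (s : seq I) (f : I -> 'M[F]_2 -> {mpoly E[4]}) :
  (forall i, null (f i)) -> null (\sum_(i <- s) f i).
Proof.
move=> nf; apply: big_ind => //; [by split; [apply: indVO0 | apply: cls_0] | exact: nullD].
Qed.

Definition aE (l : Fq) : {mpoly E[4]} -> {mpoly E[4]} :=
  subst2 (mx2 1 (- (teich l)%:A) 0 p%:R) (mx2 1 ((- (teich l)%:A) ^+ p) 0 p%:R).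
Definition bE : {mpoly E[4]} -> {mpoly E[4]} :=
  subst2 (mx2 p%:R 0 0 1) (mx2 p%:R 0 0 1).

Definition hk := hecke_bra (@actE p S) aE bE.
Definition alp : 'M[F]_2 := mx2 1 0 0 p%:R.
Definition alpl (l : Fq) : 'M[F]_2 := mx2 p%:R (teich l) 0 1.

Lemma hkE g v : hk g v = \sum_(l : Fq) bra (g *m alpl l) (aE l v) + bra (g *m alp) (bE v).
Proof. by []. Qed.

Lemma unit_alp : alp \in unitmx.
Proof. by rewrite unit_mx2 mul1r mulr0 subr0 pF_neq0. Qed.
Lemma unit_alpl l : alpl l \in unitmx.
Proof. by rewrite unit_mx2 mulr1 mulr0 subr0 pF_neq0. Qed.

Lemma aE_Z l c v : aE l (c *: v) = c *: aE l v. Proof. exact: linearZ_LR. Qed.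
Lemma bE_Z c v : bE (c *: v) = c *: bE v. Proof. exact: linearZ_LR. Qed.
Lemma aE_B l u v : aE l (u - v) = aE l u - aE l v. Proof. exact: linearB. Qed.
Lemma bE_B u v : bE (u - v) = bE u - bE v. Proof. exact: linearB. Qed.
Lemma bihom_aE l v : bihom r0 r1 v -> bihom r0 r1 (aE l v).
Proof. exact: bihom_subst2. Qed.
Lemma bihom_bE v : bihom r0 r1 v -> bihom r0 r1 (bE v).
Proof. exact: bihom_subst2. Qed.

(** The vectors may have denominators: relations are taken in [ind V(E)], and integrality is
    required only of the combinations whose class is formed. *)
Lemma hk_relation (s : seq ('M[F]_2 * {mpoly E[4]})) :
  (forall x, x \in s -> x.1 \in unitmx /\ bihom r0 r1 x.2) ->
  toPi (\sum_(x <- s) hk x.1 x.2 - ap *: \sum_(x <- s) bra x.1 x.2) = 0.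
Proof.
move=> sP; rewrite -(linear0 (toquo _)); apply/toquo_eq; rewrite subr0.
rewrite -[X in span _ X]addr0 -[X in X + 0]scale1r; apply: span_step; last exact: span_zero.
by exists (\sum_(x <- s) bra x.1 x.2), (\sum_(x <- s) hk x.1 x.2); split=> //; exists s.
Qed.

Lemma null_hk g N v : g \in unitmx -> bihom r0 r1 v -> 0 < N ->
  (forall l, intp N (aE l v)) -> intp N (bE v) -> null (hk g v).
Proof.
move=> ug hv N0 ia ib; rewrite hkE; apply: nullD; last first.
  by apply: null_bra N0 ib; rewrite ?unitmx_mul ?ug ?unit_alp //; apply: bihom_bE.
apply: null_sum => l; apply: null_bra N0 (ia l); last exact: bihom_aE.
by rewrite unitmx_mul ug unit_alpl.
Qed.

Lemma vge_mteich l : vge vF 0 (- teich l).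
Proof. by apply: (vgeN (vFP S)); apply: vge_teich. Qed.

(** Modulo p the substitution sends each [Y_i] to a multiple of [X_i], so every monomial collapses
    to the highest one, with a scalar depending only on b + p d. *)
Lemma aE_bmon l b d : (b <= r0)%N -> (d <= r1)%N ->
  intp 1 (aE l (bmon E r0 r1 b d)
          - ((- teich l) ^+ b * (- teich l) ^+ p ^+ d)%:A *: bmon E r0 r1 0 0).
Proof.
move=> hb hd; set t : F := - teich l.
have it : vge vE 0 (t%:A : E) by apply/vge_alg0/vge_mteich.
have itp : vge vE 0 (t%:A ^+ p : E) by apply: (vgeX (vEP S)).
have iX0 : intp 0 (t%:A *: X0 E) by rewrite X0E; apply: (intpZl (vEP S)) => //; apply: intp_mon.
have iX1 : intp 0 (t%:A ^+ p *: X1 E) by rewrite X1E; apply: (intpZl (vEP S)) => //; apply: intp_mon.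
have iY0 : intp 0 (Y0 E) by rewrite Y0E; apply: intp_mon.
have iY1 : intp 0 (Y1 E) by rewrite Y1E; apply: intp_mon.
have [w0 iw0 e0] := exp_cong1 (vEP S) b (vge_p0 S) iX0 iY0.
have [w1 iw1 e1] := exp_cong1 (vEP S) d (vge_p0 S) iX1 iY1.
have iX0' e : intp 0 (X0 E ^+ e) by rewrite X0E; apply: (intp_exp (vEP S)); apply: intp_mon.
have iX1' e : intp 0 (X1 E ^+ e) by rewrite X1E; apply: (intp_exp (vEP S)); apply: intp_mon.
rewrite /aE /bmon subst2_mon !mx2E !scale0r !addr0 !scale1r -!algN -/t e0 e1.
set u0 := (t%:A *: X0 E) ^+ b; set u1 := (_ *: X1 E) ^+ d.
have iu0 : intp 0 u0 by apply: (intp_exp (vEP S)).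
have iu1 : intp 0 u1 by apply: (intp_exp (vEP S)).
have -> : (t ^+ b * t ^+ p ^+ d)%:A *: mon E (r0 - 0) 0 (r1 - 0) 0 =
   X0 E ^+ (r0 - b) * u0 * X1 E ^+ (r1 - d) * u1.
  rewrite /u0 /u1 [(_ *: X0 E) ^+ _]exprZn [(_ *: X1 E) ^+ _]exprZn mul_scale4.
  by rewrite algM !algX mon.unlock !expr0 !mulr1 !subn0 -mulrA -!exprD !subnK.
pose W := X0 E ^+ (r0 - b) * w0 * X1 E ^+ (r1 - d) * (u1 + p%:R *: w1)
  + X0 E ^+ (r0 - b) * u0 * X1 E ^+ (r1 - d) * w1.
have iW : intp 0 W.
  have iM u w : intp 0 u -> intp 0 w -> intp 0 (u * w) by apply: (intpMl (vEP S)).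
  apply: (intpD (vEP S)); apply: (iM) => //; first by apply: (iM) => //; apply: (iM).
    by apply: (intpD (vEP S)) => //; apply: (intpZl (vEP S)) => //; apply: vge_p0.
  by apply: (iM) => //; apply: (iM).
have -> : X0 E ^+ (r0 - b) * (u0 + p%:R *: w0) * X1 E ^+ (r1 - d) * (u1 + p%:R *: w1)
   - X0 E ^+ (r0 - b) * u0 * X1 E ^+ (r1 - d) * u1 = p%:R *: W.
  exact: mul_expand1.
by apply: (intpZr (vEP S)) iW; apply: vge_p.
Qed.

Lemma red_mteich l b d :
  redF ((- teich l) ^+ b * (- teich l) ^+ p ^+ d) = (- l) ^+ (b + p * d).
Proof.
have it := vge_mteich l.
rewrite (red_M (redFP S)); [|exact: (vgeX (vFP S))|by do 2 apply: (vgeX (vFP S))].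
rewrite !(red_X (vFP S) (redFP S)) //; last exact: (vgeX (vFP S)).
by rewrite (red_N (vFP S) (redFP S)) ?vge_teich // red_teich exprD exprM.
Qed.

Lemma vge_mteich_exp l b d : vge vF 0 ((- teich l) ^+ b * (- teich l) ^+ p ^+ d).
Proof.
by apply: (vgeMl (vFP S)); do ?apply: (vgeX (vFP S)); apply: vge_mteich.
Qed.

(** The two scalars reduce to powers of -l with congruent exponents, both positive so that they also
    agree at l = 0; their difference is divisible by p because F is unramified. *)
Lemma aE_diff l b d b' d' : (b <= r0)%N -> (d <= r1)%N -> (b' <= r0)%N -> (d' <= r1)%N ->
  (0 < b + p * d)%N -> (0 < b' + p * d')%N -> (b + p * d = b' + p * d' %[mod q - 1])%N ->
  intp 1 (aE l (bmon E r0 r1 b d - bmon E r0 r1 b' d')).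
Proof.
move=> hb hd hb' hd' n0 n0' e; rewrite aE_B.
pose c := (- teich l) ^+ b * (- teich l) ^+ p ^+ d.
pose c' := (- teich l) ^+ b' * (- teich l) ^+ p ^+ d'.
have -> : aE l (bmon E r0 r1 b d) - aE l (bmon E r0 r1 b' d') =
  (aE l (bmon E r0 r1 b d) - c%:A *: bmon E r0 r1 0 0)
  - (aE l (bmon E r0 r1 b' d') - c'%:A *: bmon E r0 r1 0 0)
  + (c - c')%:A *: bmon E r0 r1 0 0.
  rewrite algD algN scalerBl.
  exact: sub_cong.
apply: (intpD (vEP S)); first by apply: (intpB (vEP S)); apply: aE_bmon.
apply: (intpZr (vEP S)); last exact: intp_mon.
apply: vge_alg1; first by apply: (vgeB (vFP S)); apply: vge_mteich_exp.
rewrite (red_B (vFP S) (redFP S)) ?vge_mteich_exp // !red_mteich.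
by rewrite (@expf_mod _ (- l) _ (b' + p * d')) ?subrr // cardFq.
Qed.

Lemma bE_bmon b d : bE (bmon E r0 r1 b d) = p%:R ^+ (r0 - b + (r1 - d)) *: bmon E r0 r1 b d.
Proof.
rewrite /bE /bmon subst2_mon !mx2E !scale0r !addr0 !add0r !scale1r !exprZn.
rewrite -!scalerAl -!scalerAr -!scalerAl scalerA -exprD; congr (_ *: _).
by rewrite mon.unlock.
Qed.

Lemma vge_pX e : (0 < e)%N -> vge vE 1 (p%:R ^+ e : E).
Proof.
case: e => // e _; rewrite exprS -[1]addr0; apply: (vgeM (vEP S)); first exact: vge_p.
by apply: (vgeX (vEP S)); apply: vge_p0.
Qed.

Lemma bE_small b d : (b <= r0)%N -> (d <= r1)%N -> (b, d) != (r0, r1) ->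
  intp 1 (bE (bmon E r0 r1 b d)).
Proof.
move=> hb hd bd; rewrite bE_bmon; apply: (intpZr (vEP S)); last exact: intp_mon.
by apply: vge_pX; move: bd; rewrite xpair_eqE; lia.
Qed.

Hypothesis r0_ge : (q <= r0)%N.
Hypothesis r1_ge : (q <= r1)%N.

Let p0 : (0 < p)%N := prime_gt0 p_prime.
Let p1 : (1 < p)%N := prime_gt1 p_prime.
Let p2 : (2 * p <= q)%N. Proof. by rewrite -mulnn leq_mul2r p1 orbT. Qed.

(** The values of b + p d for the two terms differ by q - 1, so their images under [aE] cancel
    modulo p. Since [bE] fixes the first term and makes the second divisible by p, [T [g, wE]] is
    congruent to the single bracket of the first term at [g alp]. *)
Definition wE : {mpoly E[4]} := bmon E r0 r1 r0 r1 - bmon E r0 r1 (r0 - (q - 1)) r1.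

Lemma inVO_wE : inVO wE.
Proof.
rewrite /wE -scaleN1r addrC; apply: inVOP; first by apply: (vgeN (vEP S)); apply: (vge_1 (vEP S)).
  by apply: inVO_bmon => //; apply: leq_subr.
exact: inVO_bmon.
Qed.

Lemma aE_wE l : intp 1 (aE l wE).
Proof.
apply: aE_diff => //; rewrite ?leq_subr //; try by have := leq_mul p0 (leqnn r1); lia.
have e : (r0 = r0 - (q - 1) + (q - 1))%N by lia.
by rewrite {1}e addnAC modnDr.
Qed.

Lemma bE_wE : intp 1 (bE wE - bmon E r0 r1 r0 r1).
Proof.
rewrite /wE bE_B bE_bmon !subnn expr0 scale1r addrC addKr; apply: (intpN (vEP S)).
by apply: bE_small; rewrite ?leq_subr // xpair_eqE; lia.
Qed.

Hypothesis ap_neq0 : ap != 0.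
Hypothesis ap_bnd : 1 / 2 < vE ap < 1.

Let ap_gt0 : 0 < vE ap.
Proof. by case/andP: ap_bnd => h _; apply: lt_trans h. Qed.
Let ap_lt1 : vE ap < 1. Proof. by case/andP: ap_bnd. Qed.

Lemma vge_ap : vge vE (vE ap) ap. Proof. by rewrite /vge lexx orbT. Qed.

(** If T[g, v] is divisible by p then [g, v] = T[g, v] / ap has positive valuation. *)
Lemma cls_eq0_of_T g v : g \in unitmx -> inVO v ->
  (forall l, intp 1 (aE l v)) -> intp 1 (bE v) -> cls (bra g v) = 0.
Proof.
move=> ug Vv ia ib; case: (Vv) => hv iv.
have := @hk_relation [:: (g, ap^-1 *: v)]; rewrite !big_seq1 /= => rel.
have N0 : 0 < - vE ap + 1 by rewrite addrC subr_gt0.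
have iap : vge vE (- vE ap) ap^-1 by rewrite /vge (valV (vEP S)) // lexx orbT.
have [If e] : null (hk g (ap^-1 *: v)).
  apply: (null_hk ug (bihomZ hv) N0) => [l|].
    by rewrite aE_Z; apply: (intpZ (vEP S) iap (ia l)).
  by rewrite bE_Z; apply: (intpZ (vEP S) iap ib).
move: rel; rewrite braE_Z scalerA mulfV // scale1r => rel.
have Ib : indVO (bra g v) by apply: braE_ind.
have im1 : vge vE 0 (-1 : E) by apply: (vgeN (vEP S)); apply: (vge_1 (vEP S)).
have : cls (hk g (ap^-1 *: v) - bra g v) = 0.
  apply: cls_toPi0; last by apply: rel => x; rewrite inE => /eqP ->; split=> //; apply: bihomZ.
  by rewrite -scaleN1r; apply: indVOD => //; apply: indVOZ.
rewrite -scaleN1r clsD //; last exact: indVOZ.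
rewrite e add0r clsZ // (red_N (vEP S) (redEP S)) ?(vge_1 (vEP S)) // (red_1 (redEP S)).
by rewrite scaleN1r => /eqP; rewrite oppr_eq0 => /eqP.
Qed.

(** [T] of the difference is divisible by p. The pure power of [Y_0] and [Y_1] is excluded because
    [bE] fixes it. *)
Lemma tau_bmon_eq g b d b' d' : g \in unitmx ->
  (b <= r0)%N -> (d <= r1)%N -> (b' <= r0)%N -> (d' <= r1)%N ->
  (b, d) != (r0, r1) -> (b', d') != (r0, r1) ->
  (0 < b + p * d)%N -> (0 < b' + p * d')%N -> (b + p * d = b' + p * d' %[mod q - 1])%N ->
  tau g (bmon k r0 r1 b d) = tau g (bmon k r0 r1 b' d').
Proof.
move=> ug hb hd hb' hd' bd bd' n0 n0' e.
apply/eqP; rewrite -subr_eq0 -tauB.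
have im1 : vge vE 0 (-1 : E) by apply: (vgeN (vEP S)); apply: (vge_1 (vEP S)).
have Vv : inVO (bmon E r0 r1 b d - bmon E r0 r1 b' d').
  by rewrite -scaleN1r addrC; apply: inVOP => //; apply: inVO_bmon.
have -> : bmon k r0 r1 b d - bmon k r0 r1 b' d' = redp (bmon E r0 r1 b d - bmon E r0 r1 b' d').
  rewrite -[in RHS]scaleN1r (redpD (redEP S)) ?(redpZ (redEP S)) //; do ?exact: intp_mon.
    rewrite (red_N (vEP S) (redEP S)) ?(vge_1 (vEP S)) // (red_1 (redEP S)) scaleN1r.
    by rewrite !redp_bmon.
  by apply: (intpZl (vEP S)) => //; apply: intp_mon.
rewrite -cls_bra //; apply/eqP; apply: cls_eq0_of_T => // [l|].
  exact: aE_diff.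
by rewrite bE_B; apply: (intpB (vEP S)); apply: bE_small.
Qed.

(** The two monomials of [theta0] times a monomial share their bidegree, and their values of b + p d
    differ by q - 1. *)
Lemma tau_theta0 g P : g \in unitmx -> tau g (theta0 S * P) = 0.
Proof.
move=> ug; rewrite theta0E; elim/mpolyind: P => [|c m P _ _ IH]; first by rewrite mulr0 tau0.
rewrite mulrDr tauD IH addr0 -scalerAr tauZ [m]mm_eta.
move: (m _) (m _) (m _) (m _) => d c' b a; rewrite mpolyX_mm mulrBl !monM.
rewrite tauB !add0n !add1n; apply/eqP; rewrite scaler_eq0 subr_eq0; apply/orP; right.
case: (boolP ((a.+1 + b == r0) && (c' + (p + d) == r1))%N) => [/andP[/eqP e0 /eqP e1]|h].
  have -> : mon k a.+1 b c' (p + d) = bmon k r0 r1 b (p + d) by rewrite /bmon -e0 -e1 !addnK.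
  have -> : mon k a b.+1 (p + c') d = bmon k r0 r1 b.+1 d.
    by rewrite /bmon -e0 -e1 addSnnS addnK; congr (mon _ _ _ _); lia.
  apply/eqP; apply: tau_bmon_eq => //; rewrite ?xpair_eqE; try lia.
  have -> : (b + p * (p + d) = b.+1 + p * d + (q - 1))%N.
    by rewrite mulnDr -mulnn; lia.
  by rewrite modnDr.
rewrite !tau_mon0 ?eqxx //; first by apply: negbTE; rewrite addnS -addSn -addnA addnCA.
exact: negbTE.
Qed.

Lemma tau_theta1 g P : g \in unitmx -> tau g (theta1 S * P) = 0.
Proof.
move=> ug; rewrite theta1E; elim/mpolyind: P => [|c m P _ _ IH]; first by rewrite mulr0 tau0.
rewrite mulrDr tauD IH addr0 -scalerAr tauZ [m]mm_eta.
move: (m _) (m _) (m _) (m _) => d c' b a; rewrite mpolyX_mm mulrBl !monM.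
rewrite tauB !add0n !add1n; apply/eqP; rewrite scaler_eq0 subr_eq0; apply/orP; right.
case: (boolP ((a + (p + b) == r0) && (c'.+1 + d == r1))%N) => [/andP[/eqP e0 /eqP e1]|h].
  have -> : mon k a (p + b) c'.+1 d = bmon k r0 r1 (p + b) d by rewrite /bmon -e0 -e1 !addnK.
  have -> : mon k (p + a) b c' d.+1 = bmon k r0 r1 b d.+1.
    by rewrite /bmon -e0 -e1 addSnnS addnK; congr (mon _ _ _ _); lia.
  apply/eqP; apply: tau_bmon_eq => //; rewrite ?xpair_eqE; try lia.
  by have -> : (p + b + p * d = b + p * d.+1)%N by rewrite mulnSr; lia.
rewrite !tau_mon0 ?eqxx //; last exact: negbTE.
by apply: negbTE; rewrite addnS -addSn -addnA addnCA.
Qed.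

(** For g' = g alp^-1 the bracket is congruent modulo p to [T [g', wE]], whose class equals that of
    [ap [g', wE]], of positive valuation. *)
Lemma tau_Y g : g \in unitmx -> tau g (bmon k r0 r1 r0 r1) = 0.
Proof.
move=> ug; pose g' := g *m invmx alp.
have ug' : g' \in unitmx by rewrite unitmx_mul ug unitmx_inv unit_alp.
have g'a : g' *m alp = g by rewrite mulmxKV // unit_alp.
have := @hk_relation [:: (g', wE)]; rewrite !big_seq1 /= => rel.
have [hw iw] := inVO_wE.
rewrite tau_bmon //.
have e : bra g (bmon E r0 r1 r0 r1) = (hk g' wE - ap *: bra g' wE) +
   - (\sum_(l : Fq) bra (g' *m alpl l) (aE l wE) + bra g (bE wE - bmon E r0 r1 r0 r1)
     - ap *: bra g' wE).
  rewrite hkE g'a (braE_B g (bE wE)).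
  exact: (sub_telescope (bra g (bE wE))).
have im1 : vge vE 0 (-1 : E) by apply: (vgeN (vEP S)); apply: (vge_1 (vEP S)).
have [In en] : null (- (\sum_(l : Fq) bra (g' *m alpl l) (aE l wE)
      + bra g (bE wE - bmon E r0 r1 r0 r1) - ap *: bra g' wE)).
  rewrite -scaleN1r; apply: nullZ => //; apply: nullD; last first.
    rewrite -scaleN1r; apply: nullZ => //; rewrite -braE_Z.
    by apply: (null_bra ug' (bihomZ hw) ap_gt0); apply: (intpZr (vEP S)) => //; apply: vge_ap.
  apply: nullD; last first.
    by apply: (null_bra ug _ ltr01 bE_wE); apply: bihomB; [apply: bihom_bE | apply: bihom_bmon].
  apply: null_sum => l; have ugl : g' *m alpl l \in unitmx.
    by rewrite unitmx_mul ug' unit_alpl.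
  exact: (null_bra ugl (bihom_aE hw) ltr01 (aE_wE l)).
have Ib : indVO (bra g (bmon E r0 r1 r0 r1)) by apply: braE_ind => //; apply: inVO_bmon.
have Ir : indVO (hk g' wE - ap *: bra g' wE).
  have -> : hk g' wE - ap *: bra g' wE = bra g (bmon E r0 r1 r0 r1) + -1 *:
    (- (\sum_(l : Fq) bra (g' *m alpl l) (aE l wE) + bra g (bE wE - bmon E r0 r1 r0 r1)
     - ap *: bra g' wE)).
    by rewrite e scaleN1r addrK.
  by apply: indVOD => //; apply: indVOZ.
rewrite e clsD // en addr0; apply: cls_toPi0 => //; apply: rel => x.
by rewrite inE => /eqP ->.
Qed.

(** The Weyl element lies in K and exchanges the pure power of [X_0], [X_1] with that of [Y_0],
    [Y_1]. *)
Lemma tau_X g : g \in unitmx -> tau g (bmon k r0 r1 0 0) = 0.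
Proof.
move=> ug; have Kw : inK (mx2 0 1 1 0 : 'M[F]_2).
  have v1 := vge_1 (vFP S); have v0 := vge_0 vF 0.
  split=> [i j|]; last by rewrite det_mx2 mul0r mul1r sub0r oppr_eq0 oner_neq0 (valN1 (vFP S)).
  by rewrite mxE; case: eqP => _; case: eqP.
have -> : bmon k r0 r1 0 0 = redp (actE (mx2 0 1 1 0) (bmon E r0 r1 r0 r1)).
  rewrite redp_actE // /actGamma subst2_mon !mxE /= (red_0 (redFP S)) (red_1 (redFP S)).
  rewrite !rmorph0 !rmorph1 expr1n expr0n eqn0Ngt p0 /= !scale0r !scale1r !addr0 ?add0r.
  by rewrite /bmon mon.unlock !subnn !expr0 !subn0 !mulr1 mul1r.
rewrite -cls_bra //; last by apply: inVO_act => //; apply: inVO_bmon.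
rewrite braE_act // -tau_bmon //.
by apply: tau_Y; rewrite unitmx_mul ug inK_unit.
Qed.

Lemma tau_Xr g v : g \in unitmx -> inXr r0 r1 v -> tau g v = 0.
Proof.
move=> ug; elim=> [|c u w [h uh ->] _ IH]; first exact: tau0.
rewrite tauP IH addr0; have [h' Kh <-] := lift_Gamma uh.
have -> : X0 k ^+ r0 * X1 k ^+ r1 = bmon k r0 r1 0 0.
  by rewrite /bmon !subn0 mon.unlock !expr0 !mulr1.
rewrite -redp_actE // -cls_bra //; last by apply: inVO_act => //; apply: inVO_bmon.
rewrite braE_act // -tau_bmon // tau_X ?scaler0 //.
by rewrite unitmx_mul ug inK_unit.
Qed.

Lemma tau_prQ g u v : g \in unitmx -> prQ r0 r1 u = prQ r0 r1 v -> tau g u = tau g v.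
Proof.
move=> ug /toquo_eq H; apply/eqP; rewrite -subr_eq0 -tauB; apply/eqP.
elim: H => [|c w w' h _ IH]; first exact: tau0.
rewrite tauP IH addr0; case: h => [[_ [P0 [P1 ->]]]|h]; last by rewrite tau_Xr ?scaler0.
by rewrite tauD tau_theta0 // tau_theta1 // addr0 scaler0.
Qed.

End ThetaBar.

(** * Products to first order in p and twisted power sums *)

Lemma mul_expand2 (R : comNzRingType) n (a b w a' b' w' : {mpoly R[n]}) (c : R) :
  (a + c *: b + c ^+ 2 *: w) * (a' + c *: b' + c ^+ 2 *: w') =
  a * a' + c *: (b * a' + a * b')
  + c ^+ 2 *: (b * b' + a * w' + w * a' + c *: (b * w' + w * b') + c ^+ 2 *: (w * w')).
Proof. by rewrite -!mul_mpolyC !rmorphXn /=; ring. Qed.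

Lemma prod_cong2 (K : fieldType) (A : realDomainType) (v : K -> A) n (vP : is_valuation v)
    (c : K) (U0 Z0 U1 Z1 : {mpoly K[n]}) e0 e1 :
  vge v 0 c -> intp v 0 U0 -> intp v 0 Z0 -> intp v 0 U1 -> intp v 0 Z1 ->
  exists2 w, intp v 0 w & (U0 + c *: Z0) ^+ e0 * (U1 + c *: Z1) ^+ e1 =
    U0 ^+ e0 * U1 ^+ e1
    + c *: (e0%:R *: (U0 ^+ e0.-1 * Z0 * U1 ^+ e1) + e1%:R *: (U0 ^+ e0 * (U1 ^+ e1.-1 * Z1)))
    + c ^+ 2 *: w.
Proof.
move=> ic iU0 iZ0 iU1 iZ1.
have [w iw ->] := exp_cong2 vP e0 ic iU0 iZ0.
have [w' iw' ->] := exp_cong2 vP e1 ic iU1 iZ1.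
have iM u t : intp v 0 u -> intp v 0 t -> intp v 0 (u * t) by apply: (intpMl vP).
have iX u e : intp v 0 u -> intp v 0 (u ^+ e) by apply: (intp_exp vP).
have iD u t : intp v 0 u -> intp v 0 t -> intp v 0 (u + t) by apply: (intpD vP).
have iZ x u : vge v 0 x -> intp v 0 u -> intp v 0 (x *: u) by apply: (intpZl vP).
have iN e := vge_nat vP e.
have ib : intp v 0 (e0%:R *: (U0 ^+ e0.-1 * Z0)).
  by apply: (iZ) => //; apply: (iM) => //; apply: (iX).
have ib' : intp v 0 (e1%:R *: (U1 ^+ e1.-1 * Z1)).
  by apply: (iZ) => //; apply: (iM) => //; apply: (iX).
have ia : intp v 0 (U0 ^+ e0) by apply: (iX).
have ia' : intp v 0 (U1 ^+ e1) by apply: (iX).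
move: ib ib'; set b := e0%:R *: _; set b' := e1%:R *: _ => ib ib'.
exists (b * b' + U0 ^+ e0 * w' + w * U1 ^+ e1 + c *: (b * w' + w * b') + c ^+ 2 *: (w * w')).
  apply: (iD); last by apply: (iZ); [apply: (vgeX vP) | apply: (iM)].
  apply: (iD); last by apply: (iZ) => //; apply: (iD); apply: (iM).
  by apply: (iD); [apply: (iD); apply: (iM) | apply: (iM)].
rewrite mul_expand2; congr (_ + c *: (_ + _) + _); first by rewrite /b -scalerAl.
by rewrite /b' -scalerAr.
Qed.

Section ScaledProducts.
Variables (R : comNzRingType) (n : nat).
Implicit Types (x y c : R) (U V Z : {mpoly R[n]}).

Lemma scale_mul2 x y U V : (x *: U) * (y *: V) = (x * y) *: (U * V).
Proof. by rewrite -!mul_mpolyC mpolyCM; ring. Qed.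
Lemma scale_mul3 c x y U V Z :
  c *: ((x *: U) * Z * (y *: V)) = (c * (x * y)) *: (U * Z * V).
Proof. by rewrite -!mul_mpolyC !mpolyCM; ring. Qed.
Lemma scale_mul3r c x y U V Z :
  c *: ((x *: U) * ((y *: V) * Z)) = (c * (x * y)) *: (U * V * Z).
Proof. by rewrite -!mul_mpolyC !mpolyCM; ring. Qed.
Lemma scale_mid c x U V Z : c *: (U * (x *: Z) * V) = (c * x) *: (Z * U * V).
Proof. by rewrite -!mul_mpolyC !mpolyCM; ring. Qed.
Lemma scale_last c x U V Z : c *: (U * (V * (x *: Z))) = (c * x) *: (U * Z * V).
Proof. by rewrite -!mul_mpolyC !mpolyCM; ring. Qed.

End ScaledProducts.

(* The congruence hypotheses only slow [lia] down. *)
Ltac flia := repeat match goal with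
  | H : (_ %% _ = _ %% _)%N |- _ => clear H
  | H : is_true (~~ (_ %| _)%N) |- _ => clear H
  | H : _ -> is_true (_ %| _)%N |- _ => clear H
  end; lia.

Lemma sub_regroup (V : zmodType) (s x y z : V) : s + x - y - z = s + (x - z) - y.
Proof. by rewrite addrAC -[s + x - z]addrA. Qed.

Lemma sum_regroup (R : nzRingType) (V : lmodType R) (I : finType) (F1 F2 F3 : I -> V)
    (c : I -> R) a (H B : V) : a *: B = \sum_i c i *: F3 i ->
  H + \sum_i F1 i - a *: (B + \sum_i F2 i) =
  H + \sum_i (F1 i - a *: F2 i - c i *: F3 i).
Proof.
move=> e; rewrite !sumrB -e -scaler_sumr scalerDr opprD -!addrA.
by congr (_ + (_ + _)); rewrite addrC.
Qed.

Lemma mul_binomial_terms (K : comNzRingType) (A B : K) n a i b j p c1 c2 :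
  A ^+ n * ((A ^+ a * B ^+ i *+ c1) * (A ^+ p ^+ b * B ^+ p ^+ j *+ c2)) =
  c1%:R * c2%:R * B ^+ (i + p * j) * A ^+ (n + a + p * b).
Proof.
rewrite !exprD !exprM -[A ^+ a * _ *+ c1]mulr_natl -[A ^+ p ^+ b * _ *+ c2]mulr_natl.
move: (A ^+ n) (A ^+ a) (A ^+ p ^+ b) (B ^+ i) (B ^+ p ^+ j) (c1%:R) (c2%:R).
by move=> x y z t u v w; ring.
Qed.

Section TwistedPowerSums.
Variables (p : nat) (S : setting p).
Hypothesis p_prime : prime p.
Local Notation Fq := (Fq S).
Local Notation iota := (@iota p S).
Local Notation q := (p ^ 2)%N.

Let p0 : (0 < p)%N := prime_gt0 p_prime.
Let p1 : (1 < p)%N := prime_gt1 p_prime.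

(** All exponents of m in the binomial expansion lie strictly between 0 and q - 1. *)
Lemma iota_sum_small n L l : (0 < n)%N -> (n + L < q - 1)%N ->
  \sum_(m : Fq) iota m ^+ n * iota (m - l) ^+ L = 0.
Proof.
move=> n0 nL.
have -> : \sum_(m : Fq) iota m ^+ n * iota (m - l) ^+ L =
   \sum_(i < L.+1) 'C(L, i)%:R * iota (- l) ^+ i * \sum_(m : Fq) iota m ^+ (n + (L - i)).
  under [RHS]eq_bigr do rewrite mulr_sumr.
  rewrite exchange_big; apply: eq_bigr => m _ /=.
  rewrite rmorphD exprDn mulr_sumr; apply: eq_bigr => i _.
  by rewrite -mulr_natl exprD; ring.
apply: big1 => i _; have iL : (i <= L)%N by case: i.
rewrite (iota_power_sum S p_prime); last by flia.
by rewrite (_ : (_ == _) = false) ?mulr0 //; apply/eqP; flia.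
Qed.

Lemma digit_eq i j i' j' : (i < p)%N -> (i' < p)%N ->
  (i + p * j == i' + p * j')%N = (i == i') && (j == j').
Proof.
move=> ip ip'; apply/eqP/andP => [e|[/eqP -> /eqP ->]//].
have := congr1 (fun n => n %% p)%N e; have := congr1 (fun n => n %/ p)%N e.
rewrite /= ![(_ + p * _)%N]addnC ![(p * _)%N]mulnC !divnMDl // !divn_small // !addn0 => ->.
by rewrite !modnMDl !modn_small // => ->; rewrite !eqxx.
Qed.

Variables r0 r1 a0 : nat.
Hypothesis r0_gt0 : (0 < r0)%N.
Hypothesis r1_gt0 : (0 < r1)%N.
Hypothesis r_mod : (r0 + p * r1 = a0 %[mod q - 1])%N.
Hypothesis a0_bnd : (1 <= a0 <= p - 1)%N.
Local Notation s0 := (a0 - 1)%N.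
Local Notation s1 := (p - 2)%N.

(** The exponent r - p is congruent to (a0 - 1) + p (p - 1), so the power expands over pairs of
    digits (i', j'). The total exponent of m is q - 1 + (i + p j) - (i' + p j'), and only (i', j') =
    (i, j) contributes. *)
Lemma iota_sum_big i j l : (i <= s0)%N -> (j <= s1)%N ->
  \sum_(m : Fq) iota m ^+ (i + p * j + p - a0) * iota (m - l) ^+ (r0 + p * r1.-1)
  = - ('C(s0, i)%:R * 'C(p.-1, j)%:R * iota (- l) ^+ (i + p * j)).
Proof.
move=> hi hj.
have r1E : (p * r1.-1 + p = p * r1)%N by rewrite -mulnSr prednK.
have ppE : (p * p.-1 + p = q)%N by rewrite -mulnSr prednK // -mulnn.
have zE m : iota (m - l) ^+ (r0 + p * r1.-1) =
    (iota m + iota (- l)) ^+ s0 * (iota m ^+ p + iota (- l) ^+ p) ^+ p.-1.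
  rewrite (@iota_mod _ _ _ _ (s0 + p * p.-1)); first last.
  - apply/eqP; rewrite -(eqn_modDr p) -addnA r1E r_mod.
    have -> : (s0 + p * p.-1 + p = a0 + (q - 1))%N by flia.
    by rewrite modnDr.
  - by rewrite addn_gt0 muln_gt0 p0 ltn_predRL p1 orbT.
  - by rewrite addn_gt0 r0_gt0.
  by rewrite exprD exprM (iota_expp p_prime) rmorphD.
under eq_bigr => m _ do rewrite zE.
have -> : \sum_(m : Fq) iota m ^+ (i + p * j + p - a0) *
     ((iota m + iota (- l)) ^+ s0 * (iota m ^+ p + iota (- l) ^+ p) ^+ p.-1) =
  \sum_(i' < s0.+1) \sum_(j' < p.-1.+1) 'C(s0, i')%:R * 'C(p.-1, j')%:R *
    iota (- l) ^+ (i' + p * j') *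
    \sum_(m : Fq) iota m ^+ (i + p * j + p - a0 + (s0 - i') + p * (p.-1 - j')).
  transitivity (\sum_(m : Fq) \sum_(i' < s0.+1) \sum_(j' < p.-1.+1)
    'C(s0, i')%:R * 'C(p.-1, j')%:R * iota (- l) ^+ (i' + p * j') *
    iota m ^+ (i + p * j + p - a0 + (s0 - i') + p * (p.-1 - j'))); last first.
    rewrite exchange_big; apply: eq_bigr => i' _ /=.
    rewrite exchange_big; apply: eq_bigr => j' _ /=.
    by rewrite mulr_sumr.
  apply: eq_bigr => m _; move: (iota m) (iota (- l)) => x y.
  rewrite [in LHS]exprDn [in LHS]exprDn mulr_suml mulr_sumr; apply: eq_bigr => i' _.
  rewrite [in LHS]mulr_sumr mulr_sumr; apply: eq_bigr => j' _.
  exact: mul_binomial_terms.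
have hi' : (i < s0.+1)%N by flia.
have hj' : (j < p.-1.+1)%N by flia.
have pe := digit_bound p1 a0_bnd hi hj.
have hS (i' : 'I_s0.+1) (j' : 'I_p.-1.+1) :
    \sum_(m : Fq) iota m ^+ (i + p * j + p - a0 + (s0 - i') + p * (p.-1 - j')) =
    if (i' == i :> nat) && (j' == j :> nat) then -1 else 0.
  have hi1 : (i' <= s0)%N by case: i'.
  have hj1 : (j' <= p.-1)%N by case: j'.
  have pj : (p * j' <= p * p.-1)%N by rewrite leq_mul2l hj1 orbT.
  have ex : (i + p * j + p - a0 + (s0 - i') + p * (p.-1 - j') + (i' + p * j')
     = q - 1 + (i + p * j))%N by rewrite mulnBr; flia.
  rewrite (iota_power_sum S p_prime); last by flia.
  congr (if _ then _ else _); rewrite -digit_eq; [|flia|flia].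
  by apply/eqP/eqP; flia.
rewrite (sum_ord_eq1 (i := Ordinal hi')) => [|i' ni]; last first.
  by apply: big1 => j' _; rewrite hS -val_eqE /= in ni *; rewrite (negPf ni) mulr0.
rewrite (sum_ord_eq1 (i := Ordinal hj')) => [|j' nj]; last first.
  by rewrite hS -val_eqE /= in nj *; rewrite (negPf nj) andbF mulr0.
by rewrite hS /= !eqxx /= mulrN1.
Qed.

End TwistedPowerSums.

(** * The Hecke operator on translates of the lowest monomial *)

Section Key.
Variables (p : nat) (S : setting p).
Hypothesis p_prime : prime p.
Hypothesis p_gt2 : (2 < p)%N.
Local Notation F := (F S).
Local Notation E := (E S).
Local Notation Fq := (Fq S).
Local Notation k := (k S).
Local Notation vF := (@vF p S).
Local Notation redF := (@redF p S).
Local Notation redE := (@redE p S).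
Local Notation iota := (@iota p S).
Local Notation teich := (@teich p S).
Local Notation sigma := (@sigma p S).
Local Notation intp := (@intp E rat vE 4).
Local Notation redp := (@map_mpoly 4 _ _ redE).
Local Notation q := (p ^ 2)%N.

Variables (r0 r1 a0 : nat) (ap : E).
Hypothesis r0_ge : (q <= r0)%N.
Hypothesis r1_ge : (q <= r1)%N.
Hypothesis r_mod : (r0 + p * r1 = a0 %[mod q - 1])%N.
Hypothesis a0_bnd : (1 <= a0 <= p - 1)%N.
Hypothesis p_r1 : ~~ (p %| r1)%N.
Hypothesis p_r0 : a0 = 1%N -> (p %| r0)%N.
Hypothesis ap_bnd : 1 / 2 < vE ap < 1.

Local Notation inVO := (@inVO p S r0 r1).
Local Notation indVO := (@indVO p S r0 r1).
Local Notation bra := (bra (@actE p S)).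
Local Notation tau := (@tau p S r0 r1 ap).
Local Notation cls := (@cls p S r0 r1 ap).
Local Notation alp := (@alp p S).
Local Notation r := (r0 + p * r1)%N.

Let p0 : (0 < p)%N := prime_gt0 p_prime.
Let p1 : (1 < p)%N := prime_gt1 p_prime.
Let p2 : (2 * p <= q)%N. Proof. by rewrite -mulnn leq_mul2r p1 orbT. Qed.
Let rq : (2 * q <= r)%N.
Proof. by have := leq_mul p0 (leqnn r1); rewrite mul1n; flia. Qed.
Let r0_gt0 : (0 < r0)%N. Proof. by apply: leq_trans r0_ge; rewrite expn_gt0 p0. Qed.
Let r1_gt0 : (0 < r1)%N. Proof. by apply: leq_trans r1_ge; rewrite expn_gt0 p0. Qed.

Lemma q_split : (q = p * (p - 2) + 2 * p)%N.
Proof. by rewrite mulnC -mulnDl subnK // -mulnn. Qed.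

(** After division by p the second-order terms are divisible by p and the first-order ones survive.
    The zeroth-order coefficient is integral, since F is unramified, but it may be nonzero modulo p;
    hence the hypothesis that [tau] kills its monomial. *)
Lemma cls_expand g (f : Fq -> {mpoly E[4]}) (c al be ga : Fq -> F) b d b0 d0 b1 d1 :
  g \in unitmx -> (forall m, bihom r0 r1 (f m)) ->
  (b <= r0)%N -> (d <= r1)%N -> (b0 <= r0)%N -> (d0 <= r1)%N -> (b1 <= r0)%N -> (d1 <= r1)%N ->
  (forall m, vge vF 0 (c m)) -> (forall m, vge vF 0 (al m)) ->
  (forall m, vge vF 0 (be m)) -> (forall m, vge vF 0 (ga m)) ->
  (forall m, exists2 w, intp 0 w & f m = (al m)%:A *: bmon E r0 r1 b d
     + p%:R *: ((be m)%:A *: bmon E r0 r1 b0 d0 + (ga m)%:A *: bmon E r0 r1 b1 d1)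
     + p%:R ^+ 2 *: w) ->
  redF (\sum_m c m * al m) = 0 -> tau g (bmon k r0 r1 b d) = 0 ->
  let v := p%:R^-1 *: \sum_m (c m)%:A *: f m in
  inVO v /\ cls (bra g v) = iota (redF (\sum_m c m * be m)) *: tau g (bmon k r0 r1 b0 d0)
                          + iota (redF (\sum_m c m * ga m)) *: tau g (bmon k r0 r1 b1 d1).
Proof.
move=> ug hf hb hd hb0 hd0 hb1 hd1 ic ial ibe iga fE ral tau_bd v.
have hv : bihom r0 r1 v by apply: bihomZ; apply: bihom_sum => m; apply: bihomZ.
pose w m := projT1 (cid2 (fE m)).
have iw m : intp 0 (w m) by rewrite /w; case: (cid2 _).
have fE' m : f m = (al m)%:A *: bmon E r0 r1 b d
     + p%:R *: ((be m)%:A *: bmon E r0 r1 b0 d0 + (ga m)%:A *: bmon E r0 r1 b1 d1)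
     + p%:R ^+ 2 *: w m by rewrite /w; case: (cid2 _).
pose SA := \sum_m c m * al m; pose SB := \sum_m c m * be m; pose SC := \sum_m c m * ga m.
have iS (h : Fq -> F) : (forall m, vge vF 0 (h m)) -> vge vF 0 (\sum_m c m * h m).
  by move=> ih; apply: (vge_sum (vFP S)) => m _; apply: (vgeMl (vFP S)).
pose x := p%:R^-1 * SA%:A : E.
have ix : vge vE 0 x.
  rewrite -[0](addNr 1); apply: (vgeM (vEP S)); last by apply: vge_alg1 => //; apply: iS.
  by rewrite /vge (valV (vEP S)) ?pE_neq0 // vE_p lexx orbT.
pose W := \sum_m (c m)%:A *: w m.
have iW : intp 1 (p%:R *: W).
  apply: (intpZr (vEP S)); first exact: vge_p.
  by apply: (intp_sum (vEP S)) => m; apply: (intpZl (vEP S)) => //; apply: vge_alg0.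
have vE' : v = x *: bmon E r0 r1 b d + (SB%:A *: bmon E r0 r1 b0 d0
     + (SC%:A *: bmon E r0 r1 b1 d1 + p%:R *: W)).
  rewrite /v; have -> : \sum_m (c m)%:A *: f m = SA%:A *: bmon E r0 r1 b d
     + p%:R *: (SB%:A *: bmon E r0 r1 b0 d0 + (SC%:A *: bmon E r0 r1 b1 d1 + p%:R *: W)).
    rewrite /SA /SB /SC /W !alg_sum !scaler_suml scaler_sumr -!big_split scaler_sumr -big_split.
    apply: eq_bigr => m _ /=; rewrite fE' !scalerDr !scalerA !algM -!addrA.
    by congr (_ + (_ + (_ + _))); congr (_ *: _); ring.
  by rewrite scalerDr !scalerA mulVf ?pE_neq0 // scale1r.
have iB := vge_alg0 (iS _ ibe); have iC := vge_alg0 (iS _ iga).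
have im b' d' : intp 0 (bmon E r0 r1 b' d') := intp_mon S _ _ _ _.
have i0W : intp 0 (p%:R *: W) := intpW ler01 iW.
have i1 : intp 0 (SC%:A *: bmon E r0 r1 b1 d1 + p%:R *: W).
  by apply: (intpD (vEP S)) => //; apply: (intpZl (vEP S)).
have i2 : intp 0 (SB%:A *: bmon E r0 r1 b0 d0 + (SC%:A *: bmon E r0 r1 b1 d1 + p%:R *: W)).
  by apply: (intpD (vEP S)) => //; apply: (intpZl (vEP S)).
have iv : intp 0 v.
  by rewrite vE'; apply: (intpD (vEP S)) => //; apply: (intpZl (vEP S)).
split=> //; rewrite cls_bra //.
have -> : redp v = redE x *: bmon k r0 r1 b d + (iota (redF SB) *: bmon k r0 r1 b0 d0
    + iota (redF SC) *: bmon k r0 r1 b1 d1).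
  rewrite vE' (redpD (redEP S)) //; last exact: (intpZl (vEP S)).
  rewrite (redpZ (redEP S)) // (redpD (redEP S)) //; last exact: (intpZl (vEP S)).
  rewrite (redpZ (redEP S)) // (redpD (redEP S)) //; last exact: (intpZl (vEP S)).
  rewrite (redpZ (redEP S)) // (redp_small (redEP S) ltr01 iW) addr0 !redp_bmon.
  by rewrite !redE_F //; apply: iS.
by rewrite tauP tauD !tauZ tau_bd scaler0 add0r.
Qed.

Definition kap (m : Fq) : 'M[F]_2 := mx2 1 (teich m) 0 1.

Lemma inK_kap m : inK (kap m).
Proof.
have v1 := vge_1 (vFP S); have v0 := vge_0 vF 0; have vt := vge_teich m.
split=> [i j|]; last by rewrite det_mx2 mulr1 mulr0 subr0 oner_neq0 (val1 (vFP S)).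
by rewrite mxE; case: eqP => _; case: eqP.
Qed.

(** Coefficients of [X_0] and [X_1] after acting by [kap m] and applying the Hecke substitution at
    l. The group acts through [sigma] while the Hecke formula uses p-th powers; the two are compared
    only modulo p. *)
Definition u0 (m l : Fq) : F := teich m - teich l.
Definition u1 (m l : Fq) : F := sigma (teich m) + (- teich l) ^+ p.

Lemma vge_u0 m l : vge vF 0 (u0 m l).
Proof. by apply: (vgeB (vFP S)); apply: vge_teich. Qed.
Lemma vge_u1 m l : vge vF 0 (u1 m l).
Proof.
apply: (vgeD (vFP S)); first by apply/vge_sigma/vge_teich.
by apply: (vgeX (vFP S)); apply: vge_mteich.
Qed.
Lemma red_u0 m l : redF (u0 m l) = m - l.
Proof. by rewrite (red_B (vFP S) (redFP S)) ?vge_teich // !red_teich. Qed.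
Lemma red_u1 m l : redF (u1 m l) = (m - l) ^+ p.
Proof.
rewrite (red_D (redFP S)); last first.
- by apply: (vgeX (vFP S)); apply: vge_mteich.
- exact/vge_sigma/vge_teich.
rewrite red_sigma ?vge_teich // red_teich (red_X (vFP S) (redFP S)) ?vge_mteich //.
rewrite (red_N (vFP S) (redFP S)) ?vge_teich // red_teich.
by rewrite exprDn_pchar // pnatE // (pcharFq S p_prime).
Qed.
Lemma red_u m l a b : redF (u0 m l ^+ a * u1 m l ^+ b) = (m - l) ^+ (a + p * b).
Proof.
rewrite (red_M (redFP S)) ?(vgeX (vFP S)) ?vge_u0 ?vge_u1 //.
rewrite !(red_X (vFP S) (redFP S)) ?vge_u0 ?vge_u1 // red_u0 red_u1.
by rewrite exprD exprM.
Qed.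
Lemma vge_u m l a b : vge vF 0 (u0 m l ^+ a * u1 m l ^+ b).
Proof. by apply: (vgeMl (vFP S)); apply: (vgeX (vFP S)); [apply: vge_u0|apply: vge_u1]. Qed.

Local Notation Ytop := (bmon E r0 r1 r0 r1).

Lemma subst2_Ytop (A0 A1 : 'M[E]_2) : subst2 A0 A1 Ytop =
  (A0 0 1 *: X0 E + A0 1 1 *: Y0 E) ^+ r0 * (A1 0 1 *: X1 E + A1 1 1 *: Y1 E) ^+ r1.
Proof. by rewrite /bmon subst2_mon !subnn !expr0 mul1r mulr1. Qed.

(** The composed substitution sends [Y_i] to [u_i X_i + p Y_i], and the product is expanded to first
    order in p. *)
Lemma aE_kap l m : exists2 w, intp 0 w & aE l (actE (kap m) Ytop) =
  (u0 m l ^+ r0 * u1 m l ^+ r1)%:A *: bmon E r0 r1 0 0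
  + p%:R *: ((r0%:R * (u0 m l ^+ r0.-1 * u1 m l ^+ r1))%:A *: bmon E r0 r1 1 0
           + (r1%:R * (u0 m l ^+ r0 * u1 m l ^+ r1.-1))%:A *: bmon E r0 r1 0 1)
  + p%:R ^+ 2 *: w.
Proof.
have iU0 : intp 0 ((u0 m l)%:A *: X0 E).
  by rewrite X0E; apply: (intpZl (vEP S)); [apply/vge_alg0/vge_u0 | apply: intp_mon].
have iU1 : intp 0 ((u1 m l)%:A *: X1 E).
  by rewrite X1E; apply: (intpZl (vEP S)); [apply/vge_alg0/vge_u1 | apply: intp_mon].
have iY0 : intp 0 (Y0 E) by rewrite Y0E; apply: intp_mon.
have iY1 : intp 0 (Y1 E) by rewrite Y1E; apply: intp_mon.
have [w iw e] := prod_cong2 (vEP S) r0 r1 (vge_p0 S) iU0 iY0 iU1 iY1.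
exists w => //; rewrite /aE /actE subst2M subst2_Ytop.
have -> : (mx2 1 (- (teich l)%:A) 0 p%:R *m map_mx (fun x => x%:A : E) (kap m)) 0 1 = (u0 m l)%:A.
  by rewrite !mxE sum_ord2 !mxE /= mul1r scale1r mulr1 /u0 algD algN.
have -> : (mx2 1 (- (teich l)%:A) 0 p%:R *m map_mx (fun x => x%:A : E) (kap m)) 1 1 = p%:R.
  by rewrite !mxE sum_ord2 !mxE /= mul0r scale1r mulr1 add0r.
have -> : (mx2 1 ((- (teich l)%:A) ^+ p) 0 p%:R *m map_mx (fun x => (sigma x)%:A : E) (kap m)) 0 1
   = (u1 m l)%:A.
  by rewrite !mxE sum_ord2 !mxE /= mul1r rmorph1 scale1r mulr1 /u1 algD algX algN.
have -> : (mx2 1 ((- (teich l)%:A) ^+ p) 0 p%:R *m map_mx (fun x => (sigma x)%:A : E) (kap m)) 1 1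
   = p%:R.
  by rewrite !mxE sum_ord2 !mxE /= mul0r rmorph1 scale1r mulr1 add0r.
rewrite e; move: (u0 m l) (u1 m l) => x y.
have r0' : (r0 - 1)%N = r0.-1 by rewrite subn1.
have r1' : (r1 - 1)%N = r1.-1 by rewrite subn1.
rewrite !algM !algX !alg_nat /bmon !subn0 r0' r1' mon.unlock !expr0 !expr1 !mulr1.
move: (X0 E) (X1 E) (Y0 E) (Y1 E) (x%:A : E) (y%:A : E) => U V Z Z' x' y'.
by rewrite !exprZn scale_mul2 scale_mul3 scale_mul3r.
Qed.

(** Here [Y_i] becomes itself plus p times a multiple of [X_i], so the zeroth-order term does not
    depend on m. *)
Lemma bE_kap m : exists2 w, intp 0 w & bE (actE (kap m) Ytop) =
  (1 : F)%:A *: Ytop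
  + p%:R *: ((r0%:R * teich m)%:A *: bmon E r0 r1 (r0 - 1) r1
           + (r1%:R * sigma (teich m))%:A *: bmon E r0 r1 r0 (r1 - 1))
  + p%:R ^+ 2 *: w.
Proof.
have iZ0 : intp 0 ((teich m)%:A *: X0 E).
  by rewrite X0E; apply: (intpZl (vEP S)); [apply/vge_alg0/vge_teich | apply: intp_mon].
have iZ1 : intp 0 ((sigma (teich m))%:A *: X1 E).
  rewrite X1E; apply: (intpZl (vEP S)); last exact: intp_mon.
  exact/vge_alg0/vge_sigma/vge_teich.
have iY0 : intp 0 (Y0 E) by rewrite Y0E; apply: intp_mon.
have iY1 : intp 0 (Y1 E) by rewrite Y1E; apply: intp_mon.
have [w iw e] := prod_cong2 (vEP S) r0 r1 (vge_p0 S) iY0 iZ0 iY1 iZ1.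
exists w => //; rewrite /bE /actE subst2M subst2_Ytop.
have -> : (mx2 p%:R 0 0 1 *m map_mx (fun x => x%:A : E) (kap m)) 0 1 = p%:R * (teich m)%:A.
  by rewrite !mxE sum_ord2 !mxE /= mul0r addr0.
have -> : (mx2 p%:R 0 0 1 *m map_mx (fun x => x%:A : E) (kap m)) 1 1 = 1.
  by rewrite !mxE sum_ord2 !mxE /= mul0r add0r mul1r scale1r.
have -> : (mx2 p%:R 0 0 1 *m map_mx (fun x => (sigma x)%:A : E) (kap m)) 0 1
    = p%:R * (sigma (teich m))%:A.
  by rewrite !mxE sum_ord2 !mxE /= mul0r addr0.
have -> : (mx2 p%:R 0 0 1 *m map_mx (fun x => (sigma x)%:A : E) (kap m)) 1 1 = 1.
  by rewrite !mxE sum_ord2 !mxE /= mul0r add0r mul1r rmorph1 scale1r.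
rewrite -[(_ * (teich m)%:A) *: X0 E]scalerA -[(_ * _) *: X1 E]scalerA.
rewrite !scale1r [_ + Y0 E]addrC [_ + Y1 E]addrC e.
move: (teich m) (sigma (teich m)) => x y.
have r0' : (r0 - (r0 - 1))%N = 1%N by rewrite subKn.
have r1' : (r1 - (r1 - 1))%N = 1%N by rewrite subKn.
rewrite !algM !alg_nat /bmon !subnn r0' r1' mon.unlock.
rewrite !expr0 !expr1 !mulr1 !mul1r !subn1.
move: (X0 E) (X1 E) (Y0 E) (Y1 E) (x%:A : E) (y%:A : E) => U V Z Z' x' y'.
by rewrite scale_mid scale_last.
Qed.

Definition yE (n : nat) : {mpoly E[4]} := \sum_(m : Fq) (teich m ^+ n)%:A *: actE (kap m) Ytop.

Lemma bihom_kap m : bihom r0 r1 (actE (kap m) Ytop).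
Proof. by apply: bihom_subst2; apply: bihom_bmon. Qed.

(** [h = p^-1 [g, y] + (ap / p) sum_m [m]^n [g kap_m alp^-1, w]]: the terms
    [(ap / p) [g, y]] cancel, and what is left besides [T (p^-1 [g, y])] is
    divisible by [ap] or by [ap^2 / p]. *)
Lemma T_yE_null n g : g \in unitmx -> indVO (hk g (p%:R^-1 *: yE n)) ->
  cls (hk g (p%:R^-1 *: yE n)) = 0.
Proof.
move=> ug Ih.
pose gm m := g *m kap m *m invmx alp.
have ugm m : gm m \in unitmx.
  by rewrite !unitmx_mul ug (inK_unit (inK_kap m)) unitmx_inv unit_alp.
pose cm m : E := ap * p%:R^-1 * (teich m ^+ n)%:A.
have [hw iw] := @inVO_wE p S r0 r1.
pose s := (g, p%:R^-1 *: yE n) :: [seq (gm m, cm m *: wE S r0 r1) | m <- index_enum Fq].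
have hy : bihom r0 r1 (yE n) by apply: bihom_sum => m; apply/bihomZ/bihom_kap.
have sP x : x \in s -> x.1 \in unitmx /\ bihom r0 r1 x.2.
  rewrite inE => /predU1P[->|/mapP[m _ ->]] /=; first by split=> //; apply: bihomZ.
  by split=> //; apply: bihomZ.
have := hk_relation ap sP; rewrite !big_cons !big_map /=.
pose Rm m := hk (gm m) (cm m *: wE S r0 r1) - ap *: bra (gm m) (cm m *: wE S r0 r1)
   - cm m *: bra g (actE (kap m) Ytop).
have -> : hk g (p%:R^-1 *: yE n) + \sum_m hk (gm m) (cm m *: wE S r0 r1)
   - ap *: (bra g (p%:R^-1 *: yE n) + \sum_m bra (gm m) (cm m *: wE S r0 r1))
   = hk g (p%:R^-1 *: yE n) + \sum_m Rm m.
  apply: (@sum_regroup _ _ Fq (fun m => hk (gm m) (cm m *: wE S r0 r1))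
    (fun m => bra (gm m) (cm m *: wE S r0 r1)) (fun m => bra g (actE (kap m) Ytop))).
  rewrite braE_Z scalerA /yE braE_sum scaler_sumr; apply: eq_bigr => m _.
  by rewrite braE_Z scalerA.
have icm m : vge vE (vE ap - 1) (cm m).
  rewrite /cm -[vE ap - 1]addr0; apply: (vgeM (vEP S)).
    apply: (vgeM (vEP S)); first exact: vge_ap.
    by rewrite /vge (valV (vEP S)) ?pE_neq0 // vE_p lexx orbT.
  by apply: vge_alg0; apply: (vgeX (vFP S)); apply: vge_teich.
have ap0 : 0 < vE ap by case/andP: ap_bnd => h _; apply: lt_trans h.
have N1 : 0 < vE ap - 1 + 1 by rewrite subrK.
have N2 : 0 < vE ap + (vE ap - 1).
  case/andP: ap_bnd => h _; rewrite addrA subr_gt0 -mulr2n -mulr_natr.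
  by rewrite -ltr_pdivrMr.
have Rnull m : null r0 r1 ap (Rm m).
  have -> : Rm m = (\sum_l bra (gm m *m alpl l) (cm m *: aE l (wE S r0 r1)))
     + bra (g *m kap m) (cm m *: (bE (wE S r0 r1) - Ytop))
     + -1 *: bra (gm m) ((ap * cm m) *: wE S r0 r1).
    have ga : gm m *m alp = g *m kap m by rewrite mulmxKV // unit_alp.
    have e1 : hk (gm m) (cm m *: wE S r0 r1) =
        \sum_l bra (gm m *m alpl l) (cm m *: aE l (wE S r0 r1))
        + bra (g *m kap m) (cm m *: bE (wE S r0 r1)).
      by rewrite hkE ga bE_Z; under eq_bigr do rewrite aE_Z.
    have e2 : ap *: bra (gm m) (cm m *: wE S r0 r1) = bra (gm m) ((ap * cm m) *: wE S r0 r1).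
      by rewrite -braE_Z scalerA.
    have e3 : cm m *: bra g (actE (kap m) Ytop) = bra (g *m kap m) (cm m *: Ytop).
      by rewrite (braE_act _ _ (inK_kap m)) braE_Z.
    have e4 : bra (g *m kap m) (cm m *: (bE (wE S r0 r1) - Ytop)) =
        bra (g *m kap m) (cm m *: bE (wE S r0 r1)) - bra (g *m kap m) (cm m *: Ytop).
      by rewrite scalerBr braE_B.
    rewrite /Rm e1 e2 e3 e4 scaleN1r; exact: sub_regroup.
  apply: nullD; last first.
    apply: nullZ; first by apply: (vgeN (vEP S)); apply: (vge_1 (vEP S)).
    apply: (null_bra _ (ugm m) (bihomZ hw) N2); apply: (intpZr (vEP S)) => //.
    by apply: (vgeM (vEP S) _ (icm m)); exact: vge_ap.
  apply: nullD; last first.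
    have ugk : g *m kap m \in unitmx by rewrite unitmx_mul ug (inK_unit (inK_kap m)).
    apply: (null_bra _ ugk _ N1).
      apply: bihomZ; apply: bihomB; last exact: bihom_bmon.
      exact: bihom_bE.
    by apply: (intpZ (vEP S) (icm m)); apply: (bE_wE S p_prime r0_ge r1_ge).
  apply: null_sum => l.
  have ugl : gm m *m alpl l \in unitmx by rewrite unitmx_mul ugm unit_alpl.
  apply: (null_bra _ ugl _ N1); first by apply/bihomZ/bihom_aE.
  by apply: (intpZ (vEP S) (icm m)); apply: (aE_wE p_prime r0_ge r1_ge).
have [IR eR] := null_sum (index_enum Fq) Rnull.
move=> rel; have := cls_toPi0 (indVOD Ih IR) rel.
by rewrite clsD // eR addr0.
Qed.

Lemma iota_red_sum n (h : Fq -> F) : (forall m, vge vF 0 (h m)) ->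
  iota (redF (\sum_m teich m ^+ n * h m)) = \sum_m iota m ^+ n * iota (redF (h m)).
Proof.
move=> ih; have it m : vge vF 0 (teich m ^+ n) by apply: (vgeX (vFP S)); apply: vge_teich.
rewrite (red_sum (vFP S) (redFP S)) => [|m]; last exact: (vgeMl (vFP S)).
rewrite rmorph_sum; apply: eq_bigr => m _.
by rewrite (red_M (redFP S)) // (red_X (vFP S) (redFP S)) ?vge_teich // red_teich rmorphM rmorphXn.
Qed.

End Key.

(** * The Hecke relation attached to a monomial of the weight *)

Lemma scaled_relation (K : fieldType) (V : lmodType K) (I : finType) (X : I -> V) (Y : V)
    (c : I -> K) (a b : K) (t : bool) : a != 0 -> b != 0 -> (t -> b = -1) ->
  \sum_l (- (a * b * c l)) *: X l + (if t then - a else 0) *: Y = 0 ->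
  \sum_l c l *: X l = if t then Y else 0.
Proof.
move=> a0 b0 tb e; have ab : - (a * b) != 0 by rewrite oppr_eq0 mulf_neq0.
apply: (scalerI ab); rewrite scaler_sumr.
under eq_bigr => l _ do rewrite scalerA mulNr.
move/eqP: e; rewrite addr_eq0 => /eqP ->.
case: t tb => [->//|_]; last by rewrite scale0r oppr0 scaler0.
by rewrite mulrN1 opprK scaleNr opprK.
Qed.

Section HeckeRelation.
Variables (p : nat) (S : setting p).
Hypothesis p_prime : prime p.
Hypothesis p_gt2 : (2 < p)%N.
Local Notation F := (F S).
Local Notation E := (E S).
Local Notation Fq := (Fq S).
Local Notation k := (k S).
Local Notation vF := (@vF p S).
Local Notation redF := (@redF p S).
Local Notation iota := (@iota p S).
Local Notation teich := (@teich p S).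
Local Notation sigma := (@sigma p S).
Local Notation q := (p ^ 2)%N.

Variables (r0 r1 a0 : nat) (ap : E).
Hypothesis r0_ge : (q <= r0)%N.
Hypothesis r1_ge : (q <= r1)%N.
Hypothesis r_mod : (r0 + p * r1 = a0 %[mod q - 1])%N.
Hypothesis a0_bnd : (1 <= a0 <= p - 1)%N.
Hypothesis p_r1 : ~~ (p %| r1)%N.
Hypothesis p_r0 : a0 = 1%N -> (p %| r0)%N.
Hypothesis ap_bnd : 1 / 2 < vE ap < 1.

Local Notation inVO := (@inVO p S r0 r1).
Local Notation indVO := (@indVO p S r0 r1).
Local Notation bra := (bra (@actE p S)).
Local Notation tau := (@tau p S r0 r1 ap).
Local Notation cls := (@cls p S r0 r1 ap).
Local Notation alp := (@alp p S).
Local Notation r := (r0 + p * r1)%N.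
Local Notation s0 := (a0 - 1)%N.
Local Notation s1 := (p - 2)%N.

Let p0 : (0 < p)%N := prime_gt0 p_prime.
Let p1 : (1 < p)%N := prime_gt1 p_prime.
Let p2 : (2 * p <= q)%N. Proof. by rewrite -mulnn leq_mul2r p1 orbT. Qed.
Let rq : (2 * q <= r)%N.
Proof. by have := leq_mul p0 (leqnn r1); rewrite mul1n; flia. Qed.
Let r0_gt0 : (0 < r0)%N. Proof. by apply: leq_trans r0_ge; rewrite expn_gt0 p0. Qed.
Let r1_gt0 : (0 < r1)%N. Proof. by apply: leq_trans r1_ge; rewrite expn_gt0 p0. Qed.

Variables (i j : nat) (g : 'M[F]_2).
Hypothesis hi : (i <= s0)%N.
Hypothesis hj : (j <= s1)%N.
Hypothesis ug : g \in unitmx.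

(** With this exponent the sum of exponent r - p selects the digits (i, j). It is positive as a0 <
    p, and n + a0 = i + p j + p stays below q - 1, which makes the sums of lower exponent vanish. *)
Let n := (i + p * j + p - a0)%N.
Let K : k := 'C(s0, i)%:R * 'C(p.-1, j)%:R.

Let pe := digit_bound p1 a0_bnd hi hj.
Let n0 : (0 < n)%N. Proof. by rewrite /n; flia. Qed.
Let na : (n + a0 < q - 1)%N. Proof. by rewrite /n; flia. Qed.
Let it m : vge vF 0 (teich m ^+ n).
Proof. by apply: (vgeX (vFP S)); apply: vge_teich. Qed.
Let iota_inj0 x : iota x = 0 -> x = 0.
Proof. by move/eqP; rewrite fmorph_eq0 => /eqP. Qed.
Let ugl l : g *m alpl l \in unitmx. Proof. by rewrite unitmx_mul ug unit_alpl. Qed.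
Let uga : g *m alp \in unitmx. Proof. by rewrite unitmx_mul ug unit_alp. Qed.
Let K0 : K != 0.
Proof. by rewrite mulf_neq0 // (binr_neq0_lt (pchark S p_prime)) //; flia. Qed.
Let R1 : r1%:R != 0 :> k.
Proof. by rewrite (natr_eq0_pchar (pchark S p_prime)). Qed.

Lemma aE_yE l : inVO (p%:R^-1 *: aE l (yE S r0 r1 n)) /\
    cls (bra (g *m alpl l) (p%:R^-1 *: aE l (yE S r0 r1 n))) =
    (- (r1%:R * K * iota (- l) ^+ (i + p * j))) *: tau (g *m alpl l) (bmon k r0 r1 0 1).
Proof.
have -> : aE l (yE S r0 r1 n) = \sum_m (teich m ^+ n)%:A *: aE l (actE (kap m) (bmon E r0 r1 r0 r1)).
  by rewrite /yE /aE linear_sum; apply: eq_bigr => m _; rewrite linearZ.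
have := @cls_expand p S r0 r1 ap (g *m alpl l) (fun m => aE l (actE (kap m) (bmon E r0 r1 r0 r1)))
  (fun m => teich m ^+ n) (fun m => u0 m l ^+ r0 * u1 m l ^+ r1)
  (fun m => r0%:R * (u0 m l ^+ r0.-1 * u1 m l ^+ r1))
  (fun m => r1%:R * (u0 m l ^+ r0 * u1 m l ^+ r1.-1)) 0 0 1 0 0 1 (ugl l).
case.
- by move=> m; apply/bihom_aE/bihom_kap.
- by [].
- by [].
- by flia.
- by [].
- by [].
- by flia.
- by [].
- by move=> m; apply: vge_u.
- by move=> m; apply: (vgeMl (vFP S)); [apply: vge_nat (vFP S) _ | apply: vge_u].
- by move=> m; apply: (vgeMl (vFP S)); [apply: vge_nat (vFP S) _ | apply: vge_u].
- by move=> m; apply: aE_kap.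
- apply: iota_inj0; rewrite iota_red_sum => [|m]; last exact: vge_u.
  have e m : iota (redF (u0 m l ^+ r0 * u1 m l ^+ r1)) = iota (m - l) ^+ a0.
    rewrite (red_u p_prime) rmorphXn /=; apply: iota_mod r_mod; last by case/andP: a0_bnd.
    by rewrite addn_gt0 r0_gt0.
  by under eq_bigr => m _ do rewrite e; apply: (iota_sum_small p_prime).
- exact: (tau_X p_prime r0_ge r1_ge ap_bnd (ugl l)).
move=> V ->; split=> //.
rewrite !iota_red_sum => [|m|m]; try by apply: (vgeMl (vFP S)); [apply: vge_nat (vFP S) _ | apply: vge_u].
have -> : \sum_m iota m ^+ n * iota (redF (r0%:R * (u0 m l ^+ r0.-1 * u1 m l ^+ r1))) = 0.
  have e m : iota (redF (r0%:R * (u0 m l ^+ r0.-1 * u1 m l ^+ r1)))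
      = r0%:R * iota (m - l) ^+ (r0.-1 + p * r1).
    rewrite (red_M (redFP S)) ?vge_u ?(vge_nat (vFP S)) // (red_nat (vFP S) (redFP S)).
    by rewrite (red_u p_prime) rmorphM rmorph_nat rmorphXn.
  under eq_bigr => m _ do rewrite e mulrCA.
  (* For a0 = 1 the exponent r - 1 is a positive multiple of q - 1 and the power sum need not
     vanish: the term disappears because p divides r0. For a0 > 1 the exponent reduces to a0 - 1 and
     the sum is zero. *)
  rewrite -mulr_sumr; case: (eqVneq a0 1%N) => [a1|a1].
    have /eqP -> : r0%:R == 0 :> k by rewrite (natr_eq0_pchar (pchark S p_prime)) p_r0.
    by rewrite mul0r.
  have e' m : iota (m - l) ^+ (r0.-1 + p * r1) = iota (m - l) ^+ s0.
    apply: iota_mod; [flia|flia|]; apply/eqP; rewrite -(eqn_modDr 1).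
    have -> : (r0.-1 + p * r1 + 1 = r)%N by flia.
    by rewrite subnK ?r_mod //; flia.
  under eq_bigr => m _ do rewrite e'.
  by rewrite (iota_sum_small p_prime) ?mulr0 //; flia.
have -> : \sum_m iota m ^+ n * iota (redF (r1%:R * (u0 m l ^+ r0 * u1 m l ^+ r1.-1))) =
   - (r1%:R * K * iota (- l) ^+ (i + p * j)).
  have e m : iota (redF (r1%:R * (u0 m l ^+ r0 * u1 m l ^+ r1.-1)))
      = r1%:R * iota (m - l) ^+ (r0 + p * r1.-1).
    rewrite (red_M (redFP S)) ?vge_u ?(vge_nat (vFP S)) // (red_nat (vFP S) (redFP S)).
    by rewrite (red_u p_prime) rmorphM rmorph_nat rmorphXn.
  under eq_bigr => m _ do rewrite e mulrCA.
  by rewrite -mulr_sumr (iota_sum_big p_prime r0_gt0 r1_gt0 r_mod a0_bnd) // mulrN mulrA.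
by rewrite scale0r add0r.
Qed.

(** The power sums have exponents n, n + 1 and n + p. The first two stay below q - 1; the third
    equals q - 1 exactly when i = a0 - 1 and j = p - 2. *)
Lemma bE_yE : inVO (p%:R^-1 *: bE (yE S r0 r1 n)) /\
    cls (bra (g *m alp) (p%:R^-1 *: bE (yE S r0 r1 n))) =
    (if (i == s0) && (j == s1) then - r1%:R else 0) *: tau (g *m alp) (bmon k r0 r1 r0 (r1 - 1)).
Proof.
have -> : bE (yE S r0 r1 n) = \sum_m (teich m ^+ n)%:A *: bE (actE (kap m) (bmon E r0 r1 r0 r1)).
  by rewrite /yE /bE linear_sum; apply: eq_bigr => m _; rewrite linearZ.
have := @cls_expand p S r0 r1 ap (g *m alp) (fun m => bE (actE (kap m) (bmon E r0 r1 r0 r1)))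
  (fun m => teich m ^+ n) (fun m => 1)
  (fun m => r0%:R * teich m) (fun m => r1%:R * sigma (teich m)) r0 r1 (r0 - 1) r1 r0 (r1 - 1) uga.
case.
- by move=> m; apply/bihom_bE/bihom_kap.
- by [].
- by [].
- by flia.
- by [].
- by [].
- by flia.
- by [].
- by move=> m; apply: vge_1 (vFP S).
- by move=> m; apply: (vgeMl (vFP S)); [apply: vge_nat (vFP S) _ | apply: vge_teich].
- by move=> m; apply: (vgeMl (vFP S)); [apply: vge_nat (vFP S) _ | apply/vge_sigma/vge_teich].
- by move=> m; apply: (bE_kap p_prime).
- apply: iota_inj0; rewrite iota_red_sum => [|m]; last exact: vge_1 (vFP S).
  under eq_bigr => m _ do rewrite (red_1 (redFP S)) rmorph1 mulr1.
  rewrite (iota_power_sum S p_prime); last by flia.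
  by rewrite (_ : (_ == _) = false) //; apply/eqP; flia.
- exact: (tau_Y p_prime r0_ge r1_ge ap_bnd uga).
move=> V ->; split=> //.
rewrite !iota_red_sum => [|m|m]; try by apply: (vgeMl (vFP S)); [apply: vge_nat (vFP S) _ |
   try apply: vge_sigma; apply: vge_teich].
have -> : \sum_m iota m ^+ n * iota (redF (r0%:R * teich m)) = 0.
  under eq_bigr => m _ do rewrite (red_M (redFP S)) ?vge_teich ?(vge_nat (vFP S)) //
    (red_nat (vFP S) (redFP S)) red_teich rmorphM rmorph_nat mulrCA -exprSr.
  rewrite -mulr_sumr (iota_power_sum S p_prime); last by flia.
  by rewrite (_ : (_ == _) = false) ?mulr0 //; apply/eqP; rewrite /n; flia.
have -> : \sum_m iota m ^+ n * iota (redF (r1%:R * sigma (teich m))) =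
   if (i == s0) && (j == s1) then - r1%:R else 0.
  have e m : iota m ^+ n * iota (redF (r1%:R * sigma (teich m))) = r1%:R * iota m ^+ (n + p).
    rewrite (red_M (redFP S)) ?(vge_nat (vFP S)) //; last exact/vge_sigma/vge_teich.
    rewrite (red_nat (vFP S) (redFP S)) red_sigma ?vge_teich // red_teich.
    by rewrite rmorphM rmorph_nat rmorphXn mulrCA exprD.
  under eq_bigr => m _ do rewrite e.
  rewrite -mulr_sumr (iota_power_sum S p_prime); last by rewrite /n; flia.
  have -> : (n + p == q - 1)%N = (i == s0) && (j == s1).
    have qs := q_split p_prime.
    by rewrite -(digit_eq p_prime); [rewrite /n; apply/eqP/eqP; flia | flia | flia].
  by case: ifP; rewrite ?mulr0 // mulrN1.
by rewrite scale0r add0r.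
Qed.

(** The class of [T (p^-1 [g, y])] is zero and both of its parts are known; the relation remains
    after division by r1 K. In the exceptional case K = C(p - 1, p - 2) = -1, which determines the
    sign on the right. *)
Lemma hecke_relation :
  \sum_(l : Fq) iota (- l) ^+ (i + p * j) *: tau (g *m alpl l) (bmon k r0 r1 0 1) =
  if (i == s0) && (j == s1) then tau (g *m alp) (bmon k r0 r1 r0 (r1 - 1)) else 0.
Proof.
have podd : odd (p - 2).
  have [h|h] := even_prime p_prime; first by move: p_gt2; rewrite h.
  by rewrite (oddB (ltnW p_gt2)) h.
have hkE' : hk g (p%:R^-1 *: yE S r0 r1 n) =
    \sum_l bra (g *m alpl l) (p%:R^-1 *: aE l (yE S r0 r1 n)) + bra (g *m alp) (p%:R^-1 *: bE (yE S r0 r1 n)).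
  by rewrite hkE bE_Z; under eq_bigr do rewrite aE_Z.
have Il l : indVO (bra (g *m alpl l) (p%:R^-1 *: aE l (yE S r0 r1 n))).
  exact: (braE_ind (ugl l) (proj1 (aE_yE l))).
have Ia : indVO (bra (g *m alp) (p%:R^-1 *: bE (yE S r0 r1 n))) by exact: (braE_ind uga (proj1 bE_yE)).
have Is : indVO (\sum_l bra (g *m alpl l) (p%:R^-1 *: aE l (yE S r0 r1 n))) by apply: indVO_sum.
have Ih : indVO (hk g (p%:R^-1 *: yE S r0 r1 n)) by rewrite hkE'; exact: (indVOD Is Ia).
have e0 := T_yE_null p_prime r0_ge r1_ge ap_bnd ug Ih.
have e1 := etrans (esym (congr1 cls hkE')) e0.
have e2 := clsD ap Is Ia.
have e3 := cls_sum ap (index_enum Fq) Il.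
have e4 := etrans (esym e2) e1.
have e5 : \sum_l (- (r1%:R * K * iota (- l) ^+ (i + p * j))) *: tau (g *m alpl l) (bmon k r0 r1 0 1)
   + (if (i == s0) && (j == s1) then - r1%:R else 0) *: tau (g *m alp) (bmon k r0 r1 r0 (r1 - 1)) = 0.
  apply: etrans e4; congr (_ + _); last exact: (esym (proj2 bE_yE)).
  by apply: etrans (esym e3); apply: eq_bigr => l _; exact: (esym (proj2 (aE_yE l))).
apply: (scaled_relation R1 K0 _ e5) => /andP[/eqP ei /eqP ej].
rewrite /K ei ej binn mul1r (binr_pred (pchark S p_prime)); last by flia.
by rewrite -signr_odd podd expr1.
Qed.

End HeckeRelation.

(** * The natural map on [ind Q] *)

Section NaturalMap.
Variables (p : nat) (S : setting p).
Hypothesis p_prime : prime p.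
Local Notation F := (F S).
Local Notation E := (E S).
Local Notation k := (k S).
Local Notation redE := (@redE p S).
Local Notation redp := (@map_mpoly 4 _ _ redE).
Local Notation q := (p ^ 2)%N.

Variables (r0 r1 : nat) (ap : E).
Hypothesis r0_ge : (q <= r0)%N.
Hypothesis r1_ge : (q <= r1)%N.
Hypothesis ap_neq0 : ap != 0.
Hypothesis ap_bnd : 1 / 2 < vE ap < 1.

Local Notation QS := (Q S r0 r1).
Local Notation TB := (ThetaBar r0 r1 ap).
Local Notation tau := (@tau p S r0 r1 ap).
Local Notation prQ := (@prQ p S r0 r1).
Local Notation actQ := (@actQ p S r0 r1).
Local Notation braQ := (bra actQ).
Local Notation tau_prQ := (tau_prQ p_prime r0_ge r1_ge ap_neq0 ap_bnd).

Definition tauQ (g : 'M[F]_2) (x : QS) : TB := tau g (ofquo x).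

Lemma tauQ_pr g v : g \in unitmx -> tauQ g (prQ v) = tau g v.
Proof. by move=> ug; apply: tau_prQ => //; apply: ofquoK. Qed.

Lemma tauQ_linear g : g \in unitmx -> linear (tauQ g).
Proof.
move=> ug c x y; have ex : x = prQ (ofquo x) by rewrite /Defs.prQ ofquoK.
have ey : y = prQ (ofquo y) by rewrite /Defs.prQ ofquoK.
rewrite {1}ex {1}ey -prQP tauQ_pr // tauP.
by rewrite /tauQ.
Qed.

Lemma tauQ_0 g : g \in unitmx -> tauQ g 0 = 0.
Proof.
by move=> ug; have := tauQ_linear ug (-1) 0 0; rewrite scaler0 addr0 scaleN1r addNr.
Qed.

Lemma tauQ_Z g c x : g \in unitmx -> tauQ g (c *: x) = c *: tauQ g x.
Proof. by move=> ug; have := tauQ_linear ug c x 0; rewrite tauQ_0 // !addr0. Qed.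

(** A finite list of representatives is chosen for each x, and by [phiE] any other list carrying the
    support gives the same sum. The empty list is a default. *)
Definition phi_support (x : 'M[F]_2 -> QS) : seq 'M[F]_2 :=
  if pselect (weak_ind x) is left h then projT1 (cid h) else [::].

Definition phi (x : 'M[F]_2 -> QS) : TB :=
  \sum_(c <- phi_support x) tauQ (invmx c) (x c).

Lemma phiE x C : @crep_list p S C -> supported x C ->
  phi x = \sum_(c <- C) tauQ (invmx c) (x c).
Proof.
move=> [uC CP] sC; rewrite /phi /phi_support; case: pselect => [h|[]]; last by exists C.
case: cid => D /= [[uD DP] sD].
pose G c := tauQ (invmx c) (x c).
have supp (L : seq 'M[F]_2) : uniq L ->
    \sum_(c <- L) G c = \sum_(c <- [seq c <- L | G c != 0]) G c.
  move=> uL; rewrite big_filter [LHS](bigID (fun c => G c != 0)) /= [X in _ + X]big1 ?addr0 //.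
  by move=> c; rewrite negbK => /eqP.
rewrite -/(G _) (supp D) // (supp C) //; apply: perm_big.
apply: uniq_perm; rewrite ?filter_uniq // => c; rewrite !mem_filter.
case: (boolP (G c != 0)) => //= Gc.
have xc : c \in unitmx -> x c != 0.
  by move=> uc; apply: contraNneq Gc => xc; rewrite /G xc tauQ_0 // unitmx_inv.
apply/idP/idP => [/DP[uc cc]|/CP[uc cc]]; [apply: sC | apply: sD] => //; exact: xc.
Qed.

Lemma supportedW (W : lmodType k) (x : 'M[F]_2 -> W) (C D : seq 'M[F]_2) :
  {subset C <= D} -> @supported p S _ _ x C -> @supported p S _ _ x D.
Proof. by move=> CD sC c uc cc xc; apply/CD/sC. Qed.

Lemma crep_list_cat C D : @crep_list p S C -> @crep_list p S D ->
  @crep_list p S (undup (C ++ D)).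
Proof.
move=> [_ CP] [_ DP]; split=> [|c]; first exact: undup_uniq.
by rewrite mem_undup mem_cat => /orP[/CP|/DP].
Qed.

Lemma phi_linear c x y : weak_ind x -> weak_ind y ->
  phi (c *: x + y) = c *: phi x + phi y.
Proof.
move=> [C [CP sC]] [D [DP sD]]; have UP := crep_list_cat CP DP.
set U := undup _ in UP.
have sx : supported x U by apply: supportedW sC => a aC; rewrite mem_undup mem_cat aC.
have sy : supported y U by apply: supportedW sD => a aD; rewrite mem_undup mem_cat aD orbT.
have sxy : supported (c *: x + y) U.
  move=> a ua ca; rewrite -[X in X != _]/(c *: x a + y a).
  case: (eqVneq (x a) 0) => [->|xa _]; last exact: sx.
  by rewrite scaler0 add0r; apply: sy.
rewrite (phiE UP sx) (phiE UP sy) (phiE UP sxy) scaler_sumr -big_split.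
rewrite [LHS]big_seq [RHS]big_seq; apply: eq_bigr => a aU /=.
rewrite -[(c *: x + y) a]/(c *: x a + y a) tauQ_linear // unitmx_inv.
by case: UP => _ /(_ _ aU)[].
Qed.

Lemma actQ_linear g : inK g -> linear (actQ g).
Proof. by move=> Kg; apply: (actGammaQ_linear p_prime r0_ge r1_ge); apply: map_red_unit. Qed.

Lemma actQ_M g h v : inK g -> inK h -> actQ (g *m h) v = actQ g (actQ h v).
Proof.
move=> Kg Kh; rewrite /Defs.actQ (map_redM Kg Kh).
by apply: (actGammaQ_M p_prime r0_ge r1_ge); apply: map_red_unit.
Qed.

Lemma actQ_in g v : inK g -> inQ v -> inQ (actQ g v).
Proof. by move=> Kg; apply: (inQ_act p_prime r0_ge r1_ge); apply: map_red_unit. Qed.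

Lemma inQ_0 : @inQ p S r0 r1 0.
Proof. by exists 0; [apply: bihom0 | rewrite /Defs.prQ linear0]. Qed.

Lemma inQ_P c u v : inQ u -> inQ v -> @inQ p S r0 r1 (c *: u + v).
Proof.
move=> [u' hu ->] [v' hv ->]; exists (c *: u' + v'); last by rewrite prQP.
by apply: bihomD => //; apply: bihomZ.
Qed.

Lemma braQ_ind g x : g \in unitmx -> inQ x -> indQ (braQ g x).
Proof. by apply: bra_ind; [exact: actQ_linear|exact: actQ_M|exact: actQ_in|exact: inQ_0]. Qed.

Lemma indQ_0 : @indQ p S r0 r1 0.
Proof. by apply: ind0; [exact: actQ_linear | exact: inQ_0]. Qed.

Lemma indQ_D x y : indQ x -> indQ y -> @indQ p S r0 r1 (x + y).
Proof. by apply: indD; [exact: actQ_linear | exact: inQ_P]. Qed.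

Lemma indQ_sum (I : eqType) (s : seq I) (f : I -> 'M[F]_2 -> QS) :
  (forall i, i \in s -> indQ (f i)) -> indQ (\sum_(i <- s) f i).
Proof. by apply: ind_sum; [exact: actQ_linear | exact: inQ_0 | exact: inQ_P]. Qed.

Lemma phi_0 : phi 0 = 0.
Proof.
have w0 := ind_weak indQ_0.
by have := phi_linear (-1) w0 w0; rewrite scaler0 addr0 scaleN1r addNr.
Qed.

Lemma phi_sum (I : eqType) (s : seq I) (f : I -> 'M[F]_2 -> QS) :
  (forall i, i \in s -> indQ (f i)) -> phi (\sum_(i <- s) f i) = \sum_(i <- s) phi (f i).
Proof.
elim: s => [|i s IH] If; first by rewrite !big_nil phi_0.
have Is j : j \in s -> indQ (f j) by move=> js; apply: If; rewrite inE js orbT.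
rewrite !big_cons -{1}[f i]scale1r phi_linear ?scale1r ?IH //; apply: ind_weak.
  by apply: If; rewrite mem_head.
exact: indQ_sum.
Qed.

(** Representatives supporting f also support its reduction. Over them f is a finite sum of brackets
    with integral vectors, and [cls_bra] evaluates each one. *)
Lemma phi_natural : natural_on_indQ phi.
Proof.
split=> [c x y /ind_weak wx /ind_weak wy|f y If ey]; first exact: phi_linear.
rewrite -(clsE If ey); have [C [CP sf]] := ind_weak If.
set x := fun g => _.
have redp0 : redp 0 = 0.
  by apply/mpolyP => m; rewrite (mcoeff_redp (redEP S)) !mcoeff0 (red_0 (redEP S)).
have sx : supported x C.
  move=> c uc cc xc; apply: sf => //; apply: contraNneq xc => fc.
  by rewrite /x fc redp0 /Defs.prQ linear0.
rewrite (phiE CP sx).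
rewrite [in RHS](ind_decomp (fun h _ => actE_linear h) If CP sf).
have Vf c : inVO r0 r1 (f c) by case: If.
have [_ CP2] := CP.
have : {subset C <= C} by [].
elim: {1 3 4}C => [|c s IH] sub; first by rewrite !big_nil cls_0.
have /CP2[uc _] := sub _ (mem_head _ _).
have uc' : invmx c \in unitmx by rewrite unitmx_inv.
have sub' : {subset s <= C} by move=> a as_; apply: sub; rewrite inE as_ orbT.
rewrite !big_cons clsD; first by rewrite -IH // cls_bra // tauQ_pr.
  exact: braE_ind.
elim: s sub' {IH sub} => [|a s IH] sub'; first by rewrite big_nil; apply: indVO0.
rewrite big_cons; apply: indVOD; last by apply: IH => b bs; apply: sub'; rewrite inE bs orbT.
by apply: braE_ind => //; rewrite unitmx_inv; case: (CP2 a) => //; apply: sub'; rewrite mem_head.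
Qed.

Lemma braQ_bmon g b d : (b <= r0)%N -> (d <= r1)%N ->
  braQ g (prQ (bmon k r0 r1 b d)) =
  fun g' => prQ (redp (bra (@actE p S) g (bmon E r0 r1 b d) g')).
Proof.
move=> hb hd; apply/funext => g'; rewrite /bra; case: asboolP => [KZ|_].
  have Kk := Kpart_in KZ; rewrite /Defs.actQ (actGammaQ_pr p_prime r0_ge r1_ge _ (map_red_unit Kk)).
  by rewrite redp_actE.
have -> : redp 0 = 0.
  by apply/mpolyP => m; rewrite (mcoeff_redp (redEP S)) !mcoeff0 (red_0 (redEP S)).
by rewrite /Defs.prQ linear0.
Qed.

Lemma braQ_linear g : linear (braQ g).
Proof. exact: bra_linear actQ_linear g. Qed.

(** Since v need not lift, the proof goes monomial by monomial: the bracket of a monomial is the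
    reduction of an integral bracket, to which naturality applies. *)
Lemma phi_bra g v : g \in unitmx -> bihom r0 r1 v -> phi (braQ g (prQ v)) = tau g v.
Proof.
move=> ug hv.
have : bihom r0 r1 v /\ phi (braQ g (prQ v)) = tau g v; last by case.
move: v hv; apply: bihom_ind => [|c b d v hb hd [hv IH]].
  have -> : prQ 0 = 0 by rewrite /Defs.prQ linear0.
  have -> : braQ g 0 = 0.
    by have := braQ_linear g (-1) 0 0; rewrite scaler0 addr0 scaleN1r addNr.
  by rewrite phi_0 tau0; split=> //; apply: bihom0.
have hbm : bihom r0 r1 (bmon k r0 r1 b d) by apply: bihom_bmon.
split; first by apply: bihomD => //; apply: bihomZ.
rewrite prQP braQ_linear phi_linear; last first.
- by apply: ind_weak; apply: braQ_ind => //; exists v.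
- by apply: ind_weak; apply: braQ_ind => //; exists (bmon k r0 r1 b d).
rewrite IH tauP; congr (_ *: _ + _); rewrite braQ_bmon //.
have Ib : indVO r0 r1 (bra (@actE p S) g (bmon E r0 r1 b d)).
  by apply: braE_ind => //; apply: inVO_bmon.
have [y ey e] := cls_lift ap Ib.
by rewrite (phi_natural.2 _ _ Ib ey) -e tau_bmon.
Qed.

Lemma phi_braQ g x : g \in unitmx -> inQ x -> phi (braQ g x) = tauQ g x.
Proof. by move=> ug [v hv ->]; rewrite phi_bra // tauQ_pr. Qed.

End NaturalMap.

(** * Vanishing on the image of the Hecke operator *)

Section Vanishing.
Variables (p : nat) (S : setting p).
Hypothesis p_prime : prime p.
Local Notation F := (F S).
Local Notation E := (E S).
Local Notation Fq := (Fq S).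
Local Notation k := (k S).
Local Notation iota := (@iota p S).
Local Notation q := (p ^ 2)%N.

Variables (r0 r1 : nat) (ap : E).
Hypothesis r0_ge : (q <= r0)%N.
Hypothesis r1_ge : (q <= r1)%N.
Hypothesis ap_neq0 : ap != 0.
Hypothesis ap_bnd : 1 / 2 < vE ap < 1.

Local Notation QS := (Q S r0 r1).
Local Notation tau := (@tau p S r0 r1 ap).
Local Notation prQ := (@prQ p S r0 r1).
Local Notation actQ := (@actQ p S r0 r1).
Local Notation braQ := (bra actQ).
Local Notation tauQ := (@tauQ p S r0 r1 ap).
Local Notation alp := (@alp p S).
Hypothesis p_gt2 : (2 < p)%N.
Variable a0 : nat.
Hypothesis r_mod : (r0 + p * r1 = a0 %[mod q - 1])%N.
Hypothesis a0_bnd : (1 <= a0 <= p - 1)%N.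
Hypothesis p_r1 : ~~ (p %| r1)%N.
Hypothesis p_r0 : a0 = 1%N -> (p %| r0)%N.
Local Notation s0 := (a0 - 1)%N.
Local Notation s1 := (p - 2)%N.
Local Notation j0 := (@j0 p S r0 r1).

Let p0 : (0 < p)%N := prime_gt0 p_prime.

Definition aWt (l : Fq) : {mpoly k[4]} -> {mpoly k[4]} :=
  subst2 (mx2 1 (- iota l) 0 0) (mx2 1 ((- iota l) ^+ p) 0 0).
Definition bWt : {mpoly k[4]} -> {mpoly k[4]} :=
  subst2 (mx2 0 0 0 1) (mx2 0 0 0 1).

Lemma aWt_bmon l i j : (i <= s0)%N -> (j <= s1)%N ->
  aWt l (bmon k s0 s1 i j) = iota (- l) ^+ (i + p * j) *: bmon k s0 s1 0 0.
Proof.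
move=> hi hj; rewrite /aWt /bmon subst2_mon !mx2E !scale0r !addr0 !scale1r rmorphN.
rewrite [(_ *: X0 k) ^+ i]exprZn [(_ *: X1 k) ^+ j]exprZn mul_scale4 exprD exprM.
by rewrite mon.unlock !expr0 !mulr1 !subn0 -mulrA -!exprD !subnK.
Qed.

Lemma bWt_bmon i j : (i <= s0)%N -> (j <= s1)%N ->
  bWt (bmon k s0 s1 i j) = if (i == s0) && (j == s1) then bmon k s0 s1 s0 s1 else 0.
Proof.
move=> hi hj; rewrite /bWt /bmon subst2_mon !mx2E !scale0r !addr0 !add0r !scale1r.
rewrite !expr0n !subn_eq0; case: (eqVneq i s0) => [->|ni].
  rewrite leqnn; case: (eqVneq j s1) => [->|nj] /=.
    by rewrite leqnn !subnn mon.unlock !expr0 !mul1r.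
  by rewrite (_ : (s1 <= j)%N = false) ?mulr0 ?mul0r //; apply/negbTE; rewrite -ltnNge ltn_neqAle nj.
by rewrite (_ : (s0 <= i)%N = false) ?mul0r //; apply/negbTE; rewrite -ltnNge ltn_neqAle ni.
Qed.

(** The two monomials define the same function: the exponents (a0 - 1) + p (p - 1) and r - p of y
    are congruent modulo q - 1, as are the complementary exponents of x, and all four are
    positive. *)
Lemma prQ_lowest : prQ (bmon k r0 r1 s0 s1.+1) = prQ (bmon k r0 r1 r0 (r1 - 1)).
Proof.
have p2 : (2 * p <= q)%N by rewrite -mulnn leq_mul2r prime_gt1 ?orbT.
have ppE : (p * s1.+1 + p = q)%N by rewrite -mulnSr -mulnn; congr (p * _)%N; flia.
have r1E : (p * (r1 - 1) + p = p * r1)%N.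
  by rewrite -mulnSr; congr (p * _)%N; flia.
have r1p : (r1 <= p * r1)%N by rewrite leq_pmull.
have hs : (s0 <= r0)%N by flia.
have ht : (s1.+1 <= r1)%N by flia.
have e1 : (s0 + p * s1.+1 + p = a0 + (q - 1))%N by flia.
have e2 : (r0 + p * (r1 - 1) + p = r0 + p * r1)%N by flia.
have em : (s0 + p * s1.+1 = r0 + p * (r1 - 1) %[mod q - 1])%N.
  by apply/eqP; rewrite -(eqn_modDr p) e1 e2 modnDr r_mod.
have s_gt0 : (0 < s0 + p * s1.+1)%N by flia.
have s_lt : (s0 + p * s1.+1 < r0 + p * r1)%N by flia.
have t_gt0 : (0 < r0 + p * (r1 - 1))%N by flia.
have t_lt : (r0 + p * (r1 - 1) < r0 + p * r1)%N by flia.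
have em' : (r0 + p * r1 - (s0 + p * s1.+1) = r0 + p * r1 - (r0 + p * (r1 - 1)) %[mod q - 1])%N.
  move: em s_lt t_lt; move: (s0 + _)%N (r0 + p * (r1 - 1))%N (r0 + p * r1)%N => m n r em mr nr.
  apply/eqP; rewrite -(eqn_modDr m) subnK; last exact: ltnW.
  by rewrite -modnDmr em modnDmr subnK // ltnW.
apply: (prQ_ev p_prime r0_ge r1_ge) => [||x y].
- exact: bihom_bmon.
- by apply: bihom_bmon => //; apply: leq_subr.
rewrite !(ev_bmon p_prime) ?leq_subr //.
by congr (_ * _); apply: iota_mod => //; rewrite subn_gt0.
Qed.

(** The factor 1/(p - 1) in [j0] is -1. This sign makes the second part of the Hecke formula cancel
    the first, in accordance with [hecke_relation]. *)
Lemma j0_lowest : j0 (bmon k s0 s1 s0 s1) = - prQ (bmon k r0 r1 r0 (r1 - 1)).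
Proof.
rewrite j0_bmon prQ_lowest -scaleN1r; congr (_ *: _).
have -> : (s1.+1%:R : k) = -1.
  apply/eqP; rewrite -subr_eq0 opprK natr1 -(dvdn_pcharf (pchark S p_prime)).
  by rewrite (_ : s1.+2 = p) //; flia.
by rewrite invrN1.
Qed.

Lemma j0_top : j0 (bmon k s0 s1 0 0) = prQ (bmon k r0 r1 0 1).
Proof. by rewrite j0_bmon invr1 scale1r. Qed.

Lemma aWtP l c u v : aWt l (c *: u + v) = c *: aWt l u + aWt l v.
Proof. exact: linearP. Qed.
Lemma bWtP c u v : bWt (c *: u + v) = c *: bWt u + bWt v.
Proof. exact: linearP. Qed.
Lemma bihom_aWt l w : bihom s0 s1 w -> bihom s0 s1 (aWt l w).
Proof. exact: bihom_subst2. Qed.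
Lemma bihom_bWt w : bihom s0 s1 w -> bihom s0 s1 (bWt w).
Proof. exact: bihom_subst2. Qed.

(** On a monomial of the weight, [aWt] gives a multiple of the highest monomial and [bWt] gives zero
    unless the monomial is the lowest one; read through [j0], the claim becomes [hecke_relation]. *)
Lemma tauQ_hecke g w : g \in unitmx -> bihom s0 s1 w ->
  \sum_(l : Fq) tauQ (g *m alpl l) (j0 (aWt l w)) + tauQ (g *m alp) (j0 (bWt w)) = 0.
Proof.
move=> ug.
have ugl l : g *m alpl l \in unitmx by rewrite unitmx_mul ug unit_alpl.
have uga : g *m alp \in unitmx by rewrite unitmx_mul ug unit_alp.
have tauQ_j0P h c u v : h \in unitmx ->
    tauQ h (j0 (c *: u + v)) = c *: tauQ h (j0 u) + tauQ h (j0 v).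
  by move=> uh; rewrite j0P; apply: tauQ_linear.
have j00 : j0 0 = 0 by exact: linear0.
move: w; apply: bihom_ind => [|c i j w hi hj IH].
  have -> : bWt 0 = 0 by exact: linear0.
  rewrite j00 (tauQ_0 p_prime r0_ge r1_ge ap_neq0 ap_bnd uga) addr0 big1 // => l _.
  have -> : aWt l 0 = 0 by exact: linear0.
  by rewrite j00; exact: (tauQ_0 p_prime r0_ge r1_ge ap_neq0 ap_bnd (ugl l)).
rewrite bWtP (tauQ_j0P _ _ _ _ uga).
have -> : \sum_l tauQ (g *m alpl l) (j0 (aWt l (c *: bmon k s0 s1 i j + w))) =
  c *: \sum_l tauQ (g *m alpl l) (j0 (aWt l (bmon k s0 s1 i j))) + \sum_l tauQ (g *m alpl l) (j0 (aWt l w)).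
  rewrite scaler_sumr -big_split; apply: eq_bigr => l _.
  by rewrite aWtP; exact: (tauQ_j0P _ _ _ _ (ugl l)).
rewrite addrACA IH addr0 -scalerDr.
have -> : \sum_l tauQ (g *m alpl l) (j0 (aWt l (bmon k s0 s1 i j))) =
   \sum_l iota (- l) ^+ (i + p * j) *: tau (g *m alpl l) (bmon k r0 r1 0 1).
  apply: eq_bigr => l _; rewrite aWt_bmon // j0Z j0_top.
  rewrite (tauQ_Z p_prime r0_ge r1_ge ap_neq0 ap_bnd _ _ (ugl l)).
  by rewrite (tauQ_pr p_prime r0_ge r1_ge ap_neq0 ap_bnd _ (ugl l)).
rewrite (hecke_relation p_prime p_gt2 r0_ge r1_ge r_mod a0_bnd p_r1 p_r0 ap_bnd hi hj ug).
rewrite bWt_bmon //; case: ifP => _; last first.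
  by rewrite j00 (tauQ_0 p_prime r0_ge r1_ge ap_neq0 ap_bnd uga) addr0 scaler0.
rewrite j0_lowest -scaleN1r (tauQ_Z p_prime r0_ge r1_ge ap_neq0 ap_bnd _ _ uga).
by rewrite (tauQ_pr p_prime r0_ge r1_ge ap_neq0 ap_bnd _ uga) scaleN1r subrr scaler0.
Qed.

Lemma j0_bra g w : bihom s0 s1 w -> j0 \o bra (@actWt p S p) g w = braQ g (j0 w).
Proof.
move=> hw; apply/funext => g' /=; rewrite /bra; case: asboolP => [KZ|_]; last exact: linear0.
apply: (j0_equiv p_prime p_gt2 r0_ge r1_ge r_mod a0_bnd) => //.
exact/map_red_unit/Kpart_in.
Qed.

Lemma j0_comp_sum (I : Type) (s : seq I) (f : I -> 'M[F]_2 -> {mpoly k[4]}) :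
  j0 \o (\sum_(i <- s) f i) = \sum_(i <- s) (j0 \o f i).
Proof.
elim: s => [|i s IH]; first by rewrite !big_nil; apply/funext => g /=; exact: linear0.
by rewrite !big_cons -IH; apply/funext => g /=; exact: linearD.
Qed.

Lemma j0_hecke_bra g w : bihom s0 s1 w ->
  j0 \o hecke_bra (@actWt p S p) aWt bWt g w =
  \sum_(l : Fq) braQ (g *m alpl l) (j0 (aWt l w)) + braQ (g *m alp) (j0 (bWt w)).
Proof.
move=> hw; rewrite -j0_bra; last exact: bihom_bWt.
rewrite (eq_bigr (fun l => j0 \o bra (@actWt p S p) (g *m alpl l) (aWt l w))); last first.
  by move=> l _; rewrite j0_bra //; exact: bihom_aWt.
rewrite -j0_comp_sum; apply/funext => g' /=; exact: linearD.
Qed.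

Lemma inQj0 w : bihom s0 s1 w -> inQ (j0 w).
Proof. exact: (inQ_j0 p_prime p_gt2 r0_ge r1_ge r_mod a0_bnd). Qed.

Lemma ind_j0_hecke_bra g w : g \in unitmx -> bihom s0 s1 w ->
  indQ (j0 \o hecke_bra (@actWt p S p) aWt bWt g w).
Proof.
move=> ug hw; rewrite j0_hecke_bra //; apply: (indQ_D p_prime r0_ge r1_ge).
  apply: (indQ_sum p_prime r0_ge r1_ge) => l _; apply: (braQ_ind p_prime r0_ge r1_ge).
    by rewrite unitmx_mul ug unit_alpl.
  exact/inQj0/bihom_aWt.
apply: (braQ_ind p_prime r0_ge r1_ge); first by rewrite unitmx_mul ug unit_alp.
exact/inQj0/bihom_bWt.
Qed.

Lemma phi_hecke_bra g w : g \in unitmx -> bihom s0 s1 w ->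
  phi ap (j0 \o hecke_bra (@actWt p S p) aWt bWt g w) = 0.
Proof.
move=> ug hw; rewrite j0_hecke_bra //.
have ugl l : g *m alpl l \in unitmx by rewrite unitmx_mul ug unit_alpl.
have uga : g *m alp \in unitmx by rewrite unitmx_mul ug unit_alp.
have Ql l : inQ (j0 (aWt l w)) by exact/inQj0/bihom_aWt.
have Qa := inQj0 (bihom_bWt hw).
have Il l := braQ_ind p_prime r0_ge r1_ge (ugl l) (Ql l).
have Ia := braQ_ind p_prime r0_ge r1_ge uga Qa.
have Is : indQ (\sum_(l : Fq) braQ (g *m alpl l) (j0 (aWt l w))).
  by apply: (indQ_sum p_prime r0_ge r1_ge) => l _; exact: Il.
have e := phi_linear p_prime r0_ge r1_ge ap_neq0 ap_bnd 1 (ind_weak Is) (ind_weak Ia).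
rewrite !scale1r in e; apply: etrans e _.
apply: etrans (tauQ_hecke ug hw); congr (_ + _).
  rewrite (phi_sum p_prime r0_ge r1_ge ap_neq0 ap_bnd) => [|l _]; last exact: Il.
  apply: eq_bigr => l _.
  exact: (phi_braQ p_prime r0_ge r1_ge ap_neq0 ap_bnd (ugl l) (Ql l)).
exact: (phi_braQ p_prime r0_ge r1_ge ap_neq0 ap_bnd uga Qa).
Qed.

Lemma phi_hecke_soc (T : ('M[F]_2 -> QS) -> 'M[F]_2 -> QS) x :
  is_hecke_socQ T -> indSocQ S r0 r1 x -> phi ap (T x) = 0.
Proof.
move=> [T_lin T_wt] Ix; have phi0 := phi_0 p_prime r0_ge r1_ge ap_neq0 ap_bnd.
(* For x = 0 the linearity of T suffices. Otherwise the socle is nonzero, which is what [wt_hom_j0]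
   requires. *)
have [x0|/existsNP[g /eqP xg]] := pselect (forall g, x g = 0).
  have x_0 : x = 0 by apply/funext.
  have := T_lin (-1) _ _ Ix Ix; rewrite x_0 scaler0 addr0 scaleN1r addNr => ->.
  exact: phi0.
have sx h : socQ (x h) by case: Ix.
have wh := wt_hom_j0 p_prime p_gt2 r0_ge r1_ge r_mod a0_bnd (sx g) xg.
have wP c : exists w, bihom s0 s1 w /\ x c = j0 w.
  have [w hw e] := soc_j0 p_prime p_gt2 r0_ge r1_ge r_mod a0_bnd (sx c).
  by exists w.
have {wP} [w wP] := choice wP.
have [C [CP xC]] := ind_weak Ix.
(* Lifting the values of x through [j0] presents x as the image of a sum of brackets of the weight,
   on which T is prescribed. *)
pose s := [seq (invmx c, w c) | c <- C].
have sP y : y \in s -> y.1 \in unitmx /\ bihom s0 s1 y.2.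
  move=> /mapP[c cC ->] /=; split; last by case: (wP c).
  by rewrite unitmx_inv; case: CP => _ /(_ _ cC)[].
have Hf : heckeWt s0 s1 p (\sum_(y <- s) bra (@actWt p S p) y.1 y.2)
    (\sum_(y <- s) hecke_bra (@actWt p S p) aWt bWt y.1 y.2) by exists s.
have xE : x = j0 \o (\sum_(y <- s) bra (@actWt p S p) y.1 y.2).
  rewrite j0_comp_sum big_map.
  have e := ind_decomp (actQ_linear p_prime r0_ge r1_ge) Ix CP xC.
  apply: etrans e _; apply: eq_bigr => c _ /=.
  by rewrite (j0_bra _ (proj1 (wP c))) -(proj2 (wP c)).
have lt0 : (s0 < p)%N by flia.
have lt1 : (s1 < p)%N by flia.
rewrite xE (T_wt _ _ _ _ lt0 lt1 wh _ _ Hf) j0_comp_sum.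
rewrite (phi_sum p_prime r0_ge r1_ge ap_neq0 ap_bnd).
  rewrite big_seq big1 // => y /sP[u1 h2].
  exact: phi_hecke_bra.
by move=> y /sP[u1 h2]; exact: ind_j0_hecke_bra.
Qed.

End Vanishing.

Theorem theorem9p1 (p : nat) (S : setting p) (k0 k1 a0 : nat) (ap : E S) :
  let q := (p ^ 2)%N in
  let r0 := (k0 - 2)%N in
  let r1 := (k1 - 2)%N in
  prime p -> (2 < p)%N ->
  (q <= r0)%N -> (q <= r1)%N ->
  (r0 + p * r1 = a0 %[mod q - 1])%N ->
  (1 <= a0 <= p - 1)%N ->
  ~~ (p %| r1)%N ->
  (a0 = 1%N -> (p %| r0)%N) ->
  ap != 0 -> 1 / 2 < vE ap < 1 ->
  exists phi : ('M[F S]_2 -> Q S r0 r1) -> ThetaBar r0 r1 ap,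
    natural_on_indQ phi /\
    forall T : ('M[F S]_2 -> Q S r0 r1) -> ('M[F S]_2 -> Q S r0 r1),
      is_hecke_socQ T ->
      forall x, indSocQ S r0 r1 x -> phi (T x) = 0.
Proof.
move=> q r0 r1 p_prime p_gt2 r0_ge r1_ge r_mod a0_bnd p_r1 p_r0 ap_neq0 ap_bnd.
exists (@phi p S r0 r1 ap); split; first exact: phi_natural.
by move=> T T_hecke x; apply: (phi_hecke_soc p_prime r0_ge r1_ge ap_neq0 ap_bnd p_gt2 r_mod).
Qed.
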